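(* Assume that the tensor $C$ satisfies the stated assumptions (symmetric, isotropic, homogeneous and positive), that $f\in C([0,T];L^2(\Omega;\mathbb{R}^d))$, $g\in C([0,T];H^1(\Omega;\mathbb{R}^d))$, $q\in C([0,T];L^2(\Gamma_1;\mathbb{R}^d))$, $\phi^0\in L^2(\Omega;\mathbb{R}^{d\times d}_{\rm sym})$, and that $\{g_h^k\}_{k=0}^{N_T}\subset X_h$ and $\phi_h^0\in\Psi_h$ are given. Then there exists a unique family $\{(u_h^k,\phi_h^k)\in V_h(g_h^k)\times\Psi_h;\ k=0,\dots,N_T\}$, whose component $\phi_h^0$ is the given one, such that $$(\sigma[u_h^k,\phi_h^k],e[v_h])_\Psi=\ell^k(v_h)\quad\forall v_h\in V_h,\quad k=0,\dots,N_T,$$ $$\eta\overline{D}_\tau\phi_h^k+\alpha\phi_h^k-\sigma[u_h^k,\phi_h^k]=0\ \text{ in }\Psi_h,\quad k=1,\dots,N_T.$$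
   Context: Let $d\in\{2,3\}$, $T>0$, and let $\Omega\subset\mathbb{R}^d$ be a bounded Lipschitz domain with boundary $\Gamma=\partial\Omega$. $\Gamma_0$ is an open subset of $\Gamma$ whose $(d-1)$-dimensional measure is positive and equal to that of $\overline{\Gamma}_0$, and $\Gamma_1=\Gamma\setminus\overline{\Gamma}_0$ (the case $\Gamma_0=\Gamma$, $\Gamma_1=\emptyset$ is allowed). $\eta>0$ and $\alpha\ge0$ are constants. $\mathbb{R}^{d\times d}_{\rm sym}$ is the space of real symmetric $d\times d$ matrices; $A:B=\sum_{i,j}A_{ij}B_{ij}$. Tensor $C=(c_{ijkl})$: $c_{ijkl}=\lambda\delta_{ij}\delta_{kl}+\mu(\delta_{ik}\delta_{jl}+\delta_{il}\delta_{jk})$ with constants $\lambda,\mu\in\mathbb{R}$, and there is $c_\ast>0$ with $\sum_{i,j,k,l}c_{ijkl}\xi_{ij}\xi_{kl}\ge c_\ast|\xi|^2$ for all $\xi\in\mathbb{R}^{d\times d}_{\rm sym}$, where $|\xi|^2=\sum_{i,j}\xi_{ij}^2$. It acts by $(C\xi)_{ij}=\sum_{k,l}c_{ijkl}\xi_{kl}$. Notation: $e[u]=\frac12[\nabla u+(\nabla u)^T]$, $\sigma[u,\phi]=C(e[u]-\phi)$. $X=H^1(\Omega;\mathbb{R}^d)$; $V(g_0)=\{v\in X: v|_{\Gamma_0}=g_0|_{\Gamma_0}\}$ (traces) for $g_0\in X$; $\Psi=L^2(\Omega;\mathbb{R}^{d\times d}_{\rm sym})$ with $(\phi,\psi)_\Psi=\int_\Omega\phi:\psi\,dx$.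 $(\cdot,\cdot)$ is the inner product of $L^2(\Omega;\mathbb{R}^d)$. Time discretization: $\tau>0$ is a time increment, $N_T=\lfloor T/\tau\rfloor$, $t^k=k\tau$, $\rho^k=\rho(\cdot,t^k)$ for a time-dependent function $\rho$ given in the data; $\overline{D}_\tau\rho^k=(\rho^k-\rho^{k-1})/\tau$ for any sequence $\rho^k$; $\ell^k(v)=(f^k,v)+\int_{\Gamma_1}q^k\cdot v\,ds$. Finite element spaces: $\mathcal{T}_h=\{K\}$ is a triangulation of $\Omega$ into simplices with representative size $h$, and it is assumed that $\Omega=\mathrm{int}(\bigcup_{K\in\mathcal{T}_h}K)$. $X_h=\{v_h\in C(\overline\Omega;\mathbb{R}^d): v_h|_K \text{ is a polynomial map of degree at most }1\ \forall K\in\mathcal{T}_h\}$; $\Psi_h=\{\psi_h\in L^2(\Omega;\mathbb{R}^{d\times d}_{\rm sym}):\psi_h|_K\text{ is constant }\forall K\in\mathcal{T}_h\}$; $V_h(g_{0h})=X_h\cap V(g_{0h})$ for $g_{0h}\in X_h$, and $V_h=V_h(0)$. *)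

(* Defs.v *)
From HB Require Import structures.
From mathcomp Require Import all_boot all_order all_algebra.
From mathcomp Require Import all_classical all_reals all_analysis.

Set Implicit Arguments.
Unset Strict Implicit.
Unset Printing Implicit Defensive.
Import Order.TTheory GRing.Theory Num.Theory.
Import numFieldNormedType.Exports.

Local Open Scope classical_set_scope.
Local Open Scope ring_scope.

(* Points and vectors of R^d are row vectors 'rV[R]_d.  Elements of L^2 and H^1
   are represented by functions on the whole space R^d of which only the values
   on the relevant set matter; equality in L^2 is equality almost everywhere. *)

(** Euclidean structure *)

Definition mdot (R : realType) m n (A B : 'M[R]_(m, n)) : R :=
  \sum_i \sum_j A i j * B i j.

Definition enorm (R : realType) m n (A : 'M[R]_(m, n)) : R :=
  Num.sqrt (mdot A A).

Definition eball (R : realType) d (x : 'rV[R]_d) (r : R) : set 'rV[R]_d :=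
  [set y | enorm (y - x) < r].

(** Outer measures defined by countable covers *)

(* The empty set has cost 0, so finite covers are countable covers. *)
Definition cost0 (R : realType) (T : Type) (c : set T -> \bar R) (F : set T)
    : \bar R :=
  if `[< F = set0 >] then 0%E else c F.

Definition cover_ext (R : realType) (T : Type) (c : set T -> \bar R)
    (A : set T) : \bar R :=
  ereal_inf [set (\sum_(k <oo) cost0 c (F k))%E |
             F in [set F : (set T)^nat | A `<=` \bigcup_k F k]].

(* A copy of T in which every set is measurable: the library's [mu_ext] then
   coincides with [cover_ext]. *)
Definition discr (T : Type) := T.

Section discr.
Variable T : pointedType.
HB.instance Definition _ := Pointed.on (discr T).
HB.instance Definition _ := @isMeasurable.Build default_measure_display
  (discr T) setT I (fun _ _ => I) (fun _ _ => I).
End discr.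

Section cover_ext_outer.
Variables (R : realType) (T : pointedType) (c : set T -> \bar R).
Hypothesis c_ge0 : forall F, (0 <= c F)%E.

Lemma cost0_set0 : cost0 c set0 = 0%E.
Proof. by rewrite /cost0 asboolT. Qed.

Lemma cost0_ge0 F : (0 <= cost0 c F)%E.
Proof. by rewrite /cost0; case: ifP. Qed.

Lemma cover_extE (A : set T) :
  cover_ext c A = @mu_ext _ (discr T) R (cost0 c) A.
Proof.
congr ereal_inf; apply/seteqP; split=> x [F FA <-]; exists F => //.
by case: FA.
Qed.

Lemma cover_ext0 : cover_ext c set0 = 0%E.
Proof. by rewrite cover_extE mu_ext0 //; [exact: cost0_set0|exact: cost0_ge0]. Qed.

Lemma cover_ext_ge0 A : (0 <= cover_ext c A)%E.
Proof. by rewrite cover_extE mu_ext_ge0 //; exact: cost0_ge0. Qed.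

Lemma le_cover_ext : {homo cover_ext c : A B / A `<=` B >-> (A <= B)%E}.
Proof. by move=> A B AB; rewrite !cover_extE; exact: (@le_mu_ext _ (discr T)). Qed.

Lemma cover_ext_sigma_subadditive : sigma_subadditive (cover_ext c).
Proof.
move=> F; rewrite cover_extE.
rewrite (eq_eseriesr (fun i _ => cover_extE (F i))).
by apply: (@mu_ext_sigma_subadditive _ (discr T)); exact: cost0_ge0.
Qed.

End cover_ext_outer.

(** Lebesgue measure on R^d *)

Definition box (R : realType) d (a b : 'rV[R]_d) : set 'rV[R]_d :=
  [set x | forall i, a 0 i <= x 0 i <= b 0 i].

Definition box_cost (R : realType) d (F : set 'rV[R]_d) : \bar R :=
  ereal_inf [set (\prod_(i < d) (ab.2 0 i - ab.1 0 i))%:E |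
             ab in [set ab : 'rV[R]_d * 'rV[R]_d |
                    (forall i, ab.1 0 i <= ab.2 0 i) /\ F `<=` box ab.1 ab.2]].

Definition lebesgue_outer (R : realType) d : set 'rV[R]_d -> \bar R :=
  cover_ext (@box_cost R d).

Lemma box_cost_ge0 (R : realType) d (F : set 'rV[R]_d) : (0 <= box_cost F)%E.
Proof.
apply: le_ereal_inf_tmp => _ [[a b] /= [ab _] <-].
by rewrite lee_fin prodr_ge0 // => i _; rewrite subr_ge0.
Qed.

HB.instance Definition _ (R : realType) d :=
  isOuterMeasure.Build R 'rV[R]_d (@lebesgue_outer R d)
    (cover_ext0 (@box_cost_ge0 R d))
    (cover_ext_ge0 (@box_cost_ge0 R d))
    (@le_cover_ext R 'rV[R]_d (@box_cost R d))
    (cover_ext_sigma_subadditive (@box_cost_ge0 R d)).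

Definition vol (R : realType) d
    : {measure set (caratheodory_type (@lebesgue_outer R d)) -> \bar R} :=
  (OuterMeasure.sort (@lebesgue_outer R d)
   : set (caratheodory_type (@lebesgue_outer R d)) -> \bar R).

(** m-dimensional Hausdorff measure on R^d *)

(* Volume of the unit ball of R^m. *)
Fixpoint ball_volume (R : realType) (m : nat) : R :=
  match m with
  | 0 => 1
  | 1 => 2
  | k.+2 => 2 * pi / k.+2%:R * ball_volume R k
  end.

Definition diam_cost (R : realType) d (m : nat) (delta : R) (F : set 'rV[R]_d)
    : \bar R :=
  ereal_inf [set (ball_volume R m * (r / 2) ^+ m)%:E |
             r in [set r : R | [/\ 0 <= r, r <= delta &
               forall x y, F x -> F y -> enorm (x - y) <= r]]].

Definition hausdorff_outer (R : realType) d (m : nat) (A : set 'rV[R]_d)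
    : \bar R :=
  ereal_sup [set cover_ext (@diam_cost R d m delta) A |
             delta in [set delta : R | 0 < delta]].

Lemma ball_volume_ge0 (R : realType) m : 0 <= ball_volume R m.
Proof.
suff: 0 <= ball_volume R m /\ 0 <= ball_volume R m.+1 by case.
elim: m => [|m [ih1 ih2]] //; split=> //.
rewrite [ball_volume _ _]/= -/(ball_volume R m) mulr_ge0 // divr_ge0 //.
by rewrite mulr_ge0 // pi_ge0.
Qed.

Lemma diam_cost_ge0 (R : realType) d m (delta : R) (F : set 'rV[R]_d) :
  (0 <= diam_cost m delta F)%E.
Proof.
apply: le_ereal_inf_tmp => _ [r [r0 _ _] <-].
by rewrite lee_fin mulr_ge0 ?ball_volume_ge0 // exprn_ge0 // divr_ge0.
Qed.

Section hausdorff_outer_measure.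
Variables (R : realType) (d m : nat).
Local Notation H := (@hausdorff_outer R d m).
Let c_ge0 (delta : R) := @diam_cost_ge0 R d m delta.

Lemma le_cover_ext_hausdorff (delta : R) A : 0 < delta ->
  (cover_ext (diam_cost m delta) A <= H A)%E.
Proof. by move=> d0; apply: ereal_sup_ubound; exists delta. Qed.

Lemma hausdorff_outer_ge0 A : (0 <= H A)%E.
Proof.
exact: le_trans (cover_ext_ge0 (c_ge0 1) A) (le_cover_ext_hausdorff A ltr01).
Qed.

Lemma hausdorff_outer0 : H set0 = 0%E.
Proof.
apply/eqP; rewrite eq_le hausdorff_outer_ge0 andbT.
by apply: ge_ereal_sup => _ [delta _ <-]; rewrite cover_ext0.
Qed.

Lemma le_hausdorff_outer : {homo H : A B / A `<=` B >-> (A <= B)%E}.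
Proof.
move=> A B AB; apply: ge_ereal_sup => _ [delta d0 <-].
exact: le_trans (le_cover_ext _ AB) (le_cover_ext_hausdorff _ d0).
Qed.

Lemma hausdorff_outer_sigma_subadditive : sigma_subadditive H.
Proof.
move=> F; apply: ge_ereal_sup => _ [delta d0 <-].
apply: le_trans (cover_ext_sigma_subadditive (c_ge0 delta) F) _.
apply: lee_nneseries => [i _ _|i _]; first exact: cover_ext_ge0.
exact: le_cover_ext_hausdorff.
Qed.

End hausdorff_outer_measure.

HB.instance Definition _ (R : realType) d m :=
  isOuterMeasure.Build R 'rV[R]_d (@hausdorff_outer R d m)
    (hausdorff_outer0 R d m)
    (@hausdorff_outer_ge0 R d m)
    (@le_hausdorff_outer R d m)
    (@hausdorff_outer_sigma_subadditive R d m).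

(* Surface measure ds on hypersurfaces of R^d. *)
Definition surf (R : realType) d
    : {measure set (caratheodory_type (@hausdorff_outer R d d.-1)) -> \bar R} :=
  (OuterMeasure.sort (@hausdorff_outer R d d.-1)
   : set (caratheodory_type (@hausdorff_outer R d d.-1)) -> \bar R).

(** Lipschitz domains *)

Definition bdry (T : topologicalType) (A : set T) : set T :=
  closure A `\` A°.

(* Near each boundary point, Omega is the part lying above the graph of a
   Lipschitz function, in the direction of some unit vector e.  A Lipschitz
   function of the d-1 coordinates orthogonal to e is the same as a Lipschitz
   function on R^d that is invariant under translations along e. *)
Definition lipschitz_boundary (R : realType) d (Omega : set 'rV[R]_d) : Prop :=
  forall x, bdry Omega x ->
  exists (U : set 'rV[R]_d) (e : 'rV[R]_d) (gam : 'rV[R]_d -> R),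
    [/\ open U /\ U x, enorm e = 1, lipschitz gam,
        (forall y t, gam (y + t *: e) = gam y) &
        forall y, U y -> (Omega y <-> gam y < mdot y e)].

Definition bounded_lipschitz_domain (R : realType) d (Omega : set 'rV[R]_d)
    : Prop :=
  [/\ open Omega, connected Omega, bounded_set Omega &
      lipschitz_boundary Omega].

(* Gamma0 is open in Gamma and has positive (d-1)-dimensional measure, equal to
   that of its closure. *)
Definition dirichlet_part (R : realType) d (Omega Gamma0 : set 'rV[R]_d)
    : Prop :=
  [/\ exists2 U, open U & Gamma0 = bdry Omega `&` U,
      (0 < surf R d Gamma0)%E &
      surf R d Gamma0 = surf R d (closure Gamma0)].

Definition neumann_part (R : realType) d (Omega Gamma0 : set 'rV[R]_d)
    : set 'rV[R]_d :=
  bdry Omega `\` closure Gamma0.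

(** Matrix-valued L^2 functions; vector-valued ones are the case m = 1 *)

Definition L2 (R : realType) disp (T : measurableType disp)
    (mu : {measure set T -> \bar R}) (A : set T) m n (f : T -> 'M[R]_(m, n))
    : Prop :=
  (forall i j, measurable_fun A (fun x => f x i j)) /\
  (\int[mu]_(x in A) (mdot (f x) (f x))%:E < +oo)%E.

Definition L2dot (R : realType) disp (T : measurableType disp)
    (mu : {measure set T -> \bar R}) (A : set T) m n (f g : T -> 'M[R]_(m, n))
    : R :=
  \int[mu]_(x in A) mdot (f x) (g x).

Definition L2dist (R : realType) disp (T : measurableType disp)
    (mu : {measure set T -> \bar R}) (A : set T) m n (f g : T -> 'M[R]_(m, n))
    : R :=
  Num.sqrt (L2dot mu A (fun x => f x - g x) (fun x => f x - g x)).

(* f belongs to C([0, Tmax]; L^2(A)). *)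
Definition continuous_in_L2 (R : realType) disp (T : measurableType disp)
    (mu : {measure set T -> \bar R}) (A : set T) m n (Tmax : R)
    (f : R -> T -> 'M[R]_(m, n)) : Prop :=
  forall t, t \in `[0, Tmax] ->
    L2 mu A (f t) /\
    L2dist mu A (f s) (f t) @[s --> within [set` `[0, Tmax]] (nbhs t)] --> 0.

(** Sobolev space H^1(Omega; R^d) *)

(* Continuously differentiable with compact support in Omega; for L^2 functions
   this class of test functions gives the same weak derivatives as C_c^oo. *)
Definition test_function (R : realType) d (Omega : set 'rV[R]_d)
    (p : 'rV[R]_d -> R) : Prop :=
  [/\ forall x, differentiable p x,
      forall j : 'I_d, continuous (fun x => 'D_(delta_mx 0 j) p x) &
      exists K : set 'rV[R]_d,
        [/\ compact K, K `<=` Omega & forall x, ~ K x -> p x = 0]].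

(* G x i j is the weak partial derivative d u_i / d x_j at x. *)
Definition weak_gradient (R : realType) d (Omega : set 'rV[R]_d)
    (u : 'rV[R]_d -> 'rV[R]_d) (G : 'rV[R]_d -> 'M[R]_d) : Prop :=
  L2 (vol R d) Omega G /\
  forall (p : 'rV[R]_d -> R), test_function Omega p -> forall i j : 'I_d,
    \int[vol R d]_(x in Omega) (u x 0 i * 'D_(delta_mx 0 j) p x) =
    - \int[vol R d]_(x in Omega) (G x i j * p x).

Definition H1 (R : realType) d (Omega : set 'rV[R]_d)
    : set ('rV[R]_d -> 'rV[R]_d) :=
  [set u | L2 (vol R d) Omega u /\ exists G, weak_gradient Omega u G].

(* A representative of the weak gradient, which is unique almost everywhere. *)
Definition grad (R : realType) d (Omega : set 'rV[R]_d)
    (u : 'rV[R]_d -> 'rV[R]_d) : 'rV[R]_d -> 'M[R]_d :=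
  xget (fun=> 0) [set G | weak_gradient Omega u G].

(* g belongs to C([0, Tmax]; H^1(Omega)). *)
Definition continuous_in_H1 (R : realType) d (Omega : set 'rV[R]_d) (Tmax : R)
    (g : R -> 'rV[R]_d -> 'rV[R]_d) : Prop :=
  (forall t, t \in `[0, Tmax] -> H1 Omega (g t)) /\
  continuous_in_L2 (vol R d) Omega Tmax g /\
  continuous_in_L2 (vol R d) Omega Tmax (fun t => grad Omega (g t)).

(* Boundary trace.  On a bounded Lipschitz domain the trace of an H^1 function
   at surface-almost every boundary point x is the limit of its mean values over
   B(x, r) `&` Omega as r tends to 0+ (Evans and Gariepy, Measure Theory and
   Fine Properties of Functions, Section 5.3). *)
Definition mean (R : realType) d (A : set 'rV[R]_d) (p : 'rV[R]_d -> R) : R :=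
  (\int[vol R d]_(x in A) p x) / fine (vol R d A).

Definition trace (R : realType) d (Omega : set 'rV[R]_d)
    (u : 'rV[R]_d -> 'rV[R]_d) (x : 'rV[R]_d) : 'rV[R]_d :=
  \row_i lim (mean (Omega `&` eball x r) (fun y => u y 0 i) @[r --> 0^'+]).

(* V(g0) *)
Definition Vaff (R : realType) d (Omega Gamma0 : set 'rV[R]_d)
    (g0 : 'rV[R]_d -> 'rV[R]_d) : set ('rV[R]_d -> 'rV[R]_d) :=
  [set v | H1 Omega v /\
           trace Omega v = trace Omega g0 %[ae surf R d in Gamma0]].

(* Psi = L^2(Omega; symmetric matrices) *)
Definition Psi (R : realType) d (Omega : set 'rV[R]_d)
    : set ('rV[R]_d -> 'M[R]_d) :=
  [set psi | L2 (vol R d) Omega psi /\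
             (\forall x \ae vol R d, Omega x -> (psi x)^T = psi x)].

(** Elasticity tensor *)

Definition ctensor (R : realType) d (lam mu : R) (i j k l : 'I_d) : R :=
  lam * (i == j)%:R * (k == l)%:R +
  mu * ((i == k)%:R * (j == l)%:R + (i == l)%:R * (j == k)%:R).

Definition Capp (R : realType) d (lam mu : R) (xi : 'M[R]_d) : 'M[R]_d :=
  \matrix_(i, j) \sum_k \sum_l ctensor lam mu i j k l * xi k l.

Definition ctensor_positive (R : realType) d (lam mu : R) : Prop :=
  exists2 cstar : R, 0 < cstar &
  forall xi : 'M[R]_d, xi^T = xi ->
    \sum_i \sum_j \sum_k \sum_l ctensor lam mu i j k l * xi i j * xi k l >=
    cstar * \sum_i \sum_j xi i j ^+ 2.

Definition strain (R : realType) d (Omega : set 'rV[R]_d)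
    (u : 'rV[R]_d -> 'rV[R]_d) (x : 'rV[R]_d) : 'M[R]_d :=
  2^-1 *: (grad Omega u x + (grad Omega u x)^T).

Definition stress (R : realType) d (Omega : set 'rV[R]_d) (lam mu : R)
    (u : 'rV[R]_d -> 'rV[R]_d) (phi : 'rV[R]_d -> 'M[R]_d) (x : 'rV[R]_d)
    : 'M[R]_d :=
  Capp lam mu (strain Omega u x - phi x).

(** Finite elements *)

(* A d-simplex is given by the (d+1) x d matrix whose rows are its vertices;
   [face S I] is the closed face spanned by the vertices with index in I. *)
Definition face (R : realType) d (S : 'M[R]_(d.+1, d)) (I : {set 'I_d.+1})
    : set 'rV[R]_d :=
  [set x | exists w : 'rV[R]_d.+1,
     [/\ forall i, 0 <= w 0 i, \sum_i w 0 i = 1,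
         forall i, i \notin I -> w 0 i = 0 & x = w *m S]].

Definition simplex (R : realType) d (S : 'M[R]_(d.+1, d)) : set 'rV[R]_d :=
  face S [set: 'I_d.+1]%SET.

Definition nondegenerate_simplex (R : realType) d (S : 'M[R]_(d.+1, d)) : Prop :=
  row_free (row_mx (const_mx 1 : 'cV[R]_d.+1) S).

(* A conforming finite triangulation: two elements meet along a common face
   (possibly the empty one). *)
Definition triangulation (R : realType) d (Omega : set 'rV[R]_d)
    (Th : seq 'M[R]_(d.+1, d)) : Prop :=
  [/\ forall S, S \in Th -> nondegenerate_simplex S,
      forall S S', S \in Th -> S' \in Th -> exists I I' : {set 'I_d.+1},
        simplex S `&` simplex S' = face S I /\
        simplex S `&` simplex S' = face S' I' &
      Omega = (\bigcup_(S in [set` Th]) simplex S)°].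

Definition Xh (R : realType) d (Omega : set 'rV[R]_d)
    (Th : seq 'M[R]_(d.+1, d)) : set ('rV[R]_d -> 'rV[R]_d) :=
  [set v | {within closure Omega, continuous v} /\
     forall S, S \in Th -> exists (A : 'M[R]_d) (b : 'rV[R]_d),
       forall x, simplex S x -> v x = x *m A + b].

Definition Psih (R : realType) d (Omega : set 'rV[R]_d)
    (Th : seq 'M[R]_(d.+1, d)) : set ('rV[R]_d -> 'M[R]_d) :=
  [set psi | Psi Omega psi /\
     forall S, S \in Th -> exists M : 'M[R]_d,
       \forall x \ae vol R d, (Omega `&` simplex S) x -> psi x = M].

Definition Vh (R : realType) d (Omega Gamma0 : set 'rV[R]_d)
    (Th : seq 'M[R]_(d.+1, d)) (g0h : 'rV[R]_d -> 'rV[R]_d)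
    : set ('rV[R]_d -> 'rV[R]_d) :=
  Xh Omega Th `&` Vaff Omega Gamma0 g0h.

(** The fully discrete problem *)

(* l^k(v), with f^k = f(k tau) and q^k = q(k tau) *)
Definition load (R : realType) d (Omega Gamma0 : set 'rV[R]_d) (tau : R)
    (f q : R -> 'rV[R]_d -> 'rV[R]_d) (k : nat) (v : 'rV[R]_d -> 'rV[R]_d) : R :=
  L2dot (vol R d) Omega (f (k%:R * tau)) v +
  L2dot (surf R d) (neumann_part Omega Gamma0) (q (k%:R * tau))
    (trace Omega v).

(* Backward difference quotient; only used for k >= 1. *)
Definition bdiff (R : realType) d (tau : R) (phi : nat -> 'rV[R]_d -> 'M[R]_d)
    (k : nat) (x : 'rV[R]_d) : 'M[R]_d :=
  tau^-1 *: (phi k x - phi k.-1 x).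

Definition discrete_solution (R : realType) d (Omega Gamma0 : set 'rV[R]_d)
    (Th : seq 'M[R]_(d.+1, d)) (lam mu eta alpha tau : R) (N : nat)
    (f q : R -> 'rV[R]_d -> 'rV[R]_d) (gh : nat -> 'rV[R]_d -> 'rV[R]_d)
    (phi0h : 'rV[R]_d -> 'M[R]_d)
    (u : nat -> 'rV[R]_d -> 'rV[R]_d) (phi : nat -> 'rV[R]_d -> 'M[R]_d)
    : Prop :=
  [/\ forall k, (k <= N)%N ->
        Vh Omega Gamma0 Th (gh k) (u k) /\ Psih Omega Th (phi k),
      phi 0%N = phi0h %[ae vol R d in Omega],
      forall k, (k <= N)%N -> forall v, Vh Omega Gamma0 Th (fun=> 0) v ->
        L2dot (vol R d) Omega (stress Omega lam mu (u k) (phi k))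
          (strain Omega v) =
        load Omega Gamma0 tau f q k v &
      forall k, (1 <= k <= N)%N ->
        \forall x \ae vol R d, Omega x ->
          eta *: bdiff tau phi k x + alpha *: phi k x
          - stress Omega lam mu (u k) (phi k) x = 0].

(* Main.v *)
Require Import Defs.
From HB Require Import structures.
From mathcomp Require Import all_boot all_order all_algebra.
From mathcomp Require Import all_classical all_reals all_analysis.
From mathcomp Require Import measurable_realfun ring lra.

Set Implicit Arguments.
Unset Strict Implicit.
Unset Printing Implicit Defensive.
Import Order.TTheory GRing.Theory Num.Theory.
Import numFieldNormedType.Exports.

Local Open Scope classical_set_scope.
Local Open Scope ring_scope.

(** The scheme is solved one time step at a time.  At step k >= 1 the second
    equation is algebraic at almost every point: with gamma = eta / tau + alpha it
    reads (gamma + C) phi^k = C e[u^k] + (eta / tau) phi^(k-1), and gamma + C is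
    invertible since C is nonnegative.  Inserting phi^k into the stress leaves
    gamma C (gamma + C)^-1 e[u^k] plus a known field ([stress_euler_step]), and the
    tensor gamma C (gamma + C)^-1 is again positive definite on symmetric matrices
    ([resolvent_pos]).  At step 0, where phi^0 is given, the tensor is C itself.  So
    each step is an elliptic problem for the displacement alone, on the space of
    continuous piecewise affine functions that vanish on Gamma_0.  Such functions
    are determined by finitely many vertex values, so existence follows from
    definiteness of the energy ([galerkin], [elliptic_exists]); uniqueness follows
    from the same definiteness by testing with the difference of two solutions
    ([elliptic_unique]), and propagates along the time steps by induction.

    Definiteness of the energy is the statement that a piecewise affine function w
    with e[w] = 0 almost everywhere and zero trace on Gamma_0 vanishes
    ([Xh_rigid_eq0]).  The slopes of w are skew-symmetric, so that increments of w
    along segments in Omega are orthogonal to the segments; polarization shows that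
    w is locally, hence by connectedness globally, a rigid displacement x M + c
    with M skew-symmetric.  If M is nonzero, two coordinates of the points of the
    zero set depend on the other d - 2, so that this set is a null set for the
    (d-1)-dimensional Hausdorff measure ([rigid_zeros_surf_null]) and cannot contain
    almost all of Gamma_0.

    The strain and the trace are defined by weak derivatives and by limits of
    means, so they have to be computed for finite element functions.  The weak
    gradient of a continuous piecewise affine function is its piecewise slope
    ([Xh_weak_gradient]): difference quotients are moved from the test function to
    the finite element function by a translation, and both sides converge boundedly
    ([integration_by_parts]).  Weak gradients are unique by the fundamental lemma of
    the calculus of variations ([fundamental_lemma]).  The trace is the restriction
    to the boundary ([trace_continuous]).

    This rests on the following facts about the measures: open sets are measurable
    for both, since half-spaces are ([vol_halfspace], [hausdorff_halfspace]); volume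
    is translation invariant, and positive on nonempty open sets ([vol_open_gt0]);
    bounded pieces of hyperplanes have zero volume and finite surface measure, which
    makes the facets of the triangulation negligible ([skeleton_vol_null]) and the
    boundary of finite surface measure ([surf_bdry_fin]). *)

(** * Outer measures given by countable covers *)

Section cover_ext_lemmas.
Variables (R : realType) (T : pointedType) (c : set T -> \bar R).
Hypothesis c_ge0 : forall F, (0 <= c F)%E.

(** A cover of X is cut into covers of its two parts: additivity of the outer
    measure on a pair of sets only has to be checked on the covering sets. *)
Lemma cover_ext_split (A B X : set T) :
  (forall F, cost0 c (F `&` A) + cost0 c (F `&` B) <= cost0 c F)%E ->
  (cover_ext c (X `&` A) + cover_ext c (X `&` B) <= cover_ext c X)%E.
Proof.
move=> cAB; apply: le_ereal_inf_tmp => _ [F XF <-].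
have cover (C : set T) :
    (cover_ext c (X `&` C) <= \sum_(k <oo) cost0 c (F k `&` C))%E.
  apply: ereal_inf_lbound; exists (fun k => F k `&` C) => //.
  by move=> x [/XF [k _ Fkx] Cx]; exists k.
apply: (le_trans (leeD (cover A) (cover B))).
rewrite -nneseriesD; [|by move=> i _ _; exact: cost0_ge0..].
by apply: lee_nneseries => i _ //; rewrite adde_ge0 //; exact: cost0_ge0.
Qed.

Lemma cover_ext_le_cost (F : set T) : (cover_ext c F <= cost0 c F)%E.
Proof.
rewrite /cover_ext; apply: ereal_inf_lbound.
exists (fun k => if k is 0%N then F else set0).
  by move=> x Fx; exists 0%N.
rewrite nneseries_recl //; last by move=> k; case: k => [|k] *; exact: cost0_ge0.
rewrite eseries_cond/= eseries0 ?adde0 // => -[|k] //= _ _.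
exact: cost0_set0.
Qed.

End cover_ext_lemmas.

Lemma cost0_le (R : realType) (T : Type) (c : set T -> \bar R) (F : set T) v :
  (0 <= v)%E -> (c F <= v)%E -> (cost0 c F <= v)%E.
Proof. by rewrite /cost0; case: ifP. Qed.

(** * Coordinate half-spaces generate the open sets *)

Definition obox (R : realType) d (a b : 'rV[R]_d) : set 'rV[R]_d :=
  [set x | forall i, a 0 i < x 0 i < b 0 i].

Lemma obox_sub_box (R : realType) d (a b : 'rV[R]_d) : obox a b `<=` box a b.
Proof. by move=> x xab i; have /andP[/ltW -> /ltW ->] := xab i. Qed.

Definition rat_row (R : realType) d (a : 'rV[rat]_d) : 'rV[R]_d :=
  \row_i ratr (a 0 i).

Lemma open_bigcup_obox (R : realType) d (U : set 'rV[R]_d) : open U ->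
  U = \bigcup_(ab in [set ab : 'rV[rat]_d * 'rV[rat]_d |
                       box (rat_row R ab.1) (rat_row R ab.2) `<=` U])
        obox (rat_row R ab.1) (rat_row R ab.2).
Proof.
move=> oU; apply/seteqP; split=> [x Ux|x [ab /= abU] /obox_sub_box]; last first.
  exact: abU.
have /nbhs_ballP[e /= e0 eU] : nbhs x U by exact: open_nbhs_nbhs.
have /choice[a ha] : forall i : 'I_d, exists q : rat,
    ratr q \in `]x 0 i - e, x 0 i[.
  by move=> i; apply: rat_in_itvoo; rewrite ltrBlDr ltrDl.
have /choice[b hb] : forall i : 'I_d, exists q : rat,
    ratr q \in `]x 0 i, x 0 i + e[.
  by move=> i; apply: rat_in_itvoo; rewrite ltrDl.
exists (\row_i a i, \row_i b i) => /=; last first.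
  move=> i; rewrite !mxE; move: (ha i) (hb i); rewrite !in_itv /=.
  by move=> /andP[_ ->] /andP[->].
move=> y yab; apply: eU; split=> // k i; rewrite ord1 /ball /=.
have := yab i; rewrite !mxE => /andP[ay yb].
move: (ha i) (hb i); rewrite !in_itv /= => /andP[h1 _] /andP[_ h2].
rewrite ltr_distl; apply/andP; split; lra.
Qed.

(** Countable set operations build the rational boxes from half-spaces, and the
    open sets from the rational boxes. *)
Lemma open_caratheodory (R : realType) d (nu : {outer_measure set 'rV[R]_d -> \bar R}) :
  (forall i c, nu.-caratheodory [set x : 'rV[R]_d | c < x 0 i]) ->
  forall U : set 'rV[R]_d, open U ->
    measurable (U : set (caratheodory_type nu)).
Proof.
move=> half U oU; rewrite (open_bigcup_obox oU) bigcup_mkcond.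
apply: (@countable_bigcupT_measurable _ (caratheodory_type nu)) => [|ab].
  exact: countableP.
case: ifP => _; last exact: measurable0.
rewrite (_ : obox _ _ = \bigcap_(i in [set: 'I_d])
    ([set x : 'rV[R]_d | rat_row R ab.1 0 i < x 0 i] `\`
     \bigcap_(n in [set: nat])
       [set x : 'rV[R]_d | rat_row R ab.2 0 i - n.+1%:R^-1 < x 0 i])).
  apply: fin_bigcap_measurable => [|i _]; first exact: finite_finset.
  apply: measurableD; first exact: half.
  by apply: bigcap_measurable => [|n _]; [exists 0%N|exact: half].
apply/seteqP; split=> x xab i => [_|].
  have /andP[ax xb] := xab i; split=> // /(_ (Num.truncn (rat_row R ab.2 0 i - x 0 i)^-1) I) /=.
  apply/negP; rewrite -leNgt lerBrDr -lerBrDl.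
  have h0 : 0 < rat_row R ab.2 0 i - x 0 i by rewrite subr_gt0.
  rewrite invf_ple ?posrE // ltW //.
  exact: truncnS_gt.
have [/= -> nxb] := xab i I; rewrite ltNge; apply/negP => bx; apply: nxb => n _ /=.
by rewrite (lt_le_trans _ bx) // ltrBlDr ltrDl invr_gt0.
Qed.

(** * Lebesgue measure *)

Lemma box_cost_le (R : realType) d (F : set 'rV[R]_d) (a b : 'rV[R]_d) :
  (forall i, a 0 i <= b 0 i) -> F `<=` box a b ->
  (cost0 (@box_cost R d) F <= (\prod_(i < d) (b 0 i - a 0 i))%:E)%E.
Proof.
move=> ab Fab; apply: cost0_le.
  by rewrite lee_fin prodr_ge0 // => i _; rewrite subr_ge0.
by apply: ereal_inf_lbound; exists (a, b).
Qed.

Definition set_coord (R : Type) d (a : 'rV[R]_d) (i : 'I_d) (c : R) : 'rV[R]_d :=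
  \row_k if k == i then c else a 0 k.

(** A hyperplane cuts a box into two boxes whose volumes add up. *)
Lemma vol_halfspace (R : realType) d (i : 'I_d) (c : R) :
  (@lebesgue_outer R d).-caratheodory [set x : 'rV[R]_d | c < x 0 i].
Proof.
apply: le_caratheodory_measurable => X.
apply: (cover_ext_split (@box_cost_ge0 R d)) => F.
have [->|F0] := eqVneq F set0; first by rewrite !set0I cost0_set0 adde0.
rewrite [leRHS]/cost0 asboolF; last exact/eqP.
apply: le_ereal_inf_tmp => _ [[a b] /= [ab Fab] <-].
have mono (A : set 'rV[R]_d) : (cost0 (@box_cost R d) (F `&` A) <=
    (\prod_(i < d) (b 0 i - a 0 i))%:E)%E.
  by apply: box_cost_le => // x [/Fab].
have [ca|ac] := ltP c (a 0 i).
  rewrite [X in (_ + cost0 _ X)%E](_ : _ = set0) ?cost0_set0 ?adde0 //.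
  rewrite -subset0 => x [/Fab /(_ i)/andP[ax _]] /=; apply.
  exact: lt_le_trans ca ax.
have [bc|cb] := ltP (b 0 i) c.
  rewrite [X in (cost0 _ X + _)%E](_ : _ = set0) ?cost0_set0 ?add0e //.
  rewrite -subset0 => x [/Fab /(_ i)/andP[_ xb]] /=.
  by apply/negP; rewrite -leNgt (le_trans xb) // ltW.
have h1 : (cost0 (@box_cost R d) (F `&` [set x : 'rV[R]_d | (c < x 0 i)%R]) <=
    (\prod_(k < d) (b 0 k - set_coord a i c 0 k))%:E)%E.
  apply: box_cost_le => [k|x [/Fab xab /= cx] k]; rewrite mxE; case: eqP => [->|] //.
  by rewrite (ltW cx) /=; have /andP[] := xab i.
have h2 : (cost0 (@box_cost R d) (F `&` ~` [set x : 'rV[R]_d | (c < x 0 i)%R]) <=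
    (\prod_(k < d) (set_coord b i c 0 k - a 0 k))%:E)%E.
  apply: box_cost_le => [k|x [/Fab xab /= /negP]]; first by rewrite mxE; case: eqP => [->|].
  rewrite -leNgt => xc k; rewrite mxE; case: eqP => [->|] //.
  by rewrite xc andbT; have /andP[] := xab i.
apply: (le_trans (leeD h1 h2)); rewrite -EFinD lee_fin.
have split (G : 'I_d -> R) : \prod_k G k = G i * \prod_(k | k != i) G k.
  by rewrite (bigD1 i).
rewrite 3!split !mxE eqxx.
rewrite [X in _ * X + _](eq_bigr (fun k => b 0 k - a 0 k)); last first.
  by move=> k /negbTE ki; rewrite mxE ki.
rewrite [X in _ + _ * X](eq_bigr (fun k => b 0 k - a 0 k)); last first.
  by move=> k /negbTE ki; rewrite mxE ki.
by rewrite -mulrDl (_ : b 0 i - c + (c - a 0 i) = b 0 i - a 0 i) //; ring.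
Qed.

Lemma open_vol_measurable (R : realType) d (U : set 'rV[R]_d) : open U ->
  measurable (U : set (caratheodory_type (@lebesgue_outer R d))).
Proof. exact/open_caratheodory/vol_halfspace. Qed.

Lemma closed_vol_measurable (R : realType) d (F : set 'rV[R]_d) : closed F ->
  measurable (F : set (caratheodory_type (@lebesgue_outer R d))).
Proof.
by move=> cF; rewrite -(setCK F); apply/measurableC/open_vol_measurable/closed_openC.
Qed.

Definition transl (R : realType) d (h : 'rV[R]_d) (x : 'rV[R]_d) : 'rV[R]_d := x + h.

Lemma box_cost_shift_le (R : realType) d (h : 'rV[R]_d) (F : set 'rV[R]_d) :
  (cost0 (@box_cost R d) (transl h @` F) <= cost0 (@box_cost R d) F)%E.
Proof.
have [->|F0] := eqVneq F set0; first by rewrite image_set0.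
rewrite [leRHS]/cost0 asboolF; last exact/eqP.
apply: le_ereal_inf_tmp => _ [[a b] /= [ab Fab] <-].
rewrite (eq_bigr (fun i => (b + h) 0 i - (a + h) 0 i)); last first.
  by move=> i _; rewrite !mxE; ring.
apply: box_cost_le => [i|_ [x /Fab xab <-] i]; rewrite !mxE ?lerD2r //.
Qed.

Lemma lebesgue_outer_shift_le (R : realType) d (h : 'rV[R]_d) (A : set 'rV[R]_d) :
  (lebesgue_outer (transl h @` A) <= lebesgue_outer A)%E.
Proof.
apply: le_ereal_inf_tmp => _ [F AF <-].
apply: (@le_trans _ _ (\sum_(k <oo) cost0 (@box_cost R d) (transl h @` F k))%E).
  apply: ereal_inf_lbound; exists (fun k => transl h @` F k) => //.
  by move=> _ [x /AF [k _ Fkx] <-]; exists k => //; exists x.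
apply: lee_nneseries => [i _ _|i _].
  by apply: cost0_ge0; exact: box_cost_ge0.
exact: box_cost_shift_le.
Qed.

Lemma shift_preimage (R : realType) d (h : 'rV[R]_d) (A : set 'rV[R]_d) :
  transl h @^-1` A = transl (- h) @` A.
Proof.
apply/seteqP; split=> [x /= Ax|_ [x Ax <-]].
  by exists (transl h x) => //; rewrite /transl addrK.
by rewrite /= /transl subrK.
Qed.

Lemma lebesgue_outer_shift (R : realType) d (h : 'rV[R]_d) (A : set 'rV[R]_d) :
  lebesgue_outer (transl h @^-1` A) = lebesgue_outer A.
Proof.
apply/eqP; rewrite eq_le; apply/andP; split.
  by rewrite shift_preimage lebesgue_outer_shift_le.
have {1}-> : A = transl h @` (transl h @^-1` A).
  apply/seteqP; split=> [x Ax|_ [x Ax <-]] //.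
  by exists (transl (- h) x); rewrite /= /transl subrK.
exact: lebesgue_outer_shift_le.
Qed.

(** The inequality between volumes is obtained by integrating the indicator
    functions of the boxes one coordinate at a time; the weights c record the
    coordinates that have already been frozen. *)
Lemma weighted_cover_volume (R : realType) d (al be : nat -> R) (c : nat -> R)
    (a b : nat -> nat -> R) :
  (forall i, al i <= be i) -> (forall k, 0 <= c k) ->
  (forall k i, a k i <= b k i) ->
  (forall x : nat -> R, (forall i, (i < d)%N -> al i <= x i <= be i) ->
    (1 <= \sum_(k <oo) (c k * \prod_(i < d) (\1_(`[a k i, b k i]) (x i) : R))%:E)%E) ->
  ((\prod_(i < d) (be i - al i))%:E <=
   \sum_(k <oo) (c k * \prod_(i < d) (b k i - a k i))%:E)%E.
Proof.
move=> albe; elim: d c => [|d IH] c c0 ab cov.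
  rewrite big_ord0; apply: (le_trans (cov (fun=> 0) _)) => //.
  by apply: lee_nneseries => k _ // *; rewrite !big_ord0 // lee_fin mulr1.
pose w (t : R) k := c k * (\1_(`[a k d, b k d]) t : R).
have w0 t k : 0 <= w t k by rewrite mulr_ge0.
have P0 k : 0 <= \prod_(i < d) (b k i - a k i).
  by apply: prodr_ge0 => i _; rewrite subr_ge0.
have slice (t : R) : `[al d, be d]%classic t -> ((\prod_(i < d) (be i - al i))%:E <=
    \sum_(k <oo) (w t k * \prod_(i < d) (b k i - a k i))%:E)%E.
  move=> /= tab; apply: IH => // x xab.
  apply: (le_trans (cov (fun i => if i == d then t else x i) _)) => [i|].
    rewrite ltnS leq_eqVlt => /orP[/eqP ->|id]; first by rewrite eqxx; move: tab; rewrite in_itv.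
    by rewrite (ltn_eqF id) xab.
  apply: lee_nneseries => k _ // *.
    by rewrite lee_fin mulr_ge0 // prodr_ge0.
  rewrite lee_fin big_ord_recr /= eqxx /w -!mulrA ler_wpM2l // mulrC.
  by rewrite (eq_bigr (fun i : 'I_d => \1_(`[a k i, b k i]) (x i) : R)) // => i _; rewrite ltn_eqF.
have mD : measurable (`[al d, be d]%classic : set R) by exact: measurable_itv.
pose W k (t : R) : \bar R := (w t k * \prod_(i < d) (b k i - a k i))%:E.
have mw k : measurable_fun `[al d, be d]%classic (W k).
  apply/measurable_EFinP/measurable_funM; last exact: measurable_cst.
  by apply/measurable_funM; [exact: measurable_cst|exact: measurable_indic].
have lenD : lebesgue_measure (`[al d, be d]%classic : set R) = (be d - al d)%:E.
  rewrite lebesgue_measure_itv /= lte_fin; case: ltP => // h; congr EFin.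
  by apply/esym/eqP; rewrite subr_eq0 eq_le h albe.
have <- : (\int[lebesgue_measure]_(x in `[al d, be d])
    (cst (\prod_(i < d) (be i - al i))%:E x) =
    (\prod_(i < d.+1) (be i - al i))%:E)%E.
  rewrite big_ord_recr EFinM -lenD; exact: integral_cst.
apply: (@le_trans _ _ (\int[lebesgue_measure]_(x in `[al d, be d])
    (\sum_(k <oo) W k x))%E).
  apply: ge0_le_integral => //.
  - by move=> x _; rewrite lee_fin prodr_ge0 // => i _; rewrite subr_ge0.
  - apply: ge0_emeasurable_sum => [k x xD _|k _]; last exact: mw.
    by rewrite lee_fin mulr_ge0.
rewrite integral_nneseries //; last by move=> k x _; rewrite lee_fin mulr_ge0.
apply: lee_nneseries => k _ //; first by move=> _; apply: integral_ge0 => t _; rewrite lee_fin mulr_ge0.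
have q0 : 0 <= c k * \prod_(i < d) (b k i - a k i) by rewrite mulr_ge0.
under eq_integral do rewrite /W /w mulrAC EFinM.
rewrite ge0_integralZl //=; last by apply/measurable_EFinP; exact: measurable_indic.
rewrite big_ord_recr /= mulrA [leRHS]EFinM; apply: lee_pmul => //.
  by apply: integral_ge0 => t _; rewrite lee_fin.
rewrite integral_indic //; apply: (@le_trans _ _ (lebesgue_measure `[a k d, b k d]%classic)).
  by apply: le_measure; rewrite ?inE //=; exact: measurableI.
rewrite lebesgue_measure_itv /= lte_fin; case: ltP => // _.
by rewrite lee_fin subr_ge0.
Qed.

(** Total in the index, so that the induction on the dimension can ignore
    ordinals. *)
Definition coords (R : realType) d (x : 'rV[R]_d) (i : nat) : R :=
  oapp (x 0) 0 (insub i).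

Lemma coordsE (R : realType) d (x : 'rV[R]_d) (i : 'I_d) : coords x i = x 0 i.
Proof. by rewrite /coords valK. Qed.

Lemma nneseries_ge_term (R : realType) (u : (\bar R)^nat) k :
  (forall n, 0 <= u n)%E -> (u k <= \sum_(n <oo) u n)%E.
Proof.
move=> u0; apply: (le_trans _ (nneseries_lim_ge k.+1 _)) => //.
by rewrite big_nat_recr //= leeDr // sume_ge0.
Qed.

Lemma vol_box_ge (R : realType) d (al be : 'rV[R]_d) :
  (forall i, al 0 i <= be 0 i) ->
  ((\prod_(i < d) (be 0 i - al 0 i))%:E <= lebesgue_outer (box al be))%E.
Proof.
move=> albe; apply: le_ereal_inf_tmp => _ [F cF <-].
pose CF k := cost0 (@box_cost R d) (F k).
have CF0 k : (0 <= CF k)%E by apply: cost0_ge0; exact: box_cost_ge0.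
have [[k0 k0oo]|nofin] := pselect (exists k, CF k = +oo%E).
  by apply: (le_trans _ (nneseries_ge_term k0 CF0)); rewrite k0oo leey.
apply/lee_addgt0Pr => e e0.
apply: (le_trans _ (epsilon_trick xpredT CF0 (ltW e0))).
(* a box of nearly optimal volume around each covering set *)
have /choice[ab hab] : forall k, exists ab : 'rV[R]_d * 'rV[R]_d,
    (forall i, ab.1 0 i <= ab.2 0 i) /\ F k `<=` box ab.1 ab.2 /\
    (F k !=set0 -> (\prod_(i < d) (ab.2 0 i - ab.1 0 i))%:E <=
                  CF k + (e / (2 ^ k.+1)%:R)%:E)%E.
  move=> k; have [Fk0|Fk0] := pselect (F k = set0).
    by exists (0, 0); split=> //=; rewrite Fk0; split=> // -[].
  have CFk : CF k = box_cost (F k) by rewrite /CF /cost0 asboolF.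
  have fin : box_cost (F k) \is a fin_num.
    by rewrite -CFk ge0_fin_numE // ltey; apply/eqP => koo; apply: nofin; exists k.
  have ek : 0 < e / (2 ^ k.+1)%:R by rewrite divr_gt0 // ltr0n expn_gt0.
  have [_ [[a b] /= [h1 h2] <-] h3] := lb_ereal_inf_adherent ek fin.
  by exists (a, b); split=> //; split=> // _; rewrite CFk ltW.
(* an empty covering set has no cost, so its box must not be counted *)
pose c k : R := `[< F k !=set0 >]%:R.
have := @weighted_cover_volume R d (coords al) (coords be) c
  (fun k => coords (ab k).1) (fun k => coords (ab k).2).
rewrite (eq_bigr (fun i : 'I_d => be 0 i - al 0 i)); last by move=> i _; rewrite !coordsE.
have le_coords (x y : 'rV[R]_d) i : (forall i, x 0 i <= y 0 i) -> coords x i <= coords y i.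
  by move=> xy; rewrite /coords; case: insubP => //=.
move=> /(_ _ _ _ _)/le_trans; apply.
- by move=> i; exact: le_coords.
- by move=> k; rewrite ler0n.
- by move=> k i; apply: le_coords => j; have [] := hab k.
- move=> x xab; pose X : 'rV[R]_d := \row_i x i.
  have /cF [k _ FkX] : box al be X.
    by move=> i; have := xab i (ltn_ord i); rewrite !coordsE mxE.
  have [_ [/(_ _ FkX) Xab _]] := hab k.
  apply: (le_trans _ (nneseries_ge_term k _)) => [|n]; last first.
    by rewrite lee_fin mulr_ge0 ?ler0n // prodr_ge0.
  rewrite lee_fin /c asboolT; last by exists X.
  rewrite mul1r big1 // => i _; rewrite !coordsE indicE mem_set //=.
  by have := Xab i; rewrite mxE in_itv.
apply: lee_nneseries => k _ // *.
  rewrite lee_fin mulr_ge0 ?ler0n // prodr_ge0 // => i _.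
  by rewrite subr_ge0; apply: le_coords => j; have [] := hab k.
rewrite /c; case: asboolP => Fk; last by rewrite mul0r adde_ge0 // lee_fin divr_ge0 // ltW.
have [_ [_ /(_ Fk)]] := hab k; apply: le_trans; rewrite lee_fin mul1r.
by rewrite (eq_bigr (fun i : 'I_d => (ab k).2 0 i - (ab k).1 0 i)) // => i _; rewrite !coordsE.
Qed.

(** An open set contains a box, whose outer measure is bounded below by its
    elementary volume. *)
Lemma vol_open_gt0 (R : realType) d (U : set 'rV[R]_d) : open U -> U !=set0 ->
  (0 < vol R d U)%E.
Proof.
move=> oU [x Ux]; have /nbhs_ballP[e /= e0 eU] : nbhs x U by exact: open_nbhs_nbhs.
have sub : box (x - const_mx (e / 2)) (x + const_mx (e / 2)) `<=` U.
  move=> y xy; apply: eU; split=> // k i; rewrite ord1 /ball /=.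
  have := xy i; rewrite !mxE => /andP[h1 h2]; rewrite ltr_distl.
  by apply/andP; split; lra.
apply: lt_le_trans (le_outer_measure (@lebesgue_outer R d) _ _ sub).
apply: lt_le_trans (vol_box_ge _).
  by rewrite lte_fin prodr_gt0 // => i _; rewrite !mxE; lra.
by move=> i; rewrite !mxE; lra.
Qed.

Lemma normr_coord (R : realType) m n (x : 'M[R]_(m, n)) i j : `|x i j| <= `|x|.
Proof.
rewrite [leRHS]/Num.norm /= mx_normrE; apply/bigmax_geP; right => /=.
by exists (i, j).
Qed.

Lemma vol_bounded_fin (R : realType) d (A : set 'rV[R]_d) : bounded_set A ->
  (vol R d A < +oo)%E.
Proof.
move=> [M [_ /(_ (`|M| + 1))]]; rewrite (le_lt_trans (ler_norm _)) ?ltrDl //.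
move=> /(_ isT) AM; set M' := `|M| + 1 in AM.
have M'0 : 0 <= M' by rewrite addr_ge0.
have sub : A `<=` box (- const_mx M') (const_mx M').
  move=> x /AM /= xM i; rewrite !mxE -ler_norml; exact: le_trans (normr_coord _ _ _) xM.
apply: (le_lt_trans (cover_ext_le_cost (@box_cost_ge0 R d) A)).
apply: (le_lt_trans (box_cost_le _ sub)); last exact: ltry.
by move=> i; rewrite !mxE; lra.
Qed.

(** * Hausdorff measure *)

Lemma mdot_ge0 (R : realType) m n (A : 'M[R]_(m, n)) : 0 <= mdot A A.
Proof. by do 2 (apply: sumr_ge0 => ? _); rewrite -expr2 sqr_ge0. Qed.

Lemma coord_le_enorm (R : realType) m n (A : 'M[R]_(m, n)) i j :
  `|A i j| <= enorm A.
Proof.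
rewrite /enorm -sqrtr_sqr ler_wsqrtr // /mdot (bigD1 i) //= (bigD1 j) //= expr2.
rewrite -addrA lerDl addr_ge0 // ?sumr_ge0 // => k _.
  by rewrite -expr2 sqr_ge0.
by apply: sumr_ge0 => l _; rewrite -expr2 sqr_ge0.
Qed.

Lemma enorm_le_sum (R : realType) m n (A : 'M[R]_(m, n)) :
  enorm A <= \sum_i \sum_j `|A i j|.
Proof.
have S0 : 0 <= \sum_i \sum_j `|A i j| by do 2 (apply: sumr_ge0 => ? _).
rewrite -[leRHS]ger0_norm // -sqrtr_sqr ler_wsqrtr // /mdot.
rewrite expr2 mulr_suml ler_sum // => i _; rewrite mulr_suml ler_sum // => j _.
rewrite (le_trans (ler_norm _)) // normrM ler_wpM2l //.
rewrite (bigD1 i) //= (bigD1 j) //= -addrA lerDl addr_ge0 //.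
  by apply: sumr_ge0.
by do 2 (apply: sumr_ge0 => ? _).
Qed.

Section hausdorff.
Variables (R : realType) (d m : nat).
Local Notation H := (@hausdorff_outer R d m).
Local Notation Hd := (fun delta => cover_ext (@diam_cost R d m delta)).
Implicit Types A B X : set 'rV[R]_d.

Lemma le_diam_cost (delta delta' : R) A B : delta' <= delta -> A `<=` B ->
  (diam_cost m delta A <= diam_cost m delta' B)%E.
Proof.
move=> dd AB; apply: ereal_inf_le_tmp => _ [r [r0 rd rB] <-]; exists r => //.
by split=> //; [exact: le_trans rd dd|move=> x y /AB Bx /AB By; exact: rB].
Qed.

Lemma le_cost0_diam (delta delta' : R) A B : delta' <= delta -> A `<=` B ->
  (cost0 (diam_cost m delta) A <= cost0 (diam_cost m delta') B)%E.
Proof.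
move=> dd AB; have [B0|B0] := pselect (B = set0).
  by move: AB; rewrite B0 subset0 => ->; rewrite !cost0_set0.
rewrite [leRHS]/cost0 asboolF //; apply: cost0_le.
  exact: diam_cost_ge0.
exact: le_diam_cost.
Qed.

Lemma le_cover_ext_diam (delta delta' : R) A : delta' <= delta ->
  (Hd delta A <= Hd delta' A)%E.
Proof.
move=> dd; apply: le_ereal_inf_tmp => _ [F AF <-].
apply: (@le_trans _ _ (\sum_(k <oo) cost0 (diam_cost m delta) (F k))%E).
  by apply: ereal_inf_lbound; exists F.
apply: lee_nneseries => [i _ _|i _].
  by apply: cost0_ge0; exact: diam_cost_ge0.
exact: le_cost0_diam.
Qed.

(** Covering sets of diameter smaller than the distance of A and B meet at most
    one of them. *)
Lemma hausdorff_separated (delta : R) A B : 0 < delta ->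
  (forall x y, A x -> B y -> delta <= enorm (x - y)) ->
  (H A + H B <= H (A `|` B))%E.
Proof.
move=> d0 AB.
have [->|HUfin] := eqVneq (H (A `|` B)) +oo%E; first exact: leey.
have small (e : R) : 0 < e -> (Hd e A + Hd e B <= H (A `|` B))%E.
  move=> e0; pose e' := Num.min e (delta / 2).
  have e'0 : 0 < e' by rewrite lt_min e0 divr_gt0.
  apply: (le_trans (leeD (le_cover_ext_diam (delta' := e') A _)
                         (le_cover_ext_diam (delta' := e') B _))).
  - by rewrite ge_min lexx.
  - by rewrite ge_min lexx.
  apply: (le_trans _ (le_cover_ext_hausdorff m (A `|` B) e'0)).
  rewrite -{1}(setIidr (@subsetUl _ A B)) -{2}(setIidr (@subsetUr _ A B)).
  apply: (cover_ext_split (@diam_cost_ge0 R d m e')) => F.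
  have mono C : (cost0 (diam_cost m e') (F `&` C) <= cost0 (diam_cost m e') F)%E.
    by apply: le_cost0_diam => // x [].
  have [FA0|/set0P[x [Fx Ax]]] := eqVneq (F `&` A) set0.
    by rewrite FA0 cost0_set0 add0e.
  have [FB0|/set0P[y [Fy By]]] := eqVneq (F `&` B) set0.
    by rewrite FB0 cost0_set0 adde0.
  rewrite [leRHS]/cost0 asboolF; last by move=> F0; rewrite F0 in Fx.
  apply: le_ereal_inf_tmp => _ [r [r0 re rF] <-].
  have := le_trans (AB _ _ Ax By) (le_trans (rF _ _ Fx Fy) re).
  rewrite leNgt /e' gt_min [X in _ || X](_ : _ = true) ?orbT //.
  by rewrite ltr_pdivrMr //; lra.
have ub (e f : R) : 0 < e -> 0 < f -> (Hd e A + Hd f B <= H (A `|` B))%E.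
  move=> e0 f0; have g0 : 0 < Num.min e f by rewrite lt_min e0.
  apply: (le_trans _ (small _ g0)); apply: leeD; apply: le_cover_ext_diam.
    by rewrite ge_min lexx.
  by rewrite ge_min lexx orbT.
have finite (x y : \bar R) : (0 <= x -> 0 <= y -> x + y <= H (A `|` B) ->
    x \is a fin_num)%E.
  move=> x0 y0 xy; rewrite ge0_fin_numE //.
  apply: (le_lt_trans (leeDl x y0)); apply: (le_lt_trans xy).
  by rewrite ltey.
have cov0 (e : R) C : (0 <= Hd e C)%E by apply: cover_ext_ge0; exact: diam_cost_ge0.
have Hub (e : R) : 0 < e -> (Hd e A + H B <= H (A `|` B))%E.
  move=> e0; have fA := finite _ _ (cov0 e A) (cov0 e B) (ub e e e0 e0).
  rewrite -leeBrDl //; apply: ge_ereal_sup => _ [f f0 <-].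
  by rewrite leeBrDl // ub.
have fB : H B \is a fin_num.
  apply: (finite _ (Hd 1 A)); rewrite ?hausdorff_outer_ge0 //.
  by rewrite addeC Hub.
by rewrite -leeBrDr //; apply: ge_ereal_sup => _ [e e0 <-]; rewrite leeBrDr // Hub.
Qed.

(** The part of X in the half-space is approximated from inside by sets at
    positive distance from the complement; the shells that are left out have
    summable measures since each of them is separated from the shell after the
    next one. *)
Lemma hausdorff_halfspace (i : 'I_d) (c : R) :
  H.-caratheodory [set x : 'rV[R]_d | c < x 0 i].
Proof.
apply: le_caratheodory_measurable => X; set P := [set x | _].
change (H (X `&` P) + H (X `&` ~` P) <= H X)%E.
have [->|HXfin] := eqVneq (H X) +oo%E; first exact: leey.
have H0 C : (0 <= H C)%E := hausdorff_outer_ge0 m C.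
have Hle C D : C `<=` D -> (H C <= H D)%E by exact: le_hausdorff_outer.
pose t n : R := c + n.+1%:R^-1.
have tS n : t n.+1 < t n.
  by rewrite ltrD2l ltf_pV2 ?posrE // ltr_nat.
have tle n k : (n <= k)%N -> t k <= t n.
  by move=> nk; rewrite lerD2l lef_pV2 ?posrE // ler_nat ltnS.
have tc n : c < t n by rewrite ltrDl invr_gt0.
pose A n := X `&` [set x : 'rV[R]_d | t n <= x 0 i].
pose B n := X `&` [set x : 'rV[R]_d | t n.+1 <= x 0 i < t n].
have sep (C D : set 'rV[R]_d) (a b : R) : b < a -> (forall x, C x -> a <= x 0 i) ->
    (forall x, D x -> x 0 i <= b) -> (H C + H D <= H (C `|` D))%E.
  move=> ba Ca Db; apply: (@hausdorff_separated (a - b)); first by rewrite subr_gt0.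
  move=> x y /Ca ax /Db yb; apply: le_trans (coord_le_enorm _ 0 i).
  by rewrite !mxE; apply: le_trans (ler_norm _); lra.
have shells n : (\sum_(k < n) H (B k.+1) <= H (A n) + H (A n.+1))%E.
  elim: n => [|n IH]; first by rewrite big_ord0 adde_ge0.
  rewrite big_ord_recr /=; apply: (le_trans (leeD IH (lexx _))).
  rewrite [(H (A n) + _)%E]addeC -addeA leeD //.
  apply: (le_trans (@sep _ _ (t n) (t n.+1) (tS n) _ _)).
  - by move=> x [].
  - by move=> x [_ /andP[_ /ltW]].
  apply: Hle => x [[Xx /= nx]|[Xx /= /andP[nx _]]]; split=> //=.
  by apply: le_trans nx; apply: tle; rewrite (leq_trans (leqnSn _)).
have sumfin : (\sum_(k <oo) H (B k.+1) < +oo)%E.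
  apply: (@le_lt_trans _ _ (H X + H X)%E); last by rewrite lte_add_pinfty // ltey.
  apply: lime_le; first by apply: is_cvg_nneseries => n _ _.
  apply: nearW => n; rewrite big_mkord; apply: (le_trans (shells n)).
  by apply: leeD; apply: Hle => x [].
have tail := nneseries_tail_cvg sumfin (fun k _ => H0 (B k.+1)).
apply/lee_addgt0Pr => e e0.
have [n _ /(_ n (leqnn _)) /= small] :
    \forall n \near \oo, (\sum_(n <= k <oo) H (B k.+1) < e%:E)%E.
  have : nbhs (0%E : \bar R) [set y | (y < e%:E)%E].
    by apply: open_nbhs_nbhs; split; [exact: open_ereal_lt_ereal|rewrite /= lte_fin].
  by move/tail.
have cov : X `&` P `<=` A n.+1 `|` \bigcup_(k in ~` `I_n) B k.+1.
  move=> x [Xx /= cx]; have [xt|xt] := leP (t n.+1) (x 0 i); first by left.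
  right.
  have ex : exists k, t k.+2 <= x 0 i.
    exists (Num.truncn (x 0 i - c)^-1); rewrite /t -lerBrDl.
    have xc : 0 < x 0 i - c by rewrite subr_gt0.
    rewrite invf_ple ?posrE // ltW // (lt_trans (truncnS_gt _)) // ltr_nat.
    by rewrite ltnS.
  case: (ex_minnP ex) => k tk kmin.
  have nk : (n <= k)%N.
    rewrite leqNgt; apply/negP => kn; move: (le_lt_trans tk xt).
    by rewrite ltNge tle.
  exists k; first by move=> /=; apply/negP; rewrite -leqNgt.
  split=> //=; rewrite tk /= ltNge; apply/negP; case: k tk kmin nk => [|k] tk kmin nk tx.
    by move: nk; rewrite leqn0 => /eqP n0; move: xt; rewrite n0 ltNge tx.
  by have := kmin _ tx; rewrite ltnn.
have HP : (H (X `&` P) <= H (A n.+1) + e%:E)%E.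
  apply: (le_trans (Hle _ _ cov)); apply: (le_trans (outer_measureU2 H _ _)).
  rewrite leeD2l //; apply: le_trans (ltW small).
  exact: (@outer_measure_sigma_subadditive_tail _ _ H n (fun k => B k.+1)).
apply: (le_trans (leeD HP (lexx _))); rewrite addeAC leeD2r //.
apply: (le_trans (@sep _ _ (t n.+1) c (tc _) _ _)).
- by move=> x [].
- by move=> x [_ /= /negP]; rewrite -leNgt.
by apply: Hle => x [] [].
Qed.

End hausdorff.

Lemma open_surf_measurable (R : realType) d (U : set 'rV[R]_d) : open U ->
  measurable (U : set (caratheodory_type (@hausdorff_outer R d d.-1))).
Proof. exact/open_caratheodory/hausdorff_halfspace. Qed.

(** ** Sets parametrized by finitely many coordinates *)

Lemma cover_ext_finite (R : realType) (T : pointedType) (c : set T -> \bar R)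
    (K : finType) (F : K -> set T) (A : set T) :
  (forall G, 0 <= c G)%E -> A `<=` \bigcup_z F z ->
  (cover_ext c A <= \sum_(z : K) cost0 c (F z))%E.
Proof.
move=> c0 AF; pose G k := oapp (fun i : 'I_#|K| => F (enum_val i)) set0 (insub k).
have -> : (\sum_(z : K) cost0 c (F z) = \sum_(k <oo) cost0 c (G k))%E.
  rewrite (nneseries_split 0 #|K|); last by move=> *; exact: cost0_ge0.
  rewrite [X in (_ + X)%E]eseries0 ?adde0; last first.
    move=> k /= Kk _; rewrite /G insubN ?cost0_set0 // -leqNgt.
    by move: Kk; rewrite add0n.
  rewrite add0n big_mkord big_enum_val.
  by apply: eq_bigr => i _; rewrite /G valK.
apply: ereal_inf_lbound; exists G => // x /AF [z _ Fzx].
by exists (enum_rank z) => //; rewrite /G valK /= enum_rankK.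
Qed.

Lemma segment_cell (R : realType) (C : R) (N : nat) (v : R) : 0 < C ->
  - C <= v <= C -> exists z : 'I_N.+1,
    - C + z%:R * (2 * C / N.+1%:R) <= v <= - C + z.+1%:R * (2 * C / N.+1%:R).
Proof.
move=> C0 /andP[Cv vC]; set q := 2 * C / N.+1%:R.
have q0 : 0 < q by rewrite divr_gt0 // mulr_gt0.
have qN : N.+1%:R * q = 2 * C by rewrite /q mulrC divfK // pnatr_eq0.
have [->|vC'] := eqVneq v C.
  by exists ord_max; move: qN; rewrite /= -natr1 mulrDl mul1r => qN; apply/andP; split; lra.
have u0 : 0 <= (v + C) / q by apply: divr_ge0; [lra|exact: ltW].
have uN : (Num.truncn ((v + C) / q) < N.+1)%N.
  rewrite truncn_lt_nat //.
  have {}vC' : v < C by rewrite lt_neqAle vC' vC.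
  by rewrite ltr_pdivrMr // qN; lra.
exists (Ordinal uN) => /=.
have h1 : (Num.truncn ((v + C) / q))%:R * q <= v + C.
  by rewrite -ler_pdivlMr // truncn_le.
have h2 : v + C < (Num.truncn ((v + C) / q)).+1%:R * q.
  by rewrite -ltr_pdivrMr // truncnS_gt.
by apply/andP; split; lra.
Qed.

Section coordinate_grid.
Variables (R : realType) (d : nat) (I : finType) (kap : 'rV[R]_d -> I -> R).
Variables (Z : set 'rV[R]_d) (C L : R).
Hypothesis C_gt0 : 0 < C.
Hypothesis kap_le : forall x, Z x -> forall i, `|kap x i| <= C.
Hypothesis kap_lip : forall x y (r : R), 0 <= r -> Z x -> Z y ->
  (forall i, `|kap x i - kap y i| <= r) -> enorm (x - y) <= L * r.
Hypothesis L_ge0 : 0 <= L.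

(** The #|I|-dimensional cube of the parameters is divided into N.+1 ^ #|I|
    cells, each of which parametrizes a piece of Z of diameter O(1 / N). *)
Lemma cover_ext_grid m N delta : L * (2 * C / N.+1%:R) <= delta ->
  (cover_ext (@diam_cost R d m delta) Z <=
   (N.+1%:R ^+ #|I| * (ball_volume R m * (L * C / N.+1%:R) ^+ m))%:E)%E.
Proof.
move=> Ld; set q := 2 * C / N.+1%:R in Ld.
have q0 : 0 <= q by rewrite divr_ge0 // mulr_ge0 // ltW.
pose cell (z : {ffun I -> 'I_N.+1}) := Z `&` [set x | forall i,
  - C + (z i)%:R * q <= kap x i <= - C + (z i).+1%:R * q].
have ZC : Z `<=` \bigcup_z cell z.
  move=> x Zx.
  have /choice[z hz] : forall i, exists z : 'I_N.+1,
      - C + z%:R * q <= kap x i <= - C + z.+1%:R * q.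
    by move=> i; apply: segment_cell => //; rewrite -ler_norml kap_le.
  by exists (finfun z) => //; split=> // i; rewrite /= ffunE.
apply: (le_trans (cover_ext_finite (@diam_cost_ge0 R d m delta) ZC)).
have -> : (N.+1%:R ^+ #|I| * (ball_volume R m * (L * C / N.+1%:R) ^+ m))%:E =
    (\sum_(z : {ffun I -> 'I_N.+1}) (ball_volume R m * (L * C / N.+1%:R) ^+ m)%:E)%E.
  by rewrite sumEFin sumr_const card_ffun card_ord -natrX mulr_natl.
apply: lee_sum => z _; apply: cost0_le.
  rewrite lee_fin mulr_ge0 ?ball_volume_ge0 // exprn_ge0 // divr_ge0 //.
  by rewrite mulr_ge0 // ltW.
apply: ereal_inf_lbound; exists (L * q).
  split=> //; first by rewrite mulr_ge0.
  move=> x y [Zx xz] [Zy yz]; apply: kap_lip => // i.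
  move: (xz i) (yz i); rewrite -natr1 mulrDl mul1r => /andP[h1 h2] /andP[h3 h4].
  by rewrite ler_norml; apply/andP; split; lra.
have half (n : R) : n != 0 -> L * (2 * C / n) / 2 = L * C / n by move=> ?; field.
by rewrite half // pnatr_eq0.
Qed.

Lemma grid_fine (e : R) : 0 < e -> exists N : nat, L * (2 * C / N.+1%:R) <= e.
Proof.
move=> e0; exists (Num.truncn (L * (2 * C) / e)).
rewrite mulrA ler_pdivrMr // [e * _]mulrC -ler_pdivrMr // ltW //.
exact: truncnS_gt.
Qed.

Lemma hausdorff_grid_fin : (hausdorff_outer #|I| Z < +oo)%E.
Proof.
apply: (@le_lt_trans _ _ (ball_volume R #|I| * (L * C) ^+ #|I|)%:E); last exact: ltry.
apply: ge_ereal_sup => _ [delta d0 <-].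
have [N LN] := grid_fine d0; apply: (le_trans (cover_ext_grid _ LN)).
rewrite lee_fin expr_div_n mulrCA [X in _ * X]mulrCA divff ?mulr1 //.
Qed.

(** In a dimension higher by one than the number of parameters the cost of the
    grid is O(1 / N). *)
Lemma hausdorff_grid_null : hausdorff_outer #|I|.+1 Z = 0%E.
Proof.
apply/eqP; rewrite eq_le hausdorff_outer_ge0 andbT.
apply: ge_ereal_sup => _ [delta d0 <-]; apply/lee_addgt0Pr => e e0; rewrite add0e.
set b := ball_volume R #|I|.+1 * (L * C) ^+ #|I|.+1.
have b0 : 0 <= b.
  by rewrite mulr_ge0 ?ball_volume_ge0 // exprn_ge0 // mulr_ge0 // ltW.
have [N1 LN1] := grid_fine d0.
pose N := maxn N1 (Num.truncn (b / e)).
have LN : L * (2 * C / N.+1%:R) <= delta.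
  apply: le_trans LN1; rewrite ler_wpM2l // ler_wpM2l //.
    by rewrite mulr_ge0 // ltW.
  by rewrite lef_pV2 ?posrE // ler_nat ltnS leq_maxl.
apply: (le_trans (cover_ext_grid _ LN)); rewrite lee_fin.
have -> : N.+1%:R ^+ #|I| * (ball_volume R #|I|.+1 * (L * C / N.+1%:R) ^+ #|I|.+1) =
    b / N.+1%:R.
  rewrite /b expr_div_n [X in _ / X]exprS invfM; set n : R := N.+1%:R ^+ _.
  have n0 : n != 0 by rewrite expf_neq0 // pnatr_eq0.
  by rewrite -!mulrA [LHS]mulrCA; congr (_ * _); rewrite mulrCA; congr (_ * _); rewrite mulrCA divff // mulr1.
rewrite ler_pdivrMr // [e * _]mulrC -ler_pdivrMr // ltW //.
by apply: (lt_le_trans (truncnS_gt _)); rewrite ler_nat ltnS leq_maxr.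
Qed.

End coordinate_grid.

(** * Null sets *)

(** Completeness: sets of outer measure zero are measurable. *)
Lemma caratheodory_negligible (R : realType) (T : pointedType)
    (nu : {outer_measure set T -> \bar R}) (A : set T) :
  ((nu : set (caratheodory_type nu) -> \bar R) : {measure set (caratheodory_type nu) -> \bar R}).-negligible A <-> nu A = 0%E.
Proof.
split=> [[B [mB nuB AB]]|nuA].
  apply/eqP; rewrite eq_le outer_measure_ge0 andbT.
  by apply: (le_trans (le_outer_measure nu _ _ AB)); rewrite [X in (X <= _)%E]nuB.
exists A; split=> //; apply: le_caratheodory_measurable => X.
have -> : nu (X `&` A) = 0%E.
  apply/eqP; rewrite eq_le outer_measure_ge0 andbT -nuA.
  exact: le_outer_measure.
by rewrite add0e le_outer_measure.
Qed.

Lemma vol_negligible (R : realType) d (A : set 'rV[R]_d) :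
  (vol R d).-negligible A <-> lebesgue_outer A = 0%E.
Proof. exact: (@caratheodory_negligible _ _ (@lebesgue_outer R d)). Qed.

Lemma surf_negligible (R : realType) d (A : set 'rV[R]_d) :
  (surf R d).-negligible A <-> hausdorff_outer d.-1 A = 0%E.
Proof. exact: (@caratheodory_negligible _ _ (@hausdorff_outer R d d.-1)). Qed.

Lemma transl_measurable (R : realType) d (h : 'rV[R]_d) (E : set 'rV[R]_d) :
  measurable (E : set (caratheodory_type (@lebesgue_outer R d))) ->
  measurable (transl h @^-1` E : set (caratheodory_type (@lebesgue_outer R d))).
Proof.
move=> mE; suff : (@lebesgue_outer R d).-caratheodory (transl h @^-1` E) by [].
move=> X; have -> : X = transl h @^-1` (transl (- h) @^-1` X).
  by apply/funext => x; rewrite /= /transl addrK.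
change (lebesgue_outer (transl h @^-1` (transl (- h) @^-1` X)) =
  lebesgue_outer (transl h @^-1` (transl (- h) @^-1` X `&` E)) +
  lebesgue_outer (transl h @^-1` (transl (- h) @^-1` X `&` ~` E)))%E.
rewrite (lebesgue_outer_shift h (transl (- h) @^-1` X)).
rewrite (lebesgue_outer_shift h (transl (- h) @^-1` X `&` E)).
rewrite (lebesgue_outer_shift h (transl (- h) @^-1` X `&` ~` E)).
exact: mE.
Qed.

Definition hyperplane (R : realType) d (a : R) (b : 'I_d -> R) : set 'rV[R]_d :=
  [set x | a + \sum_k x 0 k * b k = 0].

Lemma continuous_sum (R : realType) (T : topologicalType) (I : Type) (r : seq I)
    (f : I -> T -> R) :
  (forall k, continuous (f k)) -> continuous (fun x => \sum_(k <- r) f k x).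
Proof.
move=> cf; elim: r => [|k r IH].
  by under eq_fun do rewrite big_nil; move=> x; exact: cst_continuous.
under eq_fun do rewrite big_cons.
by move=> x; apply: (@continuousD _ _ _ (f k)); [exact: cf|exact: IH].
Qed.

Lemma continuous_affine (R : realType) d (a : R) (b : 'I_d -> R) :
  continuous (fun x : 'rV[R]_d => a + \sum_k x 0 k * b k).
Proof.
move=> x; apply: (@continuousD _ _ _ (fun=> a) (fun x : 'rV[R]_d => \sum_k x 0 k * b k)).
  exact: cst_continuous.
move: x; apply: continuous_sum => k x.
apply: (@continuousM _ _ (fun z : 'rV[R]_d => z 0 k) (fun=> b k)).
  exact: coord_continuous.
exact: cst_continuous.
Qed.

Lemma closed_box (R : realType) d (a b : 'rV[R]_d) : closed (box a b).
Proof.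
rewrite (_ : box a b = \bigcap_(i in [set: 'I_d])
   ((fun x : 'rV[R]_d => x 0 i) @^-1` [set y | a 0 i <= y] `&`
    (fun x : 'rV[R]_d => x 0 i) @^-1` [set y | y <= b 0 i])).
  apply: closed_bigI => i _; apply: closedI.
    by apply: closed_comp; [move=> ? _; exact: coord_continuous|exact: closed_ge].
  by apply: closed_comp; [move=> ? _; exact: coord_continuous|exact: closed_le].
apply/seteqP; split=> x xab i; first by move=> _; have /andP[] := xab i.
by have [/= -> ->] := xab i I.
Qed.

Lemma bounded_sub_box (R : realType) d (A : set 'rV[R]_d) : bounded_set A ->
  exists2 M : R, 0 < M & A `<=` box (- const_mx M) (const_mx M).
Proof.
move=> [M [_ /(_ (`|M| + 1))]]; rewrite (le_lt_trans (ler_norm _)) ?ltrDl //.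
move=> /(_ isT) AM; exists (`|M| + 1); first by rewrite ltr_wpDl.
move=> x /AM /= xM i; rewrite !mxE -ler_norml.
exact: le_trans (normr_coord _ _ _) xM.
Qed.

(** Infinitely many disjoint translates of a bounded piece of a hyperplane fit
    into a bounded set. *)
Lemma hyperplane_vol_null (R : realType) d (a : R) (b : 'I_d -> R) i
    (A : set 'rV[R]_d) : b i != 0 -> bounded_set A ->
  lebesgue_outer (A `&` hyperplane a b) = 0%E.
Proof.
move=> bi /bounded_sub_box[M M0 AM].
set B := box (- const_mx M) (const_mx M) in AM.
pose E := B `&` hyperplane a b.
suff E0 : lebesgue_outer E = 0%E.
  apply/eqP; rewrite eq_le outer_measure_ge0 andbT -E0.
  by apply: (le_outer_measure (@lebesgue_outer R d)) => x [/AM].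
have mE : measurable (E : set (caratheodory_type (@lebesgue_outer R d))).
  apply: closed_vol_measurable; apply: closedI; first exact: closed_box.
  apply: (@closed_comp _ _ (fun x : 'rV[R]_d => a + \sum_k x 0 k * b k) [set 0]) => [x _|].
    exact: continuous_affine.
  exact: closed_eq.
pose t n : 'rV[R]_d := - (n.+1%:R^-1 *: delta_mx 0 i).
pose F n : set 'rV[R]_d := transl (t n) @^-1` E.
have mF n : measurable (F n : set (caratheodory_type (@lebesgue_outer R d))).
  exact: transl_measurable.
have ti k : \sum_l (t k) 0 l * b l = - (k.+1%:R^-1 * b i).
  rewrite (bigD1 i) //= big1 ?addr0 => [|l /negbTE li]; rewrite !mxE ?eqxx ?li /=.
    by rewrite mulr1 mulNr.
  by rewrite mulr0 oppr0 mul0r.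
have tF : trivIset setT F.
  apply/trivIsetP => n k _ _ nk; rewrite -subset0 => x [[_ hn] [_ hk]].
  move: hn hk; rewrite /hyperplane /transl /=.
  under eq_bigr do rewrite mxE mulrDl.
  under [in X in _ -> X -> _]eq_bigr do rewrite mxE mulrDl.
  rewrite !big_split /= !ti => h1 h2.
  have /addrI/addrI/oppr_inj := etrans h1 (esym h2).
  move/(mulIf bi)/invr_inj/eqP; rewrite eqr_nat eqSS => /eqP; exact/eqP.
have bF : \bigcup_n F n `<=` box (- const_mx (M + 1)) (const_mx (M + 1)).
  move=> x [n _ [xB _]] k; have := xB k; rewrite /transl !mxE => /andP[h1 h2].
  have [n0 n1] : 0 <= n.+1%:R^-1 :> R /\ n.+1%:R^-1 <= 1 :> R.
    by rewrite invr_ge0 ler0n invf_le1 ?ler1n.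
  move: h1 h2 n0 n1; rewrite eqxx /=; move: (n.+1%:R^-1 : R) => u.
  by case: (k == i); rewrite ?mulr1 ?mulr0 => h1 h2 u0 u1; apply/andP; split; lra.
have sumF : (\sum_(n <oo) lebesgue_outer E < +oo)%E.
  rewrite (_ : (fun n => _) = (fun n => \sum_(0 <= k < n) vol R d (F k))%E); last first.
    by apply/funext => n; apply: eq_bigr => k _; rewrite -(lebesgue_outer_shift (t k) E).
  rewrite -(@measure_semi_bigcup _ _ _ (vol R d)) //; last exact: bigcup_measurable.
  apply: (le_lt_trans (le_outer_measure (@lebesgue_outer R d) _ _ bF)).
  apply: (le_lt_trans (cover_ext_le_cost (@box_cost_ge0 R d) _)).
  apply: (le_lt_trans (box_cost_le _ (fun x h => h))); last exact: ltry.
  by move=> k; rewrite !mxE; lra.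
have [//|E0] := eqVneq (lebesgue_outer E) 0%E; exfalso.
have Epos : (0 < lebesgue_outer E)%E by rewrite lt0e E0 outer_measure_ge0.
have part N : (N%:R%:E * lebesgue_outer E <= \sum_(n <oo) lebesgue_outer E)%E.
  apply: le_trans (nneseries_lim_ge N _); last by move=> *; exact: outer_measure_ge0.
  elim: N => [|N IH]; first by rewrite big_geq // mul0e.
  rewrite big_nat_recr //= -natr1 EFinD ge0_muleDl ?lee_fin ?ler0n ?ler01 // mul1e.
  exact: leeD.
have Efin : lebesgue_outer E \is a fin_num.
  rewrite ge0_fin_numE ?outer_measure_ge0 //; apply: le_lt_trans sumF.
  by have := part 1%N; rewrite mul1e.
have Sfin : (\sum_(n <oo) lebesgue_outer E)%E \is a fin_num.
  by rewrite ge0_fin_numE //; apply: nneseries_ge0 => *; exact: outer_measure_ge0.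
set S := (\sum_(n <oo) _)%E in part Sfin.
have v0 : 0 < fine (lebesgue_outer E) by rewrite -lte_fin fineK.
have := part (Num.truncn (fine S / fine (lebesgue_outer E))).+1.
rewrite -(fineK Efin) -(fineK Sfin) -EFinM lee_fin leNgt => /negP; apply.
by rewrite -ltr_pdivrMr //; exact: truncnS_gt.
Qed.

(** * Surface measure of hyperplanes and of zero sets of rigid motions *)

(** The linear relation is solved for the coordinate i. *)
Lemma dependent_coordinate (R : realType) d (b y : 'I_d -> R) i (r : R) : 0 <= r ->
  b i != 0 -> \sum_k y k * b k = 0 ->
  (forall k, k != i -> b k = 0 \/ `|y k| <= r) ->
  `|y i| <= (\sum_k `|b k|) / `|b i| * r.
Proof.
move=> r0 bi; rewrite (bigD1 i) //= => yb yr.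
have bi0 : 0 < `|b i| by rewrite normr_gt0.
rewrite mulrAC ler_pdivlMr // -normrM.
have -> : y i * b i = - \sum_(k | k != i) y k * b k by apply/eqP; rewrite -addr_eq0 yb.
rewrite normrN; apply: (le_trans (ler_norm_sum _ _ _)).
rewrite [in leRHS](bigD1 i) //= mulrDl ler_wpDl // ?mulr_ge0 // mulr_suml.
apply: ler_sum => k ki; have [->|yk] := yr k ki; first by rewrite mulr0 normr0 mul0r.
by rewrite normrM mulrC ler_wpM2l.
Qed.

Lemma enorm_row_le (R : realType) d (x : 'rV[R]_d) (r : R) :
  (forall k, `|x 0 k| <= r) -> enorm x <= d%:R * r.
Proof.
move=> xr; apply: (le_trans (enorm_le_sum x)); rewrite big_ord1.
apply: (@le_trans _ _ (\sum_(k < d) r)); first by apply: ler_sum => k _.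
by rewrite sumr_const card_ord mulr_natl.
Qed.

(** The coordinates other than i parametrize the hyperplane by a Lipschitz
    map. *)
Lemma hyperplane_surf_fin (R : realType) d (a : R) (b : 'I_d -> R) i
    (A : set 'rV[R]_d) : b i != 0 -> bounded_set A ->
  (hausdorff_outer d.-1 (A `&` hyperplane a b) < +oo)%E.
Proof.
move=> bi /bounded_sub_box[M M0 AM].
have <- : #|{: {k : 'I_d | k != i}}| = d.-1 by rewrite card_sig cardC1 card_ord.
set S := (\sum_k `|b k|) / `|b i|.
have S0 : 0 <= S by rewrite divr_ge0 // sumr_ge0.
apply: (@hausdorff_grid_fin _ _ _ (fun (x : 'rV[R]_d) (k : {k | k != i}) => x 0 (val k)) _
  M (d%:R * (1 + S))) => //.
- by move=> x [/AM xM _] k; rewrite ler_norml; have := xM (val k); rewrite !mxE.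
- move=> x y r r0 [_ hx] [_ hy] xy.
  rewrite -mulrA; apply: enorm_row_le => k; rewrite !mxE mulrDl mul1r.
  have sm l : l != i -> `|x 0 l - y 0 l| <= r by move=> li; exact: (xy (exist _ l li)).
  have [->|ki] := eqVneq k i; last first.
    by apply: (le_trans (sm _ ki)); rewrite lerDl mulr_ge0.
  rewrite ler_wpDl //; apply: (@dependent_coordinate _ _ b (fun k => x 0 k - y 0 k)) => //.
    under eq_bigr do rewrite mulrBl.
    rewrite sumrB; move: hx hy; rewrite /hyperplane /= => hx hy.
    by apply/eqP; rewrite subr_eq0; apply/eqP/(@addrI _ a); rewrite hx hy.
  by move=> l li; right; exact: sm.
by rewrite mulr_ge0 // addr_ge0.
Qed.

(** A nonzero skew-symmetric matrix has two nonzero entries in symmetric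
    positions, so the zero set is a Lipschitz image of a set of d - 2
    coordinates. *)
Lemma rigid_zeros_surf_null (R : realType) d (M : 'M[R]_d) (c : 'rV[R]_d)
    (A : set 'rV[R]_d) : M^T = - M -> M != 0 -> bounded_set A ->
  hausdorff_outer d.-1 (A `&` [set x | x *m M + c = 0]) = 0%E.
Proof.
move=> skew M0 /bounded_sub_box[C C0 AC].
have skewE k l : M k l = - M l k by have /matrixP/(_ l k) := skew; rewrite !mxE.
have diag k : M k k = 0 by have := skewE k k; lra.
have [i [j Mij]] : exists i j, M i j != 0.
  apply: contrapT => h; move/eqP: M0; apply; apply/matrixP => i j; rewrite mxE.
  by apply/eqP/negPn/negP => ij; apply: h; exists i, j.
have ij : i != j by apply: contraNneq Mij => ->; rewrite diag.
have Mji : M j i != 0 by rewrite skewE oppr_eq0.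
have <- : #|{: {k : 'I_d | k \notin [set i; j]%SET}}|.+1 = d.-1.
  have cd := cardC (mem [set i; j]%SET); rewrite cards2 ij card_ord in cd.
  rewrite card_sig -[X in _ = X.-1]cd.
  by rewrite (eq_card (B := [predC [set i; j]%SET])) // => k; rewrite !inE.
pose S k l := (\sum_m `|M m l|) / `|M k l|.
have S0 k l : 0 <= S k l by rewrite divr_ge0 // sumr_ge0.
apply: (@hausdorff_grid_null _ _ _
  (fun (x : 'rV[R]_d) (k : {k | k \notin [set i; j]%SET}) => x 0 (val k)) _
  C (d%:R * (1 + S i j + S j i))) => //.
- by move=> x [/AC xM _] k; rewrite ler_norml; have := xM (val k); rewrite !mxE.
- move=> x y r r0 [_ hx] [_ hy] xy.
  rewrite -mulrA; apply: enorm_row_le => k; rewrite !mxE !mulrDl mul1r.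
  have sm l : l != i -> l != j -> `|x 0 l - y 0 l| <= r.
    move=> li lj; have lij : l \notin [set i; j]%SET by rewrite !inE negb_or li.
    exact: (xy (exist _ l lij)).
  have col l : \sum_k (x 0 k - y 0 k) * M k l = 0.
    have /rowP/(_ l) : (x - y) *m M = 0.
      rewrite mulmxBl; apply/eqP; rewrite subr_eq0; apply/eqP/(@addIr _ c).
      by rewrite hx hy.
    by rewrite !mxE => h; rewrite -[RHS]h; apply: eq_bigr => m _; rewrite !mxE.
  have Sr k' l : 0 <= S k' l * r by rewrite mulr_ge0.
  have [->|ki] := eqVneq k i.
    apply: (@le_trans _ _ (S i j * r)); last by have := Sr j i; lra.
    apply: (@dependent_coordinate _ _ (M^~ j) (fun k => x 0 k - y 0 k)) => // l li.
    by have [->|lj] := eqVneq l j; [left|right; exact: sm].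
  have [->|kj] := eqVneq k j.
    apply: (@le_trans _ _ (S j i * r)); last by have := Sr i j; lra.
    apply: (@dependent_coordinate _ _ (M^~ i) (fun k => x 0 k - y 0 k)) => // l lj.
    by have [->|li] := eqVneq l i; [left|right; exact: sm].
  by apply: (le_trans (sm _ ki kj)); have := Sr i j; have := Sr j i; lra.
by rewrite mulr_ge0 // !addr_ge0.
Qed.

(** * Triangulations *)

Definition affine_value (R : realType) d (a : R) (b : 'I_d -> R) (x : 'rV[R]_d) : R :=
  a + \sum_k x 0 k * b k.

Section simplex.
Variables (R : realType) (d : nat) (S : 'M[R]_(d.+1, d)).
Hypothesis S_nondeg : nondegenerate_simplex S.

Let M : 'M[R]_d.+1 := row_mx (const_mx 1 : 'cV[R]_d.+1) S.
Let W : 'M[R]_d.+1 := invmx M.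

Let M_unit : M \in unitmx.
Proof. by rewrite -row_free_unit. Qed.

(* The barycentric coordinate of a point with respect to vertex i is the
   affine function with the following coefficients. *)
Definition bary0 (i : 'I_d.+1) : R := W 0 i.
Definition bary_coef (i : 'I_d.+1) (k : 'I_d) : R := W (lift 0 k) i.
Definition bary (i : 'I_d.+1) : 'rV[R]_d -> R :=
  affine_value (bary0 i) (bary_coef i).

Let homog (x : 'rV[R]_d) : 'rV[R]_d.+1 := row_mx (const_mx 1 : 'rV[R]_1) x.

Let baryE i x : bary i x = (homog x *m W) 0 i.
Proof.
rewrite mxE big_ord_recl /bary /affine_value; congr (_ + _).
  suff -> : homog x 0 ord0 = 1 by rewrite mul1r.
  apply: (etrans _ (etrans (row_mxEl (const_mx 1 : 'rV[R]_1) x 0 ord0) _)).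
    by congr (fun_of_matrix _ _ _); exact: val_inj.
  by rewrite mxE.
apply: eq_bigr => k _; congr (_ * _).
apply: (etrans (esym (row_mxEr (const_mx 1 : 'rV[R]_1) x 0 k)) _).
by congr (fun_of_matrix _ _ _); exact: val_inj.
Qed.

Let homog_comb (w : 'rV[R]_d.+1) : \sum_i w 0 i = 1 -> homog (w *m S) = w *m M.
Proof.
move=> w1; apply: (etrans _ (esym (mul_mx_row w (const_mx 1 : 'cV[R]_d.+1) S))); congr row_mx.
apply/matrixP => i j; rewrite !mxE -[LHS]w1; apply: eq_bigr => k _.
by rewrite !mxE mulr1 !ord1.
Qed.

Lemma bary_comb (w : 'rV[R]_d.+1) i : \sum_i w 0 i = 1 -> bary i (w *m S) = w 0 i.
Proof. by move=> w1; rewrite baryE homog_comb // mulmxK. Qed.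

Lemma bary_decomp (x : 'rV[R]_d) :
  \sum_i bary i x = 1 /\ x = (\row_i bary i x) *m S.
Proof.
pose w := homog x *m W.
have wE : \row_i bary i x = w by apply/rowP => i; rewrite mxE baryE.
have xw : homog x = w *m M by rewrite mulmxKV.
have xw' : row_mx (const_mx 1 : 'rV[R]_1) x =
    row_mx (w *m (const_mx 1 : 'cV[R]_d.+1)) (w *m S).
  exact: (etrans xw (mul_mx_row w (const_mx 1 : 'cV[R]_d.+1) S)).
have [h1 h2] := eq_row_mx xw'.
rewrite wE; split=> //.
have := congr1 (fun A : 'rV[R]_1 => A 0 0) h1; rewrite !mxE => ->.
by apply: eq_bigr => i _; rewrite !mxE mulr1 baryE mxE.
Qed.

Lemma simplexP (x : 'rV[R]_d) : simplex S x <-> forall i, 0 <= bary i x.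
Proof.
split=> [[w [w0 w1 _ ->]] i|x0]; first by rewrite bary_comb.
have [s1 xS] := bary_decomp x; exists (\row_i bary i x); split=> //.
- by move=> i; rewrite mxE.
- by rewrite -[RHS]s1; apply: eq_bigr => i _; rewrite mxE.
- by move=> i; rewrite inE.
Qed.

Lemma continuous_bary i : continuous (bary i).
Proof. exact: continuous_affine. Qed.

Lemma closed_simplex : closed (simplex S).
Proof.
rewrite (_ : simplex S = \bigcap_(i in [set: 'I_d.+1]) (bary i @^-1` [set y | 0 <= y])).
  apply: closed_bigI => i _; apply: closed_comp; last exact: closed_ge.
  by move=> x _; exact: continuous_bary.
by apply/seteqP; split=> x; [move=> /simplexP h i _; exact: h|move=> h; apply/simplexP => i; exact: h].
Qed.

Lemma interior_simplex (x : 'rV[R]_d) : (forall i, 0 < bary i x) -> (simplex S)° x.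
Proof.
move=> x0.
apply: (@filterS _ (nbhs x) _ (fun y => forall i, 0 < bary i y)).
  by move=> y y0; apply/simplexP => i; rewrite ltW.
apply: (@filter_forall _ _ _ _ (@nbhs_filter 'rV[R]_d x)) => i.
exact: (@continuous_bary i x _ (lt_nbhsr (x0 i))).
Qed.

(** A point of a simplex outside of its interior has a vanishing barycentric
    coordinate, and barycentric coordinates are not constant. *)
Lemma simplex_boundary (x : 'rV[R]_d) : simplex S x -> ~ (simplex S)° x ->
  exists i k, bary_coef i k != 0 /\ hyperplane (bary0 i) (bary_coef i) x.
Proof.
move=> /simplexP xS xn; apply: contrapT => h; apply: xn; apply: interior_simplex => i.
rewrite lt_neqAle xS andbT eq_sym; apply/eqP => xi0; apply: h; exists i.
apply: contrapT => h; have W0 k : bary_coef i k = 0.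
  by apply/eqP/negPn/negP => Wk; apply: h; exists k.
(* otherwise the coordinate would vanish at vertex i too *)
have := @bary_comb (delta_mx 0 i) i.
have bconst y : bary i y = bary0 i.
  by rewrite /bary /affine_value big1 ?addr0 // => k _; rewrite W0 mulr0.
move: xi0; rewrite !bconst => ->; rewrite mxE !eqxx /= (bigD1 i) //= big1 => [|k /negbTE ki]; last by rewrite mxE ki andbF.
by rewrite mxE !eqxx addr0 => /(_ erefl)/eqP; rewrite eq_sym oner_eq0.
Qed.

Definition barycenter : 'rV[R]_d := const_mx d.+1%:R^-1 *m S.

Lemma bary_barycenter i : bary i barycenter = d.+1%:R^-1.
Proof.
rewrite bary_comb ?mxE // (eq_bigr (fun=> d.+1%:R^-1)) => [|k _]; last by rewrite mxE.
by rewrite sumr_const card_ord -[LHS]mulr_natl mulfV // pnatr_eq0.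
Qed.

Lemma simplex_interior_nonempty : (simplex S)° !=set0.
Proof.
by exists barycenter; apply: interior_simplex => i; rewrite bary_barycenter invr_gt0.
Qed.

Lemma bary_convex i (x y : 'rV[R]_d) t :
  bary i (x + t *: (y - x)) = bary i x + t * (bary i y - bary i x).
Proof.
rewrite /bary /affine_value; under eq_bigr do rewrite !mxE mulrDl -mulrA mulrBl.
rewrite big_split /= -mulr_sumr sumrB; ring.
Qed.

(** Moving towards the barycenter makes all barycentric coordinates positive. *)
Lemma simplex_sub_closure_interior : simplex S `<=` closure (simplex S)°.
Proof.
move=> x /simplexP xS U /nbhs_ballP[e /= e0 eU].
pose p := barycenter - x; pose t := (Num.min 1 (e / 2 / (1 + `|p|))).
have p1 : 0 < 1 + `|p| by rewrite ltr_pwDl.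
have t0 : 0 < t by rewrite lt_min ltr01 /= !divr_gt0.
exists (x + t *: p); split.
  apply: interior_simplex => i; rewrite bary_convex bary_barycenter.
  have t1 : t <= 1 by rewrite ge_min lexx.
  have n0 : 0 < d.+1%:R^-1 :> R by rewrite invr_gt0.
  have h : 0 < t * d.+1%:R^-1 by rewrite mulr_gt0.
  have : 0 <= (1 - t) * bary i x by rewrite mulr_ge0 // subr_ge0.
  move: (d.+1%:R^-1 : R) n0 h => n n0 h.
  by rewrite mulrBr mulrBl mul1r; lra.
apply: eU; rewrite -ball_normE /ball_ /= opprD addrA subrr add0r normrN normrZ gtr0_norm //.
apply: (@le_lt_trans _ _ (t * (1 + `|p|))); first by rewrite ler_pM2l // lerDr.
rewrite -ltr_pdivlMr // (@le_lt_trans _ _ (e / 2 / (1 + `|p|))) ?ge_min ?lexx ?orbT //.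
by rewrite ltr_pM2r ?invr_gt0 //; lra.
Qed.

End simplex.

Lemma outer_measure_bigcup_seq (R : realType) (T : pointedType) (I : choiceType)
    (nu : {outer_measure set T -> \bar R}) (r : seq I) (F : I -> set T) :
  (nu (\bigcup_(i in [set` r]) F i) <= \sum_(i <- r) nu (F i))%E.
Proof.
elim: r => [|i r IH].
  by rewrite big_nil set_nil bigcup_set0 outer_measure0.
have -> : [set` i :: r] = i |` [set` r].
  apply/seteqP; split=> x /=; rewrite in_cons.
    by move=> /orP[/eqP|]; [left|right].
  by move=> [->|->]; rewrite ?eqxx ?orbT.
rewrite big_cons bigcup_setU1.
by apply: (le_trans (outer_measureU2 nu _ _)); exact: leeD.
Qed.

Section triangulation.
Variables (R : realType) (d : nat) (Omega : set 'rV[R]_d).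
Variable Th : seq 'M[R]_(d.+1, d).
Hypothesis Omega_bounded : bounded_set Omega.
Hypothesis ThP : triangulation Omega Th.

Let nondeg S : S \in Th -> nondegenerate_simplex S.
Proof. by case: ThP => h _ _; exact: h. Qed.

Lemma open_triangulated : open Omega.
Proof. by case: ThP => _ _ ->; exact: open_interior. Qed.

Lemma interior_simplex_sub S : S \in Th -> (simplex S)° `<=` Omega.
Proof.
by move=> STh; case: ThP => _ _ ->; apply: interiorS => x Sx; exists S.
Qed.

(** The union of the simplices is closed, and their interiors, which lie in
    Omega, are dense in it. *)
Lemma closure_triangulated : closure Omega = \bigcup_(S in [set` Th]) simplex S.
Proof.
have cl : closed (\bigcup_(S in [set` Th]) simplex S).
  by apply: closed_bigcup => [|S /= STh]; [exact: finite_seq|exact/closed_simplex/nondeg].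
apply/seteqP; split.
  rewrite [X in _ `<=` X](closure_id _).1 //; apply: closureS.
  by case: ThP => _ _ ->; exact: interior_subset.
move=> x [S /= STh Sx]; apply: (closureS (interior_simplex_sub STh)).
exact: (simplex_sub_closure_interior (nondeg STh)).
Qed.

Lemma sub_closure_triangulated S : S \in Th -> simplex S `<=` closure Omega.
Proof. by move=> STh x Sx; rewrite closure_triangulated; exists S. Qed.

(* The union of the facets. *)
Definition skeleton : set 'rV[R]_d :=
  \bigcup_(S in [set` Th]) (simplex S `\` (simplex S)°).

Lemma bdry_sub_skeleton : bdry Omega `<=` skeleton.
Proof.
move=> x [clx nx]; move: clx; rewrite closure_triangulated => -[S /= STh Sx].
exists S => //; split=> // Six; apply: nx.
apply: (@open_nbhs_nbhs _ x Omega); split; first exact: open_triangulated.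
exact: (interior_simplex_sub STh).
Qed.

Lemma bounded_closure_triangulated : bounded_set (closure Omega).
Proof.
have [M M0 OM] := bounded_sub_box Omega_bounded.
exists M; split; first exact: num_real.
move=> K MK x /(closureS OM); rewrite -(closure_id _).1; last exact: closed_box.
move=> xM; rewrite /Num.norm /= mx_normrE; apply/bigmax_leP; split.
  exact: ltW (lt_trans M0 MK).
move=> [i j] _ /=; rewrite ord1 (le_trans _ (ltW MK)) // ler_norml.
by have := xM j; rewrite !mxE.
Qed.

Let facets := [seq (K, i) | K <- Th, i <- enum 'I_d.+1].

Let facet (z : 'M[R]_(d.+1, d) * 'I_d.+1) : set 'rV[R]_d :=
  if [exists k, bary_coef z.1 z.2 k != 0] then
    closure Omega `&` hyperplane (bary0 z.1 z.2) (bary_coef z.1 z.2) else set0.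

Let skeleton_sub : skeleton `<=` \bigcup_(z in [set` facets]) facet z.
Proof.
move=> x [S /= STh [Sx nSx]].
have [i [k [bk bx]]] := simplex_boundary (nondeg STh) Sx nSx.
exists (S, i); first by apply/allpairsP; exists (S, i); rewrite STh mem_enum.
rewrite /facet ifT; last by apply/existsP; exists k.
by split=> //; exact: (sub_closure_triangulated STh).
Qed.

(** Each facet lies in a hyperplane. *)
Lemma skeleton_vol_null : lebesgue_outer skeleton = 0%E.
Proof.
apply/eqP; rewrite eq_le outer_measure_ge0 andbT.
apply: (le_trans (le_outer_measure (@lebesgue_outer R d) _ _ skeleton_sub)).
apply: (le_trans (outer_measure_bigcup_seq _ _ _)); rewrite big1 // => z _.
rewrite /facet; case: ifP => [/existsP[k bk]|_]; last exact: outer_measure0.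
exact: hyperplane_vol_null bk bounded_closure_triangulated.
Qed.

Lemma skeleton_surf_fin : (hausdorff_outer d.-1 skeleton < +oo)%E.
Proof.
apply: (le_lt_trans (le_outer_measure (@hausdorff_outer R d d.-1) _ _ skeleton_sub)).
apply: (le_lt_trans (outer_measure_bigcup_seq _ _ _)); apply: lte_sum_pinfty => z _.
rewrite /facet; case: ifP => [/existsP[k bk]|_].
  exact: hyperplane_surf_fin bk bounded_closure_triangulated.
by rewrite outer_measure0.
Qed.

Lemma surf_bdry_fin : (hausdorff_outer d.-1 (bdry Omega) < +oo)%E.
Proof.
apply: le_lt_trans skeleton_surf_fin.
exact: (le_outer_measure (@hausdorff_outer R d d.-1)) bdry_sub_skeleton.
Qed.

End triangulation.

(** * Continuously differentiable functions *)

Section C1.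
Variables (R : realType) (V : normedModType R).
Implicit Types p q : V -> R.

Definition C1 p : Prop :=
  (forall x, differentiable p x) /\ forall v, continuous ('D_v p).

Lemma C1_continuous p : C1 p -> continuous p.
Proof. by move=> [dp _] x; exact: differentiable_continuous. Qed.

Lemma C1_cst (c : R) : C1 (fun=> c).
Proof.
split=> [x|v]; first exact: differentiable_cst.
rewrite (_ : 'D_v _ = fun=> 0); first by move=> x; exact: cst_continuous.
by apply/funext => x; exact: derive_cst.
Qed.

Lemma C1D p q : C1 p -> C1 q -> C1 (fun x => p x + q x).
Proof.
move=> [dp cp] [dq cq]; split=> [x|v]; first exact: differentiableD.
rewrite (_ : 'D_v _ = fun x => 'D_v p x + 'D_v q x).
  by move=> x; apply: (@continuousD _ _ _ ('D_v p)); [exact: cp|exact: cq].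
by apply/funext => x; apply: deriveD; exact: diff_derivable.
Qed.

Lemma C1M p q : C1 p -> C1 q -> C1 (fun x => p x * q x).
Proof.
move=> Cp Cq; have [dp cp] := Cp; have [dq cq] := Cq.
split=> [x|v]; first exact: differentiableM.
rewrite (_ : 'D_v _ = fun x => p x * 'D_v q x + q x * 'D_v p x).
  move=> x; apply: (@continuousD _ _ _ (fun x => p x * 'D_v q x)).
    by apply: (@continuousM _ _ p); [exact: C1_continuous|exact: cq].
  by apply: (@continuousM _ _ q); [exact: C1_continuous|exact: cp].
by apply/funext => x; apply: deriveM; exact: diff_derivable.
Qed.

Lemma C1V p : C1 p -> (forall x, p x != 0) -> C1 (fun x => (p x)^-1).
Proof.
move=> Cp p0; have [dp cp] := Cp.
split=> [x|v]; first exact: differentiableV.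
rewrite (_ : 'D_v _ = fun x => - ((p x)^-1 * (p x)^-1) * 'D_v p x).
  have cV : continuous (fun x => (p x)^-1).
    by move=> x; apply: cvgV => //; exact: C1_continuous.
  move=> x; apply: (@continuousM _ _ (fun x => - ((p x)^-1 * (p x)^-1))).
    apply: (@continuousN _ _ _ (fun x => (p x)^-1 * (p x)^-1)).
    by apply: (@continuousM _ _ (fun x => (p x)^-1)); exact: cV.
  exact: cp.
apply/funext => x; rewrite deriveV //; last exact: diff_derivable.
by rewrite expr2 invfM.
Qed.

Lemma C1_prod (I : Type) (r : seq I) (f : I -> V -> R) :
  (forall i, C1 (f i)) -> C1 (fun x => \prod_(i <- r) f i x).
Proof.
move=> Cf; elim: r => [|i r IH].
  by under eq_fun do rewrite big_nil; exact: C1_cst.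
by under eq_fun do rewrite big_cons; exact: C1M.
Qed.

(* The square of the positive part, the simplest C^1 function that vanishes
   exactly on a half-line. *)
Definition pos2 (t : R) : R := Num.max 0 t ^+ 2.

Lemma pos2_ge0 t : 0 <= pos2 t.
Proof. exact: sqr_ge0. Qed.

Lemma pos2_gt0 t : 0 < t -> 0 < pos2 t.
Proof. by move=> t0; rewrite /pos2 max_r ?ltW // exprn_gt0. Qed.

Lemma pos2_le0 t : t <= 0 -> pos2 t = 0.
Proof. by move=> t0; rewrite /pos2 max_l // expr0n. Qed.

Lemma pos2_taylor t h : `|pos2 (h + t) - pos2 t - h * (2 * Num.max 0 t)| <= h ^+ 2.
Proof.
rewrite /pos2; have [t0|t0] := leP 0 t; have [th0|th0] := leP 0 (h + t);
  rewrite ler_norml; apply/andP; split; nra.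
Qed.

Lemma is_derive_pos2 (t : R) : is_derive t (1 : R) pos2 (2 * Num.max 0 t).
Proof.
suff h : (fun h => h^-1 *: ((pos2 \o shift t) (h *: 1) - pos2 t)) @ 0^' --> 2 * Num.max 0 t.
  by split; [apply/cvg_ex; exists (2 * Num.max 0 t)|exact: cvg_lim].
apply/cvgrPdist_le => e e0; near=> h.
have h0 : h != 0 by near: h; exact: nbhs_dnbhs_neq.
have he : `|h| <= e by near: h; apply: dnbhs0_le.
rewrite /= [h *: 1]mulr1 [_ *: _]/(_ * _) distrC.
have -> : h^-1 * (pos2 (h + t) - pos2 t) - 2 * Num.max 0 t =
    h^-1 * (pos2 (h + t) - pos2 t - h * (2 * Num.max 0 t)).
  by field.
rewrite normrM normfV ler_pdivrMl ?normr_gt0 //; apply: (le_trans (pos2_taylor _ _)).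
by rewrite -(real_normK (num_real h)) expr2 ler_wpM2l.
Unshelve. all: by end_near. Qed.

Lemma C1_pos2 p : C1 p -> C1 (fun x => pos2 (p x)).
Proof.
move=> Cp; have [dp cp] := Cp.
have dpos2 t : differentiable pos2 t.
  by apply/derivable1_diffP; case: (is_derive_pos2 t).
split=> [x|v]; first exact: differentiable_comp.
rewrite (_ : 'D_v _ = fun x => (2 * Num.max 0 (p x)) * 'D_v p x).
  move=> x; apply: (@continuousM _ _ (fun x => 2 * Num.max 0 (p x))); last exact: cp.
  apply: (@continuousM _ _ (fun=> 2)); first exact: cst_continuous.
  apply: (@continuous_max _ _ (fun=> 0) p); first exact: cst_continuous.
  exact: C1_continuous.
apply/funext => x; rewrite deriveE; last exact: differentiable_comp.
rewrite (diff_comp (dp x) (dpos2 (p x))) /= diff1E // -deriveE // mulrC.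
by congr (_ * _); rewrite derive1E; case: (is_derive_pos2 (p x)).
Qed.

End C1.

Lemma C1_coord (R : realType) d (i : 'I_d) : C1 (fun x : 'rV[R]_d => x 0 i).
Proof.
split=> [x|v]; first exact: differentiable_coord.
rewrite (_ : 'D_v _ = fun=> v 0 i); first by move=> x; exact: cst_continuous.
apply/funext => x; apply: lim_near_cst => //; near=> h.
have h0 : h != 0 by near: h; exact: nbhs_dnbhs_neq.
by rewrite /= !mxE addrK [_ *: _]mulrA mulVf // mul1r.
Unshelve. all: by end_near. Qed.

(** * The fundamental lemma of the calculus of variations *)

(** Stated for any outer measure that measures half-spaces, so that it applies
    both to volumes and to surfaces. *)
Lemma continuous_caratheodory_measurable (R : realType) (d : nat)
    (nu : {outer_measure set 'rV[R]_d -> \bar R})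
    (A B : set 'rV[R]_d) (f : 'rV[R]_d -> R) :
  (forall i c, nu.-caratheodory [set x : 'rV[R]_d | c < x 0 i]) ->
  A `<=` B -> {within B, continuous f} -> measurable (A : set (caratheodory_type nu)) ->
  measurable_fun (A : set (caratheodory_type nu)) (f : caratheodory_type nu -> R).
Proof.
move=> half AB cf mA; apply: (measurability _ (RGenOpens.measurableE R)) => //.
move=> _ [_ [a [b ->] <-]].
have oab : open (`]a, b[%classic : set R) by exact: interval_open.
have /continuousP/(_ _ oab)/open_subspaceP[V oV VB] := cf.
rewrite (_ : _ `&` _ = A `&` V); first exact: measurableI (open_caratheodory half oV).
apply/seteqP; split=> x [Ax].
  by move=> abx; split=> //; have [] : (V `&` B) x by rewrite VB; split=> //; exact: AB.
by move=> Vx; split=> //; have [] : (f @^-1` `]a, b[%classic `&` B) x by rewrite -VB; split=> //; exact: AB.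
Qed.

(* Products of these functions approximate the indicator functions of boxes. *)
Definition bump (R : realType) d (a b : 'rV[R]_d) (n : nat) (x : 'rV[R]_d) : R :=
  \prod_(i < d) (pos2 (x 0 i - a 0 i) * pos2 (b 0 i - x 0 i) *
    (pos2 (x 0 i - a 0 i) * pos2 (b 0 i - x 0 i) + n.+1%:R^-1)^-1).

Section bump.
Variables (R : realType) (d : nat) (a b : 'rV[R]_d).
Let q (i : 'I_d) (x : 'rV[R]_d) : R := pos2 (x 0 i - a 0 i) * pos2 (b 0 i - x 0 i).

Let q_ge0 i x : 0 <= q i x.
Proof. by rewrite mulr_ge0 // pos2_ge0. Qed.

Let den_gt0 n i x : 0 < q i x + n.+1%:R^-1.
Proof. by rewrite ltr_wpDl // invr_gt0. Qed.

Lemma C1_bump n : C1 (bump a b n).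
Proof.
apply: C1_prod => i.
have Cq : C1 (q i).
  apply: C1M; apply: C1_pos2.
    apply: (@C1D _ _ (fun x : 'rV[R]_d => x 0 i) (fun=> - a 0 i)).
      exact: C1_coord.
    exact: C1_cst.
  apply: (@C1D _ _ (fun=> b 0 i) (fun x : 'rV[R]_d => - x 0 i)); first exact: C1_cst.
  rewrite (_ : (fun x => _) = fun x : 'rV[R]_d => -1 * x 0 i).
    by apply: (@C1M _ _ (fun=> -1)); [exact: C1_cst|exact: C1_coord].
  by apply/funext => x; rewrite mulN1r.
apply: C1M => //; apply: (@C1V _ _ (fun x => q i x + n.+1%:R^-1)).
  by apply: (@C1D _ _ (q i) (fun=> n.+1%:R^-1)) => //; exact: C1_cst.
by move=> x; rewrite gt_eqF.
Qed.

Lemma bump_ge0_le1 n x : 0 <= bump a b n x <= 1.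
Proof.
have h i : 0 <= q i x * (q i x + n.+1%:R^-1)^-1 <= 1.
  rewrite mulr_ge0 ?invr_ge0 ?(ltW (den_gt0 _ _ _)) //=.
  by rewrite ler_pdivrMr // mul1r lerDl.
apply/andP; split; first by apply: prodr_ge0 => i _; have /andP[] := h i.
by apply: prodr_ile1 => i _; exact: h.
Qed.

Lemma bump_out n x : ~ obox a b x -> bump a b n x = 0.
Proof.
move=> xn; have [i] : exists i, ~~ (a 0 i < x 0 i < b 0 i).
  by apply: contrapT => h; apply: xn => i; apply/negPn/negP => hi; apply: h; exists i.
rewrite negb_and -!leNgt => ab; rewrite /bump (bigD1 i) //=.
suff qi0 : q i x = 0 by rewrite -/(q i x) qi0 !mul0r.
rewrite /q; case/orP: ab => h; first by rewrite pos2_le0 ?mul0r // subr_le0.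
by rewrite [X in _ * X]pos2_le0 ?mulr0 // subr_le0.
Qed.

Lemma bump_cvg x : obox a b x -> bump a b n x @[n --> \oo] --> (1 : R).
Proof.
move=> abx.
have -> : (1 : R) = \prod_(i < d) (q i x * (q i x + 0)^-1).
  rewrite big1 // => i _; rewrite addr0 mulfV // gt_eqF // mulr_gt0 // pos2_gt0 //.
    by rewrite subr_gt0; have /andP[] := abx i.
  by rewrite subr_gt0; have /andP[] := abx i.
apply: (@cvg_big R); first exact: mul_continuous.
move=> i _; have qi : 0 < q i x.
  by rewrite mulr_gt0 // pos2_gt0 // subr_gt0; have /andP[] := abx i.
apply: cvgMl_tmp; apply: cvgV; first by rewrite addr0 gt_eqF.
apply: (@cvgD _ R); first exact: (@cvg_cst R).
exact: cvg_harmonic.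
Qed.

Lemma test_function_bump n (Omega : set 'rV[R]_d) : box a b `<=` Omega ->
  test_function Omega (bump a b n).
Proof.
move=> abO; have [dp cp] := C1_bump n; split=> //.
exists (box a b); split=> //.
  rewrite (_ : box a b = [set v : 'rV[R]_d | forall i, `[a 0 i, b 0 i]%classic (v ord0 i)]).
    apply: (@rV_compact _ _ (fun i => `[a 0 i, b 0 i]%classic)) => i.
    exact: segment_compact.
  by apply/seteqP; split=> x /= h i; have := h i; rewrite in_itv.
by move=> x nx; apply: bump_out => /obox_sub_box.
Qed.

End bump.

Lemma oboxI (R : realType) d (a b a' b' : 'rV[R]_d) : obox a b `&` obox a' b' =
  obox (\row_i Num.max (a 0 i) (a' 0 i)) (\row_i Num.min (b 0 i) (b' 0 i)).
Proof.
apply/seteqP; split=> [x [x1 x2] i|x xab].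
  by have /andP[h1 h2] := x1 i; have /andP[h3 h4] := x2 i; rewrite !mxE gt_max lt_min h1 h2 h3.
by split=> i; have := xab i; rewrite !mxE gt_max lt_min => /andP[/andP[h1 h2] /andP[h3 h4]];
  apply/andP.
Qed.

Section fundamental_lemma.
Variables (R : realType) (d : nat) (Omega : set 'rV[R]_d) (h : 'rV[R]_d -> R).
Local Notation T := (caratheodory_type (@lebesgue_outer R d)).
Local Notation mu := (vol R d).
Hypothesis Omega_open : open Omega.
Hypothesis Omega_bounded : bounded_set Omega.
Hypothesis h_int : mu.-integrable Omega (EFin \o h).
Hypothesis h_weak : forall p, test_function Omega p ->
  \int[mu]_(x in Omega) (h x * p x) = 0.

Let mOmega : measurable (Omega : set T).
Proof. exact: open_vol_measurable. Qed.

Let mh : measurable_fun (Omega : set T) (h : T -> R).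
Proof. by apply/measurable_EFinP; case/integrableP: h_int. Qed.

Lemma open_obox (a b : 'rV[R]_d) : open (obox a b).
Proof.
rewrite openE => x xab.
apply: (@filterS _ (nbhs x) _ (fun y => forall i, a 0 i < y 0 i < b 0 i)) => //.
apply: (@filter_forall _ _ _ _ (@nbhs_filter 'rV[R]_d x)) => i.
have /andP[ax xb] := xab i.
have h1 : nbhs x (fun y : 'rV[R]_d => a 0 i < y 0 i).
  exact: (@coord_continuous R 1 d 0 i x _ (lt_nbhsr ax)).
have h2 : nbhs x (fun y : 'rV[R]_d => y 0 i < b 0 i).
  exact: (@coord_continuous R 1 d 0 i x _ (lt_nbhsl xb)).
by apply: filterS2 h1 h2 => y -> ->.
Qed.

Let mobox a b : measurable (obox a b : set T).
Proof. exact/open_vol_measurable/open_obox. Qed.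

(** The bump functions are bounded by 1 and converge to the indicator function
    of the open box. *)
Lemma integral_obox a b : box a b `<=` Omega ->
  (\int[mu]_(x in obox a b) (h x)%:E = 0)%E.
Proof.
move=> abO.
have C1b n := @C1_bump R d a b n.
have mb n : measurable_fun (Omega : set T) (bump a b n : T -> R).
  apply: (@continuous_caratheodory_measurable _ _ _ _ setT) => //.
    exact: vol_halfspace.
  by apply: continuous_subspaceT; apply: C1_continuous.
pose f n (x : T) : \bar R := (h x * bump a b n x)%:E.
pose F : T -> \bar R := (EFin \o h) \_ (obox a b).
have mF : measurable_fun (Omega : set T) F.
  apply/(measurable_restrict _ (mobox a b) mOmega).
  apply: measurable_funS mOmega _ _; first by move=> x [].
  exact/measurable_EFinP.
have [|||||_ _] := @dominated_convergence _ _ _ mu Omega mOmega f F (abse \o (EFin \o h)).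
- by move=> n; apply/measurable_EFinP; exact: measurable_funM.
- exact: mF.
- apply: aeW => x Ox; rewrite /F /patch; case: ifPn => xab.
    apply: cvg_EFin; first by apply: nearW.
    have := @cvgMl_tmp _ _ _ _ _ (h x) _ (bump_cvg (set_mem xab)).
    by rewrite mulr1 => hc; exact: hc.
  rewrite (_ : (fun n => f n x) = fun=> 0%E); first exact: cvg_cst.
  apply/funext => n; rewrite /f bump_out ?mulr0 //.
  by move: xab; rewrite notin_setE.
- exact: integrable_abse.
- apply: aeW => x n Ox; rewrite /f /= lee_fin normrM ler_piMr //.
  by have /andP[b0 b1] := bump_ge0_le1 a b n x; rewrite ger0_norm.
have f0 n : (\int[mu]_(x in Omega) f n x = 0)%E.
  have fi : mu.-integrable Omega (f n).
    apply: le_integrable h_int => //; first by apply/measurable_EFinP; exact: measurable_funM.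
    move=> x Ox; rewrite /f /= lee_fin normrM ler_piMr //.
    by have /andP[b0 b1] := bump_ge0_le1 a b n x; rewrite ger0_norm.
  have := h_weak (test_function_bump n abO); rewrite /Rintegral => fz.
  by rewrite -[LHS]fineK ?fz //; exact: integrable_fin_num.
rewrite (_ : (fun n => _) = fun=> 0%E); last by apply/funext.
move/(cvg_unique (@ereal_hausdorff R)) => /(_ _ (cvg_cst _)) F0.
have -> : obox a b = Omega `&` obox a b.
  by rewrite setIidr // => x /obox_sub_box; exact: abO.
by rewrite integral_mkcondr.
Qed.

(* Borel sets, presented by a generating pi-system. *)
Let oboxes : set (set 'rV[R]_d) := [set obox ab.1 ab.2 | ab in [set: 'rV[R]_d * 'rV[R]_d]].
Local Notation BT := (g_sigma_algebraType oboxes).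

Let B_measurable (E : set 'rV[R]_d) : measurable (E : set BT) -> measurable (E : set T).
Proof.
apply: (@smallest_sub _ _ oboxes (@measurable _ T)); first exact: sigma_algebra_measurable.
by move=> _ [ab _ <-]; exact: mobox.
Qed.

Let B_obox a b : measurable (obox a b : set BT).
Proof. by apply: sub_sigma_algebra; exists (a, b). Qed.

Let B_box a b : measurable (box a b : set BT).
Proof.
rewrite (_ : box a b = \bigcap_n obox (a - const_mx n.+1%:R^-1) (b + const_mx n.+1%:R^-1)).
  by apply: bigcap_measurable => [|n _]; [exists 0%N|exact: B_obox].
apply/seteqP; split=> [x xab n _ i|x xab i].
  have /andP[h1 h2] := xab i; have n0 : 0 < n.+1%:R^-1 :> R by rewrite invr_gt0.
  by rewrite !mxE; move: (n.+1%:R^-1 : R) n0 => u u0; apply/andP; split; lra.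
have an n : a 0 i - n.+1%:R^-1 < x 0 i < b 0 i + n.+1%:R^-1.
  by have := xab n I i; rewrite !mxE.
by apply/andP; split; apply/ler_addgt0Pr => e e0;
   have /andP[h1 h2] := an (Num.truncn e^-1);
   have : (Num.truncn e^-1).+1%:R^-1 < e by
     [rewrite invf_plt ?posrE //; exact: truncnS_gt|];
   move: ((Num.truncn e^-1).+1%:R^-1 : R) h1 h2 => u; lra.
Qed.

(** The boxes of a nearly optimal cover of a set form a Borel set of nearly the
    same measure. *)
Let borel_hull (E : set 'rV[R]_d) (e : R) : 0 < e ->
  exists2 H : set 'rV[R]_d, measurable (H : set BT) /\ E `<=` H & (lebesgue_outer H <= lebesgue_outer E + e%:E)%E.
Proof.
move=> e0.
have [->|Efin] := eqVneq (lebesgue_outer E) +oo%E.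
  exists setT; first by split=> //; exact: (@measurableT _ BT).
  by rewrite addye // leey.
have e2 : 0 < e / 2 by rewrite divr_gt0.
have fin : lebesgue_outer E \is a fin_num.
  by rewrite ge0_fin_numE ?ltey // outer_measure_ge0.
have [_ [F EF <-] Flt] := lb_ereal_inf_adherent e2 fin.
have /choice[H hH] : forall k, exists H : set 'rV[R]_d,
    [/\ measurable (H : set BT), F k `<=` H &
    (lebesgue_outer H <= cost0 (@box_cost R d) (F k) + (e / 2 / (2 ^ k.+1)%:R)%:E)%E].
  move=> k; have ek : 0 < e / 2 / (2 ^ k.+1)%:R by rewrite !divr_gt0 // ltr0n expn_gt0.
  have [Fk0|Fk0] := pselect (F k = set0).
    exists set0; rewrite Fk0; split=> //.
    by rewrite cost0_set0 add0e outer_measure0 lee_fin ltW.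
  have [Fkoo|Fkfin] := eqVneq (cost0 (@box_cost R d) (F k)) +oo%E.
    exists setT; split=> //.
    by rewrite Fkoo addye // leey.
  move: Fkfin; rewrite /cost0 asboolF // => Fkfin.
  have Fkn : box_cost (F k) \is a fin_num.
    by rewrite ge0_fin_numE ?ltey // box_cost_ge0.
  have [_ [[a b] /= [ab Fab] <-] lt] := lb_ereal_inf_adherent ek Fkn.
  exists (box a b); split=> //; apply: le_trans (ltW lt).
  apply: (le_trans (cover_ext_le_cost (@box_cost_ge0 R d) _)).
  exact: box_cost_le.
exists (\bigcup_k H k).
  split; first by apply: bigcup_measurable => // k _; case: (hH k).
  by move=> x /EF[k _ Fkx]; exists k => //; case: (hH k) => _ FH _; exact: FH.
apply: (le_trans (outer_measure_sigma_subadditive (@lebesgue_outer R d) H)).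
apply: (@le_trans _ _ (\sum_(k <oo) (cost0 (@box_cost R d) (F k) + (e / 2 / (2 ^ k.+1)%:R)%:E))%E).
  by apply: lee_nneseries => [k _ _|k _]; [exact: outer_measure_ge0|case: (hH k)].
apply: (le_trans (epsilon_trick _ _ (ltW e2))).
  by move=> k; apply: cost0_ge0; exact: box_cost_ge0.
apply: (le_trans (leeD (ltW Flt) (lexx _))).
by rewrite -addeA -EFinD -splitr.
Qed.

(** Open boxes form a pi-system, so h has integral zero over the Borel subsets
    of a box inside Omega. *)
Let integral_borel a b (E : set 'rV[R]_d) : box a b `<=` Omega -> measurable (E : set BT) ->
  (\int[mu]_(x in obox a b `&` E) (h x)%:E = 0)%E.
Proof.
move=> abO.
have hQ : mu.-integrable (obox a b) (EFin \o h).
  by apply: integrableS h_int => // x /obox_sub_box; exact: abO.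
have hS A : measurable (A : set T) -> mu.-integrable (obox a b `&` A) (EFin \o h).
  move=> mA; apply: integrableS hQ => //.
  by apply: measurableI => //; exact: mobox.
apply: (@dynkin_induction _ BT oboxes
  [set E : set 'rV[R]_d | (\int[mu]_(x in obox a b `&` E) (h x)%:E = 0)%E]) => //.
- move=> _ _ [[a1 b1] _ <-] [[a2 b2] _ <-].
  exists (\row_i Num.max (a1 0 i) (a2 0 i), \row_i Num.min (b1 0 i) (b2 0 i)) => //=.
  by rewrite oboxI.
- by rewrite /= setIT integral_obox.
- move=> _ [[a1 b1] _ <-] /=.
  rewrite oboxI.
  apply: integral_obox => x xab; apply: abO => i; have := xab i.
  by rewrite !mxE ge_max le_min => /andP[/andP[-> _] /andP[-> _]].
- move=> A /B_measurable mA hA; rewrite /mkset in hA *.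
  have mI : measurable (obox a b `&` A : set T) by apply: measurableI => //; exact: mobox.
  have mIC : measurable (obox a b `&` ~` A : set T).
    by apply: measurableI; [exact: mobox|exact: measurableC].
  have split : (\int[mu]_(x in obox a b) (h x)%:E = \int[mu]_(x in obox a b `&` A) (h x)%:E
      + \int[mu]_(x in obox a b `&` ~` A) (h x)%:E)%E.
    rewrite -{1}(setIT (obox a b)) -(setUCr A) setIUr integral_setU_EFin //.
      by rewrite -setIUr setUCr setIT; apply/measurable_EFinP; case/integrableP: hQ.
    by apply/disj_setPS => x [[_ Ax] [_ nAx]].
  by move: split; rewrite (integral_obox abO) hA add0e.
move=> F mF tF F0; rewrite /mkset setI_bigcupr.
rewrite integral_bigcup //.
- by rewrite eseries0 // => k _ _; exact: F0.
- by apply: trivIset_setIl.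
- by move=> k; apply: measurableI; [exact: mobox|exact: B_measurable].
rewrite -setI_bigcupr; apply: hS; apply: bigcup_measurable => k _; exact: B_measurable.
Qed.

Let ae_eq_obox a b : box a b `<=` Omega -> ae_eq mu (obox a b) (EFin \o h) (cst 0%E).
Proof.
move=> abO.
have hQ : mu.-integrable (obox a b) (EFin \o h).
  by apply: integrableS h_int => // x /obox_sub_box; exact: abO.
apply: integral_ae_eq => // E EQ mE; rewrite integral0.
have /choice[H hH] : forall n, exists H : set 'rV[R]_d, [/\ measurable (H : set BT), E `<=` H &
    (lebesgue_outer H <= lebesgue_outer E + n.+1%:R^-1%:E)%E].
  move=> n; have n0 : 0 < n.+1%:R^-1 :> R by rewrite invr_gt0.
  by have [H [mH EH] HE] := borel_hull E n0; exists H.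
pose G := \bigcap_n H n.
have mG : measurable (G : set BT).
  by apply: bigcap_measurable => [|n _]; [exists 0%N|case: (hH n)].
have EG : E `<=` obox a b `&` G.
  by move=> x Ex; split; [exact: EQ|move=> n _; case: (hH n) => _ + _; exact].
have mQG : measurable (obox a b `&` G : set T).
  by apply: measurableI; [exact: mobox|exact: B_measurable].
have Efin : (mu E < +oo)%E.
  apply: (@le_lt_trans _ _ (mu Omega)); last exact: vol_bounded_fin.
  apply: (le_outer_measure (@lebesgue_outer R d)) => x /EQ /obox_sub_box.
  exact: abO.
have QGE : (mu (obox a b `&` G) <= mu E)%E.
  apply/lee_addgt0Pr => e e0.
  apply: (@le_trans _ _ (mu E + (Num.truncn e^-1).+1%:R^-1%:E)%E).
    case: (hH (Num.truncn e^-1)) => _ _; apply: le_trans.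
    by apply: (le_outer_measure (@lebesgue_outer R d)) => x [_ /(_ _ I)].
  rewrite leeD2l // lee_fin invf_ple ?posrE //; exact/ltW/truncnS_gt.
have null : mu ((obox a b `&` G) `\` E) = 0%E.
  suff le0 : (mu ((obox a b `&` G) `\` E) <= 0)%E.
    by apply/eqP; rewrite eq_le le0 measure_ge0.
  rewrite measureD //; last exact: le_lt_trans QGE Efin.
  by rewrite (setIidr EG) leeBlDr ?add0e // ge0_fin_numE.
have EE : E = (obox a b `&` G) `\` ((obox a b `&` G) `\` E) by rewrite setDD (setIidr EG).
rewrite {1}EE -negligible_integral //.
- exact: integral_borel.
- exact: measurableD.
- by apply: integrableS hQ => // x [].
Qed.

(** On a box inside Omega all integrals over measurable subsets vanish, and
    countably many such boxes exhaust Omega. *)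
Lemma fundamental_lemma : ae_eq mu Omega h (cst 0).
Proof.
pose Q (ab : 'rV[rat]_d * 'rV[rat]_d) := obox (rat_row R ab.1) (rat_row R ab.2).
pose N (ab : 'rV[rat]_d * 'rV[rat]_d) :=
  if `[< box (rat_row R ab.1) (rat_row R ab.2) `<=` Omega >]
  then Q ab `&` [set x | h x <> 0] else set0.
pose M n := oapp N set0 (unpickle n).
have : mu.-negligible (\bigcup_n M n).
  apply: negligible_bigcup => n; rewrite /M; case: unpickle => [ab|]; last exact: negligible_set0.
  rewrite /oapp /N; case: asboolP => [abO|_]; last exact: negligible_set0.
  have [B [mB B0 sub]] := ae_eq_obox abO; exists B; split=> // x [Qx hx].
  by apply: sub => /(_ Qx) /= [].
apply: negligibleS => x /=; rewrite /cst => hx.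
have /not_implyP[Ox hx0] := hx.
move: Ox; rewrite (open_bigcup_obox Omega_open) => -[ab /= abO Qx].
by exists (pickle ab) => //; rewrite /M pickleK /= /N asboolT.
Qed.

End fundamental_lemma.

(** * Square-integrable matrix fields *)

Section sqint.
Context disp (T : measurableType disp) (R : realType) (mu : {measure set T -> \bar R}).
Variable A : set T.
Hypothesis mA : measurable A.
Implicit Types f g : T -> R.

Definition sqint f : Prop :=
  measurable_fun A f /\ mu.-integrable A (EFin \o (fun x => f x ^+ 2)).

Let integrable_le f g : measurable_fun A f -> mu.-integrable A (EFin \o g) ->
  (forall x, A x -> `|f x| <= g x) -> mu.-integrable A (EFin \o f).
Proof.
move=> mf ig fg; apply: le_integrable ig => //; first exact/measurable_EFinP.
by move=> x Ax /=; rewrite lee_fin (le_trans (fg x Ax)) // ler_norm.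
Qed.

Lemma sqint_prod f g : sqint f -> sqint g ->
  mu.-integrable A (EFin \o (fun x => f x * g x)).
Proof.
move=> [mf if2] [mg ig2].
apply: (@integrable_le _ (fun x => f x ^+ 2 + g x ^+ 2)).
- exact: measurable_funM.
- by have := integrableD mA if2 ig2.
- by move=> x _; rewrite ler_norml; apply/andP; split; nra.
Qed.

Lemma sqintD f g : sqint f -> sqint g -> sqint (fun x => f x + g x).
Proof.
move=> [mf if2] [mg ig2]; split; first exact: measurable_funD.
apply: (@integrable_le _ (fun x => 2 * f x ^+ 2 + 2 * g x ^+ 2)).
- by apply: measurable_funX; exact: measurable_funD.
- by have := integrableD mA (integrableZl mA 2 if2) (integrableZl mA 2 ig2).
- move=> x _; rewrite ger0_norm ?sqr_ge0 // -subr_ge0.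
  by rewrite (_ : _ - _ = (f x - g x) ^+ 2) ?sqr_ge0 //; ring.
Qed.

Lemma sqintZ (c : R) f : sqint f -> sqint (fun x => c * f x).
Proof.
move=> [mf if2]; split; first exact: measurable_funM.
apply: eq_integrable (integrableZl mA (c ^+ 2) if2) => // x _.
by rewrite /= exprMn EFinM.
Qed.

Lemma sqint0 : sqint (fun=> 0).
Proof.
split; first exact: measurable_cst.
rewrite (_ : _ \o _ = cst 0%E); first exact: integrable0.
by apply/funext => x /=; rewrite expr0n.
Qed.

Lemma sqint_sum (I : Type) (r : seq I) (f : I -> T -> R) :
  (forall i, sqint (f i)) -> sqint (fun x => \sum_(i <- r) f i x).
Proof.
move=> sf; elim: r => [|i r IH].
  by under eq_fun do rewrite big_nil; exact: sqint0.
by under eq_fun do rewrite big_cons; exact: sqintD.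
Qed.

Lemma sqint_bounded f M : (mu A < +oo)%E -> measurable_fun A f ->
  (forall x, A x -> `|f x| <= M) -> sqint f.
Proof.
move=> Afin mf fM; split=> //; apply: measurable_bounded_integrable => //.
  exact: measurable_funX.
exists (M ^+ 2); split; first exact: num_real.
move=> K MK x Ax /=; rewrite normrX (le_trans _ (ltW MK)) //.
by rewrite ler_sqr ?nnegrE ?fM // (le_trans _ (fM x Ax)).
Qed.

Lemma integrable_sumR (I : Type) (r : seq I) (f : I -> T -> R) :
  (forall i, mu.-integrable A (EFin \o f i)) ->
  mu.-integrable A (EFin \o (fun x => \sum_(i <- r) f i x)).
Proof.
move=> intf; have := @integrable_sum _ _ _ mu A mA I r xpredT (fun i => EFin \o f i) (fun i _ => intf i).
by apply: eq_integrable => // x _; rewrite /= sumEFin.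
Qed.

Section matrix_valued.
Variables m n : nat.
Implicit Types F G H : T -> 'M[R]_(m, n).

Lemma L2P F : L2 mu A F <-> forall i j, sqint (fun x => F x i j).
Proof.
split=> [[mF Ffin] i j|sF].
  split=> //.
  have iF : mu.-integrable A (EFin \o (fun x => mdot (F x) (F x))).
    apply/integrableP; split.
      apply/measurable_EFinP; apply: measurable_sum => k; apply: measurable_sum => l.
      exact: measurable_funM.
    by under eq_integral do rewrite gee0_abs ?lee_fin ?mdot_ge0 //.
  apply: integrable_le iF _; first exact: measurable_funX.
  move=> x Ax; rewrite ger0_norm ?sqr_ge0 // /mdot (bigD1 i) //= (bigD1 j) //= expr2.
  rewrite -addrA lerDl addr_ge0 ?sumr_ge0 // => k _; rewrite -?expr2 ?sqr_ge0 //.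
  by apply: sumr_ge0 => l _; rewrite -expr2 sqr_ge0.
split=> [i j|]; first by case: (sF i j).
apply: integrable_lty => //; rewrite /mdot.
apply: integrable_sumR => i; apply: integrable_sumR => j.
by case: (sF i j).
Qed.

Lemma L2_bounded F M : (mu A < +oo)%E ->
  (forall i j, measurable_fun A (fun x => F x i j)) ->
  (forall x i j, A x -> `|F x i j| <= M) -> L2 mu A F.
Proof.
by move=> Afin mF FM; apply/L2P => i j; apply: (@sqint_bounded _ M) => // x; exact: FM.
Qed.

Lemma L2D F G : L2 mu A F -> L2 mu A G -> L2 mu A (fun x => F x + G x).
Proof.
move=> /L2P sF /L2P sG; apply/L2P => i j; under eq_fun do rewrite mxE.
exact: sqintD.
Qed.

Lemma L2Z c F : L2 mu A F -> L2 mu A (fun x => c *: F x).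
Proof.
move=> /L2P sF; apply/L2P => i j; under eq_fun do rewrite mxE.
exact: sqintZ.
Qed.

Lemma mdot_integrable F G : L2 mu A F -> L2 mu A G ->
  mu.-integrable A (EFin \o (fun x => mdot (F x) (G x))).
Proof.
move=> /L2P sF /L2P sG; apply: integrable_sumR => i; apply: integrable_sumR => j.
exact: sqint_prod.
Qed.

Lemma mdotDl (B C D : 'M[R]_(m, n)) : mdot (B + C) D = mdot B D + mdot C D.
Proof.
rewrite /mdot -big_split; apply: eq_bigr => i _; rewrite -big_split.
by apply: eq_bigr => j _; rewrite mxE mulrDl.
Qed.

Lemma mdotZl c (B C : 'M[R]_(m, n)) : mdot (c *: B) C = c * mdot B C.
Proof.
rewrite /mdot mulr_sumr; apply: eq_bigr => i _; rewrite mulr_sumr.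
by apply: eq_bigr => j _; rewrite mxE mulrA.
Qed.

Lemma mdotC (B C : 'M[R]_(m, n)) : mdot B C = mdot C B.
Proof. by apply: eq_bigr => i _; apply: eq_bigr => j _; rewrite mulrC. Qed.

Lemma mdot_eq0 (B : 'M[R]_(m, n)) : mdot B B = 0 -> B = 0.
Proof.
move=> B0; apply/matrixP => i j; rewrite mxE; apply/eqP; rewrite -normr_eq0 eq_le normr_ge0 andbT.
by apply: le_trans (coord_le_enorm B i j) _; rewrite /enorm B0 sqrtr0.
Qed.

Lemma L2dotC F G : L2dot mu A F G = L2dot mu A G F.
Proof. by apply: eq_Rintegral => x _; exact: mdotC. Qed.

Lemma L2dotDl F G H : L2 mu A F -> L2 mu A G -> L2 mu A H ->
  L2dot mu A (fun x => F x + G x) H = L2dot mu A F H + L2dot mu A G H.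
Proof.
move=> LF LG LH; rewrite /L2dot -RintegralD //; [|exact: mdot_integrable..].
by apply: eq_Rintegral => x _; rewrite mdotDl.
Qed.

Lemma L2dotZl c F G : L2 mu A F -> L2 mu A G ->
  L2dot mu A (fun x => c *: F x) G = c * L2dot mu A F G.
Proof.
move=> LF LG; rewrite /L2dot -RintegralZl //; last exact: mdot_integrable.
by apply: eq_Rintegral => x _; rewrite mdotZl.
Qed.

Lemma measurable_mdot F G : L2 mu A F -> L2 mu A G ->
  measurable_fun A (fun x => mdot (F x) (G x)).
Proof.
move=> [mF _] [mG _]; apply: measurable_sum => i; apply: measurable_sum => j.
exact: measurable_funM.
Qed.

Lemma L2dot_ae F F' G G' : L2 mu A F -> L2 mu A F' -> L2 mu A G -> L2 mu A G' ->
  (\forall x \ae mu, A x -> F x = F' x) -> (\forall x \ae mu, A x -> G x = G' x) ->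
  L2dot mu A F G = L2dot mu A F' G'.
Proof.
move=> LF LF' LG LG' FF' GG'; rewrite /L2dot /Rintegral; congr fine.
apply: ae_eq_integral => //; [exact/measurable_EFinP/measurable_mdot..|].
by apply: filterS2 FF' GG' => x FF' GG' Ax; rewrite FF' // GG'.
Qed.

Lemma L2dot_eq0 F G : L2 mu A F -> L2 mu A G -> (forall x, A x -> 0 <= mdot (F x) (G x)) ->
  L2dot mu A F G = 0 -> \forall x \ae mu, A x -> mdot (F x) (G x) = 0.
Proof.
move=> LF LG FG0 dot0.
have fz : (\int[mu]_(x in A) (mdot (F x) (G x))%:E)%E \is a fin_num.
  by apply: integrable_fin_num => //; exact: mdot_integrable.
have I0 : (\int[mu]_(x in A) (mdot (F x) (G x))%:E = 0)%E.
  by rewrite -(fineK fz); congr EFin; exact: dot0.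
have mFG : measurable_fun A (fun x => (mdot (F x) (G x))%:E).
  exact/measurable_EFinP/measurable_mdot.
have : (\int[mu]_(x in A) `|(mdot (F x) (G x))%:E| = 0)%E.
  rewrite -[RHS]I0; apply: eq_integral => x xA.
  by rewrite gee0_abs // lee_fin FG0 //; exact: set_mem.
move/(ae_eq_integral_abs mu mA mFG); apply: filterS => x h Ax.
by have [] := h Ax.
Qed.

End matrix_valued.

End sqint.

(** * Continuous piecewise affine functions *)

(** Growth of a real function is controlled by its growth on the members of a
    finite closed cover: near each point only the members that contain the
    point matter. *)
Lemma lipschitz_closed_cover (R : realType) (I : choiceType) (r : seq I) (F : I -> set R)
    (f : R -> R) (a b L : R) : a <= b -> 0 <= L ->
  (forall i, i \in r -> closed (F i)) ->
  (forall t, a <= t <= b -> exists2 i, i \in r & F i t) ->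
  (forall i s t, i \in r -> F i s -> F i t -> a <= s <= b -> a <= t <= b ->
    `|f s - f t| <= L * `|s - t|) ->
  `|f b - f a| <= L * (b - a).
Proof.
move=> ab L0 cF cov lip.
have local s : a <= s <= b -> exists2 e : R, 0 < e &
    forall t, a <= t <= b -> `|t - s| < e -> `|f t - f s| <= L * `|t - s|.
  move=> sab.
  have cG : closed (\bigcup_(i in [set` [seq i <- r | ~~ `[< F i s >]]]) F i).
    apply: closed_bigcup => [|i /=]; first exact: finite_seq.
    by rewrite mem_filter => /andP[_]; exact: cF.
  have nGs : (~` (\bigcup_(i in [set` [seq i <- r | ~~ `[< F i s >]]]) F i)) s.
    by move=> [i /=]; rewrite mem_filter => /andP[/asboolPn h _] /h.
  have /nbhs_ballP[e /= e0 eG] := open_nbhs_nbhs (conj (closed_openC cG) nGs).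
  exists e => // t tab te.
  have [i ir Ft] := cov _ tab.
  have Fs : F i s.
    apply: contrapT => nFs; apply: (eG t); first by rewrite /ball /= distrC.
    by exists i => //=; rewrite mem_filter ir andbT; apply/asboolPn.
  exact: (lip i).
pose A := [set t | a <= t <= b /\ `|f t - f a| <= L * (t - a)].
have Aa : A a by split; rewrite ?lexx // !subrr normr0 mulr0.
have supA : has_sup A by split; [exists a|exists b => t [/andP[]]].
pose s := sup A.
have as_ : a <= s by apply: ub_le_sup => //; case: supA.
have sb : s <= b by apply: ge_sup => [|t [/andP[]]] //; exists a.
have [e e0 he] := local s (introT andP (conj as_ sb)).
have As : A s.
  have [t At st] := sup_adherent e0 supA; have [/andP[a_t tb] ht] := At.
  have ts : t <= s by apply: ub_le_sup => //; case: supA.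
  split; first by rewrite as_.
  have := he t; rewrite a_t tb => /(_ isT); rewrite ler0_norm ?subr_le0 // => /(_ _) h.
  have {}h : `|f t - f s| <= L * (s - t).
    by rewrite -[s - t]opprB; apply: h; rewrite /s; lra.
  have -> : f s - f a = (f s - f t) + (f t - f a) by ring.
  apply: (le_trans (ler_normD _ _)); rewrite [`|f s - f t|]distrC.
  by apply: (le_trans (lerD h ht)); rewrite -mulrDr ler_wpM2l //; lra.
have [sltb|bs] := ltP s b; last first.
  have sbE : s = b by apply/eqP; rewrite eq_le sb.
  by have [_] := As; rewrite sbE.
exfalso; pose t := Num.min b (s + e / 2).
have e2 : 0 < e / 2 by rewrite divr_gt0.
have st : s < t by rewrite lt_min sltb ltrDl.
have tb : t <= b by rewrite ge_min lexx.
have tse : t - s < e.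
  apply: (@le_lt_trans _ _ (e / 2)); last by lra.
  by rewrite lerBlDl ge_min lexx orbT.
have At : A t.
  split; first by rewrite tb (le_trans as_) // ltW.
  have := he t; rewrite tb (le_trans as_ (ltW st)) => /(_ isT).
  rewrite ger0_norm ?subr_ge0 ?(ltW st) // => /(_ tse) h.
  have [_ hs] := As.
  have -> : f t - f a = (f t - f s) + (f s - f a) by ring.
  apply: (le_trans (ler_normD _ _)); apply: (le_trans (lerD h hs)).
  by rewrite -mulrDr ler_wpM2l //; lra.
have : t <= s by apply: ub_le_sup => //; case: supA.
by rewrite leNgt st.
Qed.

Section piecewise_affine.
Variables (R : realType) (d : nat) (Omega : set 'rV[R]_d).
Variable Th : seq 'M[R]_(d.+1, d).
Hypothesis Omega_bounded : bounded_set Omega.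
Hypothesis ThP : triangulation Omega Th.
Local Notation T := (caratheodory_type (@lebesgue_outer R d)).
Local Notation mu := (vol R d).

Let nondeg S : S \in Th -> nondegenerate_simplex S.
Proof. by case: ThP => h _ _; exact: h. Qed.

(** The order in which a segment meets the simplices is immaterial: all that
    counts is that they cover it. *)
Lemma segment_growth (g : 'rV[R]_d -> R) (x y : 'rV[R]_d) (L : R) : 0 <= L ->
  (forall t, 0 <= t <= 1 -> closure Omega (x + t *: (y - x))) ->
  (forall S p q c, S \in Th -> simplex S p -> simplex S q -> p - q = c *: (y - x) ->
    `|g p - g q| <= L * `|c|) ->
  `|g y - g x| <= L.
Proof.
move=> L0 xyO gL; pose l t := x + t *: (y - x).
have cl : continuous l.
  move=> t; apply: cvgD; first exact: cvg_cst.
  by apply: cvgZr_tmp; exact: cvg_id.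
have := @lipschitz_closed_cover R _ Th (fun S => l @^-1` simplex S) (g \o l) 0 1 L ler01 L0.
rewrite /= /l scale1r scale0r addr0 [x + _]addrC subrK subr0 mulr1; apply.
- move=> S STh; apply: closed_comp; first by move=> t _; exact: cl.
  exact/closed_simplex/nondeg.
- move=> t /xyO; rewrite (closure_triangulated ThP) => -[S /= STh Sl].
  by exists S.
- move=> S s t STh Ss St _ _; apply: gL STh Ss St _.
  by rewrite opprD addrACA subrr add0r -scalerBl.
Qed.

Lemma off_skeleton_interior S x : S \in Th -> simplex S x -> ~ skeleton Th x ->
  (simplex S)° x.
Proof. by move=> STh Sx nx; apply: contrapT => h; apply: nx; exists S. Qed.

Lemma skeleton_ae (P : 'rV[R]_d -> Prop) :
  (forall x, Omega x -> ~ skeleton Th x -> P x) -> \forall x \ae mu, Omega x -> P x.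
Proof.
move=> h; have /vol_negligible := skeleton_vol_null Omega_bounded ThP.
apply: negligibleS => x /= /not_implyP[Ox nP]; apply: contrapT => nx.
by apply: nP; exact: h.
Qed.

(** The order of the list breaks the ties between simplices that share a
    point. *)
Fixpoint piecewise (E : zmodType) (r : seq 'M[R]_(d.+1, d)) (A : 'M[R]_(d.+1, d) -> E)
    (x : 'rV[R]_d) : E :=
  if r is K :: r' then if `[< simplex K x >] then A K else piecewise r' A x else 0.

Lemma piecewiseP (E : zmodType) r (A : 'M[R]_(d.+1, d) -> E) x :
  (exists2 S, S \in r & simplex S x) ->
  exists S, [/\ S \in r, simplex S x & piecewise r A x = A S].
Proof.
elim: r => [|S r IH] [S' S'r S'x] //=; case: asboolP => Sx.
  by exists S; split=> //; rewrite inE eqxx.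
have [|K [Kr Kx ->]] := IH.
  by move: S'r; rewrite inE => /orP[/eqP E'|S'r]; [move: S'x; rewrite E'|exists S'].
by exists K; split=> //; rewrite inE Kr orbT.
Qed.

Lemma measurable_piecewise r (A : 'M[R]_(d.+1, d) -> R) (D : set T) :
  {subset r <= Th} -> measurable D ->
  measurable_fun D (piecewise r A : T -> R).
Proof.
move=> rTh mD; elim: r rTh => [|S r IH] rTh /=; first exact: measurable_cst.
have mS : measurable (simplex S : set T).
  by apply/closed_vol_measurable/closed_simplex/nondeg/rTh; rewrite inE eqxx.
rewrite (_ : (fun x => _) = fun x : T => \1_(simplex S) x * A S + (1 - \1_(simplex S) x) * piecewise r A x).
  apply: measurable_funD; apply: measurable_funM.
  - exact: measurable_indic.
  - exact: measurable_cst.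
  - by apply: measurable_funB; [exact: measurable_cst|exact: measurable_indic].
  - by apply: IH => K Kr; apply: rTh; rewrite inE Kr orbT.
apply/funext => x; rewrite indicE; case: asboolP => Sx.
  by rewrite mem_set // mul1r subrr mul0r addr0.
by rewrite memNset // mul0r subr0 mul1r add0r.
Qed.

Section Xh_function.
Variable v : 'rV[R]_d -> 'rV[R]_d.
Hypothesis vXh : Xh Omega Th v.

Lemma Xh_affine : exists (A : 'M[R]_(d.+1, d) -> 'M[R]_d) (b : 'M[R]_(d.+1, d) -> 'rV[R]_d),
  forall S x, S \in Th -> simplex S x -> v x = x *m A S + b S.
Proof.
case: vXh => _ vA.
have /choice[Ab hAb] : forall S, exists Ab : 'M[R]_d * 'rV[R]_d, S \in Th ->
    forall x, simplex S x -> v x = x *m Ab.1 + Ab.2.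
  move=> S; have [STh|nS] := boolP (S \in Th); last by exists (0, 0).
  by have [A [b h]] := vA S STh; exists (A, b).
by exists (fun S => (Ab S).1), (fun S => (Ab S).2) => S x STh Sx; exact: hAb.
Qed.

Lemma Xh_within_continuous i : {within closure Omega, continuous (fun x => v x 0 i)}.
Proof.
case: vXh => cv _; apply/subspace_continuousP => x Ox.
move/subspace_continuousP/(_ x Ox): cv => cvx.
exact: (cvg_comp v (fun y : 'rV[R]_d => y 0 i) cvx (@coord_continuous R 1 d 0 i (v x))).
Qed.

Lemma compact_closure : compact (closure Omega).
Proof.
apply: bounded_closed_compact; last exact: closed_closure.
exact: bounded_closure_triangulated.
Qed.

Lemma Xh_bounded : exists2 M : R, 0 <= M & forall x i, closure Omega x -> `|v x 0 i| <= M.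
Proof.
have [cv _] := vXh.
have /compact_bounded[M [_ hM]] := continuous_compact cv compact_closure.
exists (`|M| + 1); first by rewrite addr_ge0.
move=> x i Ox; apply: (le_trans (normr_coord _ _ _)).
apply: hM; last by exists x.
by rewrite (le_lt_trans (ler_norm _)) // ltrDl.
Qed.

Lemma Xh_lipschitz : exists2 L : R, 0 <= L & forall x y i,
  (forall t, 0 <= t <= 1 -> closure Omega (x + t *: (y - x))) ->
  `|v y 0 i - v x 0 i| <= L * `|y - x|.
Proof.
have [A [b vA]] := Xh_affine.
pose L := \sum_(S <- Th) \sum_k \sum_i `|A S k i|.
have nn S k : 0 <= \sum_i `|A S k i| by apply: sumr_ge0.
have nn2 S : 0 <= \sum_k \sum_i `|A S k i| by apply: sumr_ge0.
have L0 : 0 <= L by apply: sumr_ge0.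
exists L => // x y i xyO.
apply: (@segment_growth (fun x => v x 0 i)) => //; first by rewrite mulr_ge0.
move=> S p q c STh Sp Sq pq.
rewrite (vA _ _ STh Sp) (vA _ _ STh Sq).
have -> : (p *m A S + b S) 0 i - (q *m A S + b S) 0 i = (c *: ((y - x) *m A S)) 0 i.
  by rewrite scalemxAl -pq mulmxBl !mxE; ring.
rewrite mxE normrM mulrC ler_wpM2r // mxE.
apply: (@le_trans _ _ ((\sum_k \sum_i `|A S k i|) * `|y - x|)).
  rewrite mulr_suml; apply: (le_trans (ler_norm_sum _ _ _)); apply: ler_sum => k _.
  rewrite normrM mulrC ler_pM //; last exact: normr_coord.
  by rewrite (bigD1 i) //= lerDl sumr_ge0.
rewrite ler_wpM2r // /L (big_rem S) //= lerDl; exact: sumr_ge0.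
Qed.

End Xh_function.
End piecewise_affine.

(** * Weak gradients of finite element functions *)

Lemma Rintegral_dominated disp (T : measurableType disp) (R : realType)
    (mu : {measure set T -> \bar R}) (A : set T) (F : nat -> T -> R) (f g : T -> R) :
  measurable A -> (forall n, measurable_fun A (F n)) -> measurable_fun A f ->
  (\forall x \ae mu, A x -> F n x @[n --> \oo] --> f x) ->
  mu.-integrable A (EFin \o g) -> (forall n x, A x -> `|F n x| <= g x) ->
  \int[mu]_(x in A) F n x @[n --> \oo] --> \int[mu]_(x in A) f x.
Proof.
move=> mA mF mf Ff ig Fg.
have [|||||fi _ cv] := @dominated_convergence _ _ _ mu A mA (fun n => EFin \o F n) (EFin \o f) (EFin \o g).
- by move=> n; exact/measurable_EFinP.
- exact/measurable_EFinP.
- by apply: filterS Ff => x h Ax; apply: cvg_EFin; [exact: nearW|exact: h].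
- exact: ig.
- by apply: aeW => x n Ax; rewrite lee_fin Fg.
move: cv; rewrite -(fineK (integrable_fin_num mA fi)); exact: fine_cvg.
Qed.

Lemma ae_mono disp (T : measurableType disp) (R : realType)
    (mu : {measure set T -> \bar R}) (P Q : T -> Prop) :
  (forall x, P x -> Q x) -> (\forall x \ae mu, P x) -> \forall x \ae mu, Q x.
Proof. by move=> PQ; apply: filterS. Qed.

Section difference_quotients.
Variables (R : realType) (d : nat).
Local Notation T := (caratheodory_type (@lebesgue_outer R d)).
Local Notation mu := (vol R d).

Lemma Rintegral_transl (h : 'rV[R]_d) (f : T -> R) :
  measurable_fun [set: T] f -> mu.-integrable [set: T] (EFin \o (f \o transl h)) ->
  \int[mu]_x f (transl h x) = \int[mu]_x f x.
Proof.
move=> mf intf; congr fine.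
have mh : measurable_fun [set: T] (transl h : T -> T).
  by move=> _ A mA; rewrite setTI; exact: transl_measurable.
rewrite -(@integral_pushforward _ _ _ _ R (transl h : T -> T) mh mu setT (EFin \o f)).
- by apply: eq_measure_integral => A mA _; exact: lebesgue_outer_shift.
- exact/measurable_EFinP.
- exact: intf.
- exact: measurableT.
Qed.

Lemma continuous_vol_measurable (p : 'rV[R]_d -> R) : continuous p ->
  measurable_fun [set: T] (p : T -> R).
Proof.
move=> cp; apply: (@continuous_caratheodory_measurable _ _ (@lebesgue_outer R d) setT setT) => //.
- exact: vol_halfspace.
- exact: continuous_subspaceT.
Qed.

Lemma integrable_bounded_support (A : set T) (f : T -> R) (M : R) : measurable A -> (mu A < +oo)%E ->
  measurable_fun [set: T] f -> (forall x, `|f x| <= M) -> (forall x, ~ A x -> f x = 0) ->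
  mu.-integrable [set: T] (EFin \o f).
Proof.
move=> mA Afin mf fM f0; have -> : EFin \o f = (EFin \o f) \_ A.
  by apply/funext => x; rewrite patchE; case: ifPn => // /negP xA; rewrite /= f0 // => /mem_set.
apply/(integrable_mkcond _ mA).1; apply: measurable_bounded_integrable => //.
  exact: measurable_funTS.
by exists M; split=> [|K MK x _ /=]; [exact: num_real|exact: le_trans (fM x) (ltW MK)].
Qed.

Lemma Rintegral_support (A : set T) (f : T -> R) : (forall x, ~ A x -> f x = 0) ->
  \int[mu]_(x in A) f x = \int[mu]_x f x.
Proof.
move=> f0; rewrite Rintegral_mkcond; apply: eq_Rintegral => x _.
by rewrite patchE; case: ifPn => // /negP xA; rewrite f0 // => /mem_set.
Qed.

Lemma is_derive_line (p : 'rV[R]_d -> R) (x e : 'rV[R]_d) (s : R) :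
  differentiable p (x + s *: e) ->
  is_derive s (1 : R) (fun s => p (x + s *: e)) ('D_e p (x + s *: e)).
Proof.
move=> dp.
have gE : (fun h => h^-1 *: (((fun s => p (x + s *: e)) \o shift s) (h *: (1 : R)) - p (x + s *: e))) =
    (fun h => h^-1 *: ((p \o shift (x + s *: e)) (h *: e) - p (x + s *: e))).
  apply/funext => h /=; rewrite [h *: 1]mulr1 scalerDl.
  by congr (_ *: (p _ - _)); rewrite addrCA.
split; rewrite /derivable /derive gE //.
exact: (@diff_derivable _ _ _ p _ e dp).
Qed.

Section test_function.
Variables (Omega : set 'rV[R]_d) (p : 'rV[R]_d -> R) (j : 'I_d).
Hypothesis p_test : test_function Omega p.
Let e : 'rV[R]_d := delta_mx 0 j.

(** The derivative is continuous and vanishes outside a compact set; the mean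
    value theorem does the rest. *)
Lemma test_function_lipschitz : exists2 L : R, 0 <= L &
  (forall x, `|'D_e p x| <= L) /\ forall x s, `|p (x + s *: e) - p x| <= L * `|s|.
Proof.
have [dp cp [K [cK KO pK]]] := p_test.
have clK : closed K by apply: compact_closed => //; exact: norm_hausdorff.
have D0 x : ~ K x -> 'D_e p x = 0.
  move=> nKx; rewrite -(derive_cst (0 : R) x e); apply: near_eq_derive.
  have : nbhs x (~` K) by apply: open_nbhs_nbhs; split=> //; exact: closed_openC.
  by apply: filterS => y; exact: pK.
have /compact_bounded[M [_ hM]] := continuous_compact (continuous_subspaceT (cp j)) cK.
have DM x : `|'D_e p x| <= `|M| + 1.
  have [Kx|nKx] := pselect (K x); last by rewrite D0 // normr0 addr_ge0.
  by apply: hM; [rewrite (le_lt_trans (ler_norm _)) // ltrDl|exists x].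
exists (`|M| + 1); first by rewrite addr_ge0.
split=> // x s.
wlog s0 : x s / 0 <= s => [h|].
  have [/h//|s0] := leP 0 s.
  have := h (x + s *: e) (- s); rewrite scaleNr addrK normrN distrC; apply.
  by rewrite oppr_ge0 ltW.
move: s0; rewrite le_eqVlt => /predU1P[<-|s0].
  by rewrite scale0r addr0 subrr !normr0 mulr0.
have [||c _] := @MVT R (fun s => p (x + s *: e)) (fun s => 'D_e p (x + s *: e)) 0 s s0.
- by move=> t _; exact: is_derive_line.
- apply: continuous_subspaceT => t; apply: differentiable_continuous.
  apply/derivable1_diffP; exact: (@ex_derive _ _ _ _ _ _ _ (is_derive_line (dp (x + t *: e)))).
rewrite scale0r addr0 subr0 => ->; rewrite normrM ler_wpM2r //; exact: DM.
Qed.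

Lemma test_function_bounded : exists M : R, forall x, `|p x| <= M.
Proof.
have [dp _ [K [cK _ pK]]] := p_test.
have cnt : continuous p by move=> x; exact: differentiable_continuous.
have /compact_bounded[B [_ hB]] := continuous_compact (continuous_subspaceT cnt) cK.
exists (`|B| + 1) => x.
have [Kx|nKx] := pselect (K x); last by rewrite pK // normr0 addr_ge0.
by apply: hB; [rewrite (le_lt_trans (ler_norm _)) // ltrDl|exists x].
Qed.

(** Difference quotients pass from the test function to U by a translation of
    the integration variable; both sides then converge boundedly. *)
Lemma integration_by_parts (K : set 'rV[R]_d) (U G : T -> R) (M L delta : R) :
  measurable (Omega : set T) -> (mu Omega < +oo)%E ->
  compact K -> K `<=` Omega -> (forall x, ~ K x -> p x = 0) ->
  measurable_fun [set: T] U -> measurable_fun (Omega : set T) G -> (forall x, `|U x| <= M) ->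
  (forall x, ~ Omega x -> U x = 0) -> 0 < delta ->
  (forall x (t : R), K x -> 0 < t <= delta -> `|U x - U (x - t *: e)| <= L * t) ->
  (\forall x \ae mu, Omega x -> (fun t => t^-1 * (U x - U (x - t *: e))) t @[t --> 0^'+] --> G x) ->
  \int[mu]_(x in Omega) (U x * 'D_e p x) = - \int[mu]_(x in Omega) (G x * p x).
Proof.
move=> mO Ofin cK KO pK mU mG UM U0 delta0 UL UG.
have [dp cp _] := p_test.
have [Lp Lp0 [DL pL]] := test_function_lipschitz.
have cnt : continuous p by move=> x; exact: differentiable_continuous.
have mp := continuous_vol_measurable cnt.
have M0 : 0 <= M by exact: le_trans (UM 0).
have [Mp pM] := test_function_bounded.
have Mp0 : 0 <= Mp by exact: le_trans (pM 0).
pose t n : R := delta * n.+1%:R^-1.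
have t0 n : 0 < t n by rewrite mulr_gt0 // invr_gt0.
have td n : t n <= delta by rewrite ler_piMr ?(ltW delta0) // invf_le1 // ler1n.
have tcvg : t n @[n --> \oo] --> 0^'+.
  have tc : t n @[n --> \oo] --> 0.
    by rewrite -(mulr0 delta); apply: cvgM; [exact: cvg_cst|exact: cvg_harmonic].
  move=> A /= [r r0 rA]; have /cvgr0Pnorm_lt /(_ r r0) := tc.
  apply: filterS => n; rewrite /= => h; apply: rA => //=.
  by rewrite sub0r normrN.
have mtr (h : 'rV[R]_d) : measurable_fun [set: T] (transl h : T -> T).
  by move=> _ A mA; rewrite setTI; exact: transl_measurable.
pose F n x := U x * ((t n)^-1 * (p (x + t n *: e) - p x)).
pose H n x := ((t n)^-1 * (U x - U (x - t n *: e))) * p x.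
have mpt n : measurable_fun [set: T] (fun x : T => p (x + t n *: e)).
  exact: (measurableT_comp mp (mtr (t n *: e))).
have mUt n : measurable_fun [set: T] (fun x : T => U (x - t n *: e)).
  exact: (measurableT_comp mU (mtr (- (t n *: e)))).
have mF n : measurable_fun [set: T] (F n).
  exact: (measurable_funM mU (measurable_funM (measurable_cst _) (measurable_funB (mpt n) mp))).
have mH n : measurable_fun [set: T] (H n).
  exact: (measurable_funM (measurable_funM (measurable_cst _) (measurable_funB mU (mUt n))) mp).
have FH n : \int[mu]_(x in Omega) F n x = - \int[mu]_(x in Omega) H n x.
  rewrite !Rintegral_support; last 2 first.
    - by move=> x nO; rewrite /H pK ?mulr0 // => /KO.
    - by move=> x nO; rewrite /F U0 // mul0r.
  pose A x := U (x - t n *: e) * p x; pose B x := U x * p x.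
  have mA : measurable_fun [set: T] A by exact: measurable_funM (mUt n) mp.
  have mB : measurable_fun [set: T] B by exact: measurable_funM mU mp.
  have iA : mu.-integrable [set: T] (EFin \o A).
    apply: (integrable_bounded_support (M := M * Mp) mO Ofin mA).
      by move=> x; rewrite normrM ler_pM.
    by move=> x nO; rewrite /A pK ?mulr0 // => /KO.
  have iB : mu.-integrable [set: T] (EFin \o B).
    apply: (integrable_bounded_support (M := M * Mp) mO Ofin mB).
      by move=> x; rewrite normrM ler_pM.
    by move=> x nO; rewrite /B U0 // mul0r.
  have AE x : A (transl (t n *: e) x) = U x * p (x + t n *: e).
    by rewrite /A /transl addrK.
  have mAt : measurable_fun [set: T] (A \o transl (t n *: e)).
    exact: (measurableT_comp mA (mtr _)).
  have iAt : mu.-integrable [set: T] (EFin \o (A \o transl (t n *: e))).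
    apply: (integrable_bounded_support (M := M * Mp) mO Ofin mAt).
      by move=> x; rewrite /= AE normrM ler_pM.
    by move=> x nO; rewrite /= AE U0 // mul0r.
  have := Rintegral_transl mA iAt => EA.
  rewrite (@eq_Rintegral _ _ _ mu setT (fun x => (t n)^-1 * ((A \o transl (t n *: e)) x - B x))); last first.
    by move=> x _; rewrite /= AE /F /B; ring.
  rewrite [in RHS](@eq_Rintegral _ _ _ mu setT (fun x => (t n)^-1 * (B x - A x))); last first.
    by move=> x _; rewrite /H /A /B; ring.
  rewrite !RintegralZl //; last 2 first.
    - by have := integrableB measurableT iB iA.
    - by have := integrableB measurableT iAt iB.
  rewrite !RintegralB // EA; ring.
have cstO (c : R) : mu.-integrable (Omega : set T) (EFin \o cst c).
  apply: (measurable_bounded_integrable mO Ofin (measurable_cst c)).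
  by exists `|c|; split=> [|k ck x _ /=]; [exact: num_real|exact: ltW].
have cF : \int[mu]_(x in Omega) F n x @[n --> \oo] --> \int[mu]_(x in Omega) (U x * 'D_e p x).
  apply: (Rintegral_dominated mO _ _ _ (cstO (M * Lp))).
  - by move=> n; exact: (measurable_funTS (mF n)).
  - apply: measurable_funTS.
    exact: measurable_funM mU (continuous_vol_measurable (cp j)).
  - apply: aeW => x _; apply: cvgM; first exact: cvg_cst.
    have tcvg' : t n @[n --> \oo] --> 0^'.
      move=> A [r r0 rA]; apply: tcvg; exists r => // y yr /= y0.
      by apply: rA => //; rewrite /= gt_eqF.
    have dx : (fun h => h^-1 *: ((p \o shift x) (h *: e) - p x)) @ 0^' --> 'D_e p x.
      exact: (@diff_derivable _ _ _ p x e (dp x)).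
    have := cvg_comp _ _ tcvg' dx; apply: cvg_trans; apply: near_eq_cvg.
    by apply: nearW => n /=; rewrite [x + _]addrC.
  - move=> n x _; rewrite /cst /F normrM ler_pM // normrM normfV (gtr0_norm (t0 n)).
    by rewrite ler_pdivrMl // mulrC -[in leRHS](gtr0_norm (t0 n)).
have cH : \int[mu]_(x in Omega) H n x @[n --> \oo] --> \int[mu]_(x in Omega) (G x * p x).
  apply: (Rintegral_dominated mO _ _ _ (cstO (`|L| * Mp))).
  - by move=> n; exact: (measurable_funTS (mH n)).
  - exact: measurable_funM mG (measurable_funTS mp).
  - apply: ae_mono UG => x UG Ox; apply: cvgM; last exact: cvg_cst.
    exact: (cvg_comp _ _ tcvg (UG Ox)).
  - move=> n x _; have [Kx|nKx] := pselect (K x); last first.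
      by rewrite /H pK // mulr0 normr0 mulr_ge0.
    rewrite /cst /H normrM ler_pM // normrM normfV (gtr0_norm (t0 n)).
    rewrite ler_pdivrMl // mulrC; apply: (le_trans (UL _ _ Kx _)).
      by rewrite t0 td.
    by rewrite ler_wpM2r ?ler_norm // ltW.
have cF' : \int[mu]_(x in Omega) F n x @[n --> \oo] --> - \int[mu]_(x in Omega) (G x * p x).
  by under eq_cvg do rewrite FH; exact: cvgN.
apply: (cvg_unique _ cF cF'); exact: norm_hausdorff.
Qed.

End test_function.
End difference_quotients.

Lemma compact_uniform_ball (R : realType) (V : normedModType R) (K O : set V) :
  compact K -> open O -> K `<=` O ->
  exists2 r : R, 0 < r & forall x y, K x -> `|x - y| < r -> O y.
Proof.
move=> /compact_near_coveringP cK oO KO.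
have : \forall r \near 0^'+, K `<=` [set x | forall y : V, `|x - y| < r -> O y].
  apply: cK => x Kx.
  have /nbhs_ballP[e /= e0 eO] : nbhs x O by apply: open_nbhs_nbhs; split=> //; exact: KO.
  exists (ball x (e / 2), [set r : R | 0 < r < e / 2]).
    split; first by apply: nbhsx_ballx; rewrite divr_gt0.
    have e2 : 0 < e / 2 by rewrite divr_gt0.
    near=> r; rewrite /mkset; apply/andP; split; first by near: r; exact: nbhs_right_gt.
    by near: r; exact: nbhs_right_lt.
  move=> [z r] [/= xz /andP[r0 re] y zy]; apply: eO; rewrite -ball_normE /=.
  move: xz; rewrite -ball_normE /= => xz.
  rewrite (splitr e) (_ : x - y = (x - z) + (z - y)).
    by rewrite (le_lt_trans (ler_normD _ _)) // ltrD // (lt_trans zy).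
  by rewrite addrA subrK.
move=> h; have [r [r0 hr]] : exists r : R, 0 < r /\ (K `<=` [set x | forall y : V, `|x - y| < r -> O y]).
  apply: (@filter_ex _ (0^'+)); near=> r; split; [near: r; exact: nbhs_right_gt|near: r; exact: h].
by exists r => // x y Kx; exact: hr.
Unshelve. all: by end_near. Qed.

Section Xh_gradient.
Variables (R : realType) (d : nat) (Omega : set 'rV[R]_d).
Variable Th : seq 'M[R]_(d.+1, d).
Hypothesis Omega_bounded : bounded_set Omega.
Hypothesis ThP : triangulation Omega Th.
Local Notation T := (caratheodory_type (@lebesgue_outer R d)).
Local Notation mu := (vol R d).

Lemma piecewise_entry (r : seq 'M[R]_(d.+1, d)) m n (A : 'M[R]_(d.+1, d) -> 'M[R]_(m, n)) x i j :
  piecewise r A x i j = piecewise r (fun K => A K i j) x.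
Proof. by elim: r => [|K r IH] /=; [rewrite mxE|case: asboolP]. Qed.

Lemma Omega_measurable : measurable (Omega : set T).
Proof. exact/open_vol_measurable/(open_triangulated ThP). Qed.

Lemma L2_piecewise m n (A : 'M[R]_(d.+1, d) -> 'M[R]_(m, n)) :
  L2 mu Omega (piecewise Th A).
Proof.
have mP i j : measurable_fun (Omega : set T) (fun x : T => piecewise Th A x i j).
  rewrite (_ : (fun x => _) = piecewise Th (fun K => A K i j)).
    exact: (measurable_piecewise ThP _ (fun S STh => STh) Omega_measurable).
  by apply/funext => x; exact: piecewise_entry.
have nn i j : 0 <= \sum_(S <- Th) `|A S i j| by exact: sumr_ge0.
have nn2 i : 0 <= \sum_j \sum_(S <- Th) `|A S i j| by exact: sumr_ge0.
apply: (L2_bounded (M := \sum_i \sum_j \sum_(S <- Th) `|A S i j|) Omega_measurable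
  (vol_bounded_fin Omega_bounded) mP).
move=> x i j _; rewrite (bigD1 i) //= (bigD1 j) //= -addrA piecewise_entry.
apply: (@le_trans _ _ (\sum_(S <- Th) `|A S i j|)); last first.
  by rewrite lerDl addr_ge0 ?sumr_ge0.
elim: Th => [|K r IH] /=; first by rewrite normr0 big_nil.
rewrite big_cons; case: asboolP => _; first by rewrite lerDl sumr_ge0.
by apply: (le_trans IH); rewrite lerDr.
Qed.

Section one_function.
Variables (v : 'rV[R]_d -> 'rV[R]_d) (A : 'M[R]_(d.+1, d) -> 'M[R]_d) (b : 'M[R]_(d.+1, d) -> 'rV[R]_d).
Hypothesis vXh : Xh Omega Th v.
Hypothesis vA : forall S x, S \in Th -> simplex S x -> v x = x *m A S + b S.

Lemma Xh_measurable i : measurable_fun (Omega : set T) (fun x : T => v x 0 i).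
Proof.
apply: (@continuous_caratheodory_measurable _ _ (@lebesgue_outer R d) Omega (closure Omega)).
- exact: vol_halfspace.
- exact: subset_closure.
- exact: Xh_within_continuous vXh i.
- exact: Omega_measurable.
Qed.

Lemma Xh_L2 : L2 mu Omega v.
Proof.
have [M M0 vM] := Xh_bounded Omega_bounded vXh.
apply: (L2_bounded (M := M) Omega_measurable (vol_bounded_fin Omega_bounded)).
  by move=> i j; rewrite (ord1 i); exact: Xh_measurable.
by move=> x i j Ox; rewrite (ord1 i); apply: vM; exact: subset_closure.
Qed.

(** Off the skeleton the difference quotients are eventually equal to the slope
    of one affine piece. *)
Lemma Xh_weak_gradient : weak_gradient Omega v (piecewise Th (fun S => (A S)^T)).
Proof.
split=> [|p p_test i j]; first exact: L2_piecewise.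
have [_ _ [K [cK KO pK]]] := p_test.
have [r r0 rO] := compact_uniform_ball cK (open_triangulated ThP) KO.
have [M M0 vM] := Xh_bounded Omega_bounded vXh.
have [L L0 vL] := Xh_lipschitz ThP vXh.
pose U (x : T) := if `[< Omega x >] then v x 0 i else 0.
have UE x : Omega x -> U x = v x 0 i by move=> Ox; rewrite /U asboolT.
have mU : measurable_fun [set: T] U.
  rewrite (_ : U = (fun x => v x 0 i) \_ Omega).
    apply/(measurable_restrict _ Omega_measurable measurableT).
    by rewrite setTI; exact: Xh_measurable.
  apply/funext => x; rewrite patchE /U.
  by case: asboolP => Ox; [rewrite mem_set|rewrite memNset].
have UM x : `|U x| <= M.
  rewrite /U; case: asboolP => [Ox|_]; last by rewrite normr0.
  by apply: vM; exact: subset_closure.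
rewrite (@eq_Rintegral _ _ _ mu Omega (fun x => U x * 'D_(delta_mx 0 j) p x)); last first.
  by move=> x /set_mem Ox; rewrite UE.
have e1 : `|delta_mx 0 j : 'rV[R]_d| <= 1.
  rewrite [leLHS]/Num.norm /= mx_normrE; apply/bigmax_leP; split=> // k _.
  by rewrite mxE; case: (_ && _); rewrite ?normr1 ?normr0.
have inO x t : K x -> 0 <= t <= r / 2 -> Omega (x - t *: delta_mx 0 j).
  move=> Kx /andP[t0 tr]; apply: (rO x) => //.
  rewrite opprB addrC subrK normrZ ger0_norm //.
  apply: (@le_lt_trans _ _ (r / 2)); last by lra.
  by apply: le_trans tr; rewrite ler_piMr.
apply: (integration_by_parts p_test (K := K) (M := M) (L := L) (delta := r / 2)
  Omega_measurable (vol_bounded_fin Omega_bounded) cK KO pK mU _ UM _ _ _ _).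
- by case: (L2_piecewise (fun S => (A S)^T)).
- by move=> x nO; rewrite /U asboolF.
- by rewrite divr_gt0.
- move=> x t Kx /andP[t0 tr].
  have Oxt : Omega (x - t *: delta_mx 0 j) by apply: inO; rewrite ?(ltW t0).
  rewrite !UE //; last exact: KO.
  apply: (le_trans (vL _ _ i _)).
    move=> s /andP[s0 s1]; apply: subset_closure.
    rewrite (_ : x - t *: delta_mx 0 j + s *: _ = x - ((1 - s) * t) *: delta_mx 0 j).
      apply: inO => //; apply/andP; split; first by rewrite mulr_ge0 ?subr_ge0 ?(ltW t0).
      by apply: le_trans tr; rewrite ler_piMl ?(ltW t0) // lerBlDr lerDl.
    rewrite subKr scalerA -addrA -scaleNr -scalerDl -scaleNr.
    by congr (_ + _ *: _); ring.
  rewrite ler_wpM2l // subKr normrZ gtr0_norm //.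
  by rewrite ler_piMr // ltW.
apply: (skeleton_ae Omega_bounded ThP) => x Ox nx.
have [S [STh Sx pwE]] := @piecewiseP R d _ Th (fun K => (A K)^T i j) x (ltac:(
  by have := subset_closure Ox; rewrite (closure_triangulated ThP) => -[S STh Sx]; exists S)).
rewrite piecewise_entry pwE mxE.
apply: cvg_near_cst.
have cx : x - t *: delta_mx 0 j @[t --> 0^'+] --> x.
  apply: cvg_at_right_filter; rewrite -[X in _ --> X]subr0 -(scale0r (delta_mx 0 j)).
  by apply: cvgB; [exact: cvg_cst|apply: cvgZr_tmp; exact: cvg_id].
have nS := cx _ (off_skeleton_interior STh Sx nx).
have nO := cx _ (open_nbhs_nbhs (conj (open_triangulated ThP) Ox)).
near=> t.
have t0 : 0 < t by near: t; exact: nbhs_right_gt.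
have St : simplex S (x - t *: delta_mx 0 j) by near: t; exact: nS.
have Ot : Omega (x - t *: delta_mx 0 j) by near: t; exact: nO.
rewrite !UE // (vA STh Sx) (vA STh St) mulmxBl -scalemxAl -rowE !mxE.
by field; rewrite gt_eqF.
Unshelve. all: by end_near. Qed.

End one_function.
End Xh_gradient.

(** * Uniqueness of weak gradients *)

Lemma ae_forall disp (T : measurableType disp) (R : realType)
    (mu : {measure set T -> \bar R}) (I : finType) (P : I -> T -> Prop) :
  (forall i, \forall x \ae mu, P i x) -> \forall x \ae mu, forall i, P i x.
Proof. by move=> h; apply: filter_forall. Qed.

Lemma ae_and disp (T : measurableType disp) (R : realType)
    (mu : {measure set T -> \bar R}) (P Q : T -> Prop) :
  (\forall x \ae mu, P x) -> (\forall x \ae mu, Q x) -> \forall x \ae mu, P x /\ Q x.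
Proof. by move=> hP hQ; apply: filterS2 hP hQ. Qed.

Lemma L2_tr disp (T : measurableType disp) (R : realType)
    (mu : {measure set T -> \bar R}) (A : set T) m n (F : T -> 'M[R]_(m, n)) :
  measurable A -> L2 mu A F -> L2 mu A (fun x => (F x)^T).
Proof.
by move=> mA /(L2P _ mA) sF; apply/(L2P _ mA) => i j; under eq_fun do rewrite mxE.
Qed.

Section weak_gradient.
Variables (R : realType) (d : nat) (Omega : set 'rV[R]_d).
Hypothesis Omega_open : open Omega.
Hypothesis Omega_bounded : bounded_set Omega.
Local Notation T := (caratheodory_type (@lebesgue_outer R d)).
Local Notation mu := (vol R d).

Let mO : measurable (Omega : set T). Proof. exact: open_vol_measurable. Qed.
Let Ofin : (mu Omega < +oo)%E. Proof. exact: vol_bounded_fin. Qed.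

Lemma weak_gradient_unique v G G' : weak_gradient Omega v G -> weak_gradient Omega v G' ->
  \forall x \ae mu, Omega x -> G x = G' x.
Proof.
move=> [LG vG] [LG' vG'].
suff h i : \forall x \ae mu, forall j, Omega x -> G x i j = G' x i j.
  by apply: ae_mono (ae_forall h) => x GG' Ox; apply/matrixP => i j; exact: GG'.
apply: ae_forall => j.
have sG := (L2P _ mO _).1 LG i j; have sG' := (L2P _ mO _).1 LG' i j.
have s1 : sqint mu (Omega : set T) (fun=> 1).
  by apply: (sqint_bounded mO Ofin (measurable_cst _)) => x _; rewrite normr1.
have iG : mu.-integrable (Omega : set T) (EFin \o (fun x => G x i j - G' x i j)).
  have := integrableB mO (sqint_prod mO sG s1) (sqint_prod mO sG' s1).
  by apply: eq_integrable => // x _; rewrite /= !mulr1.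
have := fundamental_lemma Omega_open Omega_bounded iG.
suff h : forall p, test_function Omega p -> \int[mu]_(x in Omega) ((G x i j - G' x i j) * p x) = 0.
  move=> /(_ h); apply: ae_mono => x h' Ox.
  by apply/eqP; rewrite -subr_eq0; apply/eqP; exact: h'.
move=> p tp; have [dp _ _] := tp.
have cnt : continuous p by move=> x; exact: differentiable_continuous.
have [M pM] := test_function_bounded tp.
have sp : sqint mu (Omega : set T) p.
  exact: (sqint_bounded mO Ofin (measurable_funTS (continuous_vol_measurable cnt)) (fun x _ => pM x)).
rewrite (@eq_Rintegral _ _ _ mu Omega (fun x => G x i j * p x - G' x i j * p x)); last first.
  by move=> x _; rewrite mulrBl.
rewrite (RintegralB mO (sqint_prod mO sG sp) (sqint_prod mO sG' sp)).
by apply/eqP; rewrite subr_eq0 -eqr_opp -vG // -vG'.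
Qed.

Lemma gradP v G : weak_gradient Omega v G -> weak_gradient Omega v (grad Omega v).
Proof. by move=> vG; apply: (@xgetPex _ _ (weak_gradient Omega v)); exists G. Qed.

Lemma strain_L2 v G : weak_gradient Omega v G -> L2 mu Omega (strain Omega v).
Proof.
by move=> /gradP[Lg _]; exact: (L2Z mO _ (L2D mO Lg (L2_tr mO Lg))).
Qed.

Lemma strain_sym v x : (strain Omega v x)^T = strain Omega v x.
Proof. by rewrite /strain linearZ linearD /= trmxK addrC. Qed.

End weak_gradient.

Section Xh_strain.
Variables (R : realType) (d : nat) (Omega : set 'rV[R]_d).
Variable Th : seq 'M[R]_(d.+1, d).
Hypothesis Omega_bounded : bounded_set Omega.
Hypothesis ThP : triangulation Omega Th.
Local Notation T := (caratheodory_type (@lebesgue_outer R d)).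
Local Notation mu := (vol R d).

Lemma affine_unique (A A' : 'M[R]_d) (b b' x : 'rV[R]_d) :
  (\forall y \near x, y *m A + b = y *m A' + b') -> A = A' /\ b = b'.
Proof.
move=> h; have hx := nbhs_singleton h.
have AA : A = A'.
  apply/row_matrixP => i.
  have c0 : x + t *: delta_mx 0 i @[t --> 0^'+] --> x.
    apply: cvg_at_right_filter; rewrite -[X in _ --> X]addr0 -(scale0r (delta_mx 0 i)).
    by apply: cvgD; [exact: cvg_cst|apply: cvgZr_tmp; exact: cvg_id].
  have n0 := c0 _ h.
  have [t [t0 ht]] : exists t : R, 0 < t /\ (x + t *: delta_mx 0 i) *m A + b = (x + t *: delta_mx 0 i) *m A' + b'.
    apply: (@filter_ex _ (0^'+)); near=> t; split; [near: t; exact: nbhs_right_gt|near: t; exact: n0].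
  move: ht; rewrite !mulmxDl -!scalemxAl -!rowE ![_ + t *: _]addrC -!addrA hx.
  by move=> /addIr /(scalerI (lt0r_neq0 t0)).
by split=> //; move: hx; rewrite AA => /addrI.
Unshelve. all: by end_near. Qed.

Section one_function.
Variable v : 'rV[R]_d -> 'rV[R]_d.
Hypothesis vXh : Xh Omega Th v.

Lemma Xh_H1 : H1 Omega v.
Proof.
have [A [b vA]] := Xh_affine vXh.
split; first exact: (Xh_L2 Omega_bounded ThP vXh).
by exists (piecewise Th (fun S => (A S)^T)); exact: (Xh_weak_gradient Omega_bounded ThP vXh vA).
Qed.

Lemma Xh_strain_L2 : L2 mu Omega (strain Omega v).
Proof.
have [_ [G vG]] := Xh_H1.
have oO := open_triangulated ThP.
exact (strain_L2 oO vG).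
Qed.

(** Affine representations of v on two simplices with a common interior point
    have the same slope, so any of them gives the strain. *)
Lemma Xh_strain : \forall x \ae mu, Omega x ->
  forall S, S \in Th -> simplex S x -> forall (A : 'M[R]_d) b,
    (forall y, simplex S y -> v y = y *m A + b) ->
    strain Omega v x = 2^-1 *: (A + A^T).
Proof.
have [A [b vA]] := Xh_affine vXh.
have vG := Xh_weak_gradient Omega_bounded ThP vXh vA.
have h := weak_gradient_unique (open_triangulated ThP) Omega_bounded (gradP vG) vG.
have h' := @skeleton_ae _ _ _ _ Omega_bounded ThP (fun x => ~ skeleton Th x) (fun x _ => id).
apply: ae_mono (ae_and h h') => x [gx nx] Ox S STh Sx A' b' vA'.
have {}nx := nx Ox.
have [K [KTh Kx pwE]] := @piecewiseP R d _ Th (fun K => (A K)^T) x (ex_intro2 _ _ S STh Sx).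
suff [AA _] : A K = A' /\ b K = b' by rewrite /strain gx // pwE AA trmxK addrC.
apply: (@affine_unique _ _ _ _ x).
have nS := off_skeleton_interior STh Sx nx.
have nK := off_skeleton_interior KTh Kx nx.
near=> y.
have Sy : simplex S y by near: y.
have Ky : simplex K y by near: y.
by rewrite -(vA _ _ KTh Ky) -(vA' _ Sy).
Unshelve. all: by end_near. Qed.

End one_function.
End Xh_strain.

(** * Traces of continuous functions *)

Lemma open_eball (R : realType) d (x : 'rV[R]_d) r : open (eball x r).
Proof.
suff ce : continuous (fun y : 'rV[R]_d => enorm (y - x)).
  rewrite (_ : eball x r = (fun y => enorm (y - x)) @^-1` [set s | s < r]) //.
  by apply: open_comp; [move=> y _; exact: ce|exact: open_lt].
move=> y; apply: (@continuous_comp 'rV[R]_d R R (fun y => mdot (y - x) (y - x)) (@Num.sqrt R)).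
  rewrite /mdot; apply: continuous_sum => i; apply: continuous_sum => j.
  have cj : continuous (fun z : 'rV[R]_d => (z - x) i j).
    under eq_fun do rewrite !mxE.
    move=> z; apply: (@continuousB _ _ _ (fun z : 'rV[R]_d => z i j) (fun=> x i j)).
      exact: coord_continuous.
    exact: cst_continuous.
  by move=> z; apply: (@continuousM _ _ (fun z : 'rV[R]_d => (z - x) i j)); exact: cj.
exact: sqrt_continuous.
Qed.

(** The means are taken over sets of positive and finite volume on which v is
    close to v x. *)
Lemma trace_continuous (R : realType) d (Omega : set 'rV[R]_d) (v : 'rV[R]_d -> 'rV[R]_d) x :
  open Omega -> bounded_set Omega -> {within closure Omega, continuous v} ->
  closure Omega x -> trace Omega v x = v x.
Proof.
move=> oO bO cv clx; apply/rowP => i; rewrite mxE; apply: cvg_lim => //.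
apply/cvgrPdist_le => e e0.
have cvx : v y @[y --> within (closure Omega) (nbhs x)] --> v x.
  by move/subspace_continuousP: cv => /(_ x clx).
have /cvgrPdist_le/(_ e e0) := cvx; rewrite /within /=.
move=> /nbhs_ballP[r0 /= r00 hr]; near=> r.
have r_gt0 : 0 < r by near: r; exact: nbhs_right_gt.
have rr0 : r < r0 by near: r; exact: nbhs_right_lt.
pose D := Omega `&` eball x r.
have oD : open D by apply: openI => //; exact: open_eball.
have D0 : D !=set0.
  apply: (clx (eball x r)); apply: open_nbhs_nbhs; split; first exact: open_eball.
  by rewrite /eball /mkset subrr /enorm /mdot big1 ?sqrtr0 // => k _; rewrite big1 // => l _; rewrite mxE mul0r.
have mD : measurable (D : set (caratheodory_type (@lebesgue_outer R d))) by exact: open_vol_measurable.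
have Dfin : (vol R d D < +oo)%E.
  apply: le_lt_trans (vol_bounded_fin bO).
  by apply: (le_outer_measure (@lebesgue_outer R d)) => y [].
have Dpos : (0 < vol R d D)%E by exact: vol_open_gt0.
have m0 : 0 < fine (vol R d D) by rewrite fine_gt0 // Dpos.
have vclose y : D y -> `|v x 0 i - v y 0 i| <= e.
  move=> [Oy xy]; rewrite (_ : _ - _ = (v x - v y) 0 i); last by rewrite !mxE.
  apply: (le_trans (normr_coord _ _ _)); apply: hr; last exact: subset_closure.
  rewrite -ball_normE /= distrC (le_lt_trans _ rr0) //.
  rewrite [leLHS]/Num.norm /= mx_normrE; apply/bigmax_leP; split; first exact: ltW.
  by move=> [k l] _; apply: le_trans (coord_le_enorm _ k l) (ltW xy).
have mv : measurable_fun (D : set (caratheodory_type (@lebesgue_outer R d)))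
    (fun y : caratheodory_type (@lebesgue_outer R d) => v y 0 i).
  apply: (@continuous_caratheodory_measurable _ _ (@lebesgue_outer R d) D (closure Omega)) => //.
  - exact: vol_halfspace.
  - by move=> y [Oy _]; exact: subset_closure.
  - apply/subspace_continuousP => y Oy; move/subspace_continuousP/(_ y Oy): cv => cvy.
    exact: (cvg_comp v (fun z : 'rV[R]_d => z 0 i) cvy (@coord_continuous R 1 d 0 i (v y))).
have bnd c : (vol R d).-integrable (D : set (caratheodory_type (@lebesgue_outer R d))) (EFin \o cst c).
  apply: (measurable_bounded_integrable mD Dfin (measurable_cst c)).
  by exists `|c|; split=> [|k ck y _ /=]; [exact: num_real|exact: ltW].
have iv : (vol R d).-integrable (D : set (caratheodory_type (@lebesgue_outer R d))) (EFin \o (fun y => v y 0 i)).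
  apply: (measurable_bounded_integrable mD Dfin mv).
  exists (`|v x 0 i| + e); split=> [|k ck y Dy /=]; first exact: num_real.
  apply: le_trans (ltW ck); rewrite -[v y 0 i](subKr (v x 0 i)).
  by rewrite (le_trans (ler_normB _ _)) // lerD2l vclose.
have -> : v x 0 i - mean D (fun y => v y 0 i) =
    (\int[vol R d]_(y in D) (v x 0 i - v y 0 i)) / fine (vol R d D).
  rewrite (RintegralB mD (bnd _) iv) Rintegral_cst // /mean mulrBl mulfK ?gt_eqF //.
rewrite normrM normfV (gtr0_norm m0) ler_pdivrMr //.
have iB := integrableB mD (bnd (v x 0 i)) iv.
apply: (le_trans (le_normr_Rintegral mD iB)).
rewrite -(Rintegral_cst (vol R d) mD e).
apply: (le_Rintegral mD _ (bnd e)) => [|y Dy]; last exact: vclose.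
by have := integrable_norm iB.
Unshelve. all: by end_near. Qed.

(** * Rigid displacements *)

Lemma mdot_row (R : realType) d (x y : 'rV[R]_d) : mdot x y = (x *m y^T) 0 0.
Proof. by rewrite /mdot big_ord1 mxE; apply: eq_bigr => j _; rewrite mxE. Qed.

Lemma mdotBl (R : realType) m n (A B D : 'M[R]_(m, n)) :
  mdot (A - B) D = mdot A D - mdot B D.
Proof. by rewrite mdotDl -[- B]scaleN1r mdotZl mulN1r. Qed.

Lemma mdotBr (R : realType) m n (A B D : 'M[R]_(m, n)) :
  mdot D (A - B) = mdot D A - mdot D B.
Proof. by rewrite mdotC mdotBl !(mdotC D). Qed.

Lemma mdot_skew (R : realType) d (A : 'M[R]_d) (x : 'rV[R]_d) :
  A + A^T = 0 -> mdot (x *m A) x = 0.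
Proof.
move=> AA; have h : mdot (x *m A) x = - mdot (x *m A) x.
  rewrite {1}mdotC [in RHS]mdot_row !mdot_row trmx_mul mulmxA.
  have -> : A^T = - A by apply/eqP; rewrite -addr_eq0 addrC AA.
  by rewrite mulmxN mulNmx mxE.
lra.
Qed.

(** A map whose increments are orthogonal to the displacement is determined by
    its values at a basis, since the orthogonality polarizes to
    (w y - w x).k = - (w (x + k) - w x).(y - x). *)
Lemma orthogonal_increments_affine (R : realType) d (w : 'rV[R]_d -> 'rV[R]_d)
    (x : 'rV[R]_d) (r : R) : 0 < r ->
  (forall y z, `|y - x| < r -> `|z - x| < r -> mdot (w y - w z) (y - z) = 0) ->
  exists M c, M + M^T = 0 /\ forall y, `|y - x| < r -> w y = y *m M + c.
Proof.
move=> r0 wO; pose s := r / 2; have s0 : 0 < s by rewrite divr_gt0.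
pose e j : 'rV[R]_d := delta_mx 0 j.
have eB j : `|x + s *: e j - x| < r.
  rewrite addrC addKr normrZ gtr0_norm //.
  have e1 : `|e j| <= 1.
    rewrite [leLHS]/Num.norm /= mx_normrE; apply/bigmax_leP; split=> // k _.
    by rewrite mxE; case: (_ && _); rewrite ?normr1 ?normr0.
  by apply: (@le_lt_trans _ _ s); [rewrite ler_piMr // ltW|rewrite /s; lra].
have xB : `|x - x| < r by rewrite subrr normr0.
have polar y k : `|y - x| < r -> `|x + k - x| < r ->
    mdot (w y - w x) k = - mdot (w (x + k) - w x) (y - x).
  move=> yB kB; have h1 := wO _ _ yB xB; have h2 := wO _ _ kB xB; have h3 := wO _ _ yB kB.
  move: h1 h2 h3; set p := w y - w x; set q := w (x + k) - w x; set h := y - x => h1 h2.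
  have -> : w y - w (x + k) = p - q by rewrite /p /q opprB addrA subrK.
  have -> : y - (x + k) = h - k by rewrite opprD addrA.
  rewrite (_ : x + k - x = k) in h2; last by rewrite addrC addKr.
  by clearbody p q h; rewrite mdotBl !mdotBr h1 h2; lra.
pose M : 'M[R]_d := \matrix_(i, j) (- (w (x + s *: e j) - w x) 0 i / s).
have wE y : `|y - x| < r -> w y - w x = (y - x) *m M.
  move=> yB; apply/rowP => j; have := polar _ _ yB (eB j).
  rewrite mdotC mdotZl.
  have -> : mdot (e j) (w y - w x) = (w y - w x) 0 j by rewrite mdot_row -rowE !mxE.
  move=> h; rewrite -[LHS](mulKf (lt0r_neq0 s0)) h mxE mdotC mulrN -mulNr.
  rewrite /mdot big_ord1 mulr_sumr; apply: eq_bigr => i _; rewrite [M i j]mxE; ring.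
exists M, (w x - x *m M); split; last first.
  by move=> y yB; rewrite addrCA -mulmxBl -wE // addrC subrK.
apply/eqP; rewrite addr_eq0; apply/eqP/matrixP => i j; rewrite [RHS]mxE [M^T i j]mxE.
have := wE _ (eB j); rewrite [x + _]addrC addrK -[s *: e j + x]addrC => h.
rewrite {1}/M mxE h -scalemxAl -rowE !mxE.
by field; rewrite gt_eqF.
Qed.

Section rigidity.
Variables (R : realType) (d : nat) (Omega : set 'rV[R]_d).
Variable Th : seq 'M[R]_(d.+1, d).
Hypothesis Omega_bounded : bounded_set Omega.
Hypothesis Omega_connected : connected Omega.
Hypothesis ThP : triangulation Omega Th.
Local Notation mu := (vol R d).

Section one_function.
Variable w : 'rV[R]_d -> 'rV[R]_d.
Hypothesis wXh : Xh Omega Th w.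
Hypothesis w_strain : \forall x \ae mu, Omega x -> strain Omega w x = 0.

(** The interior of S has positive volume, hence contains a point where the
    strain is both zero and given by the slope. *)
Lemma Xh_skew S A b : S \in Th -> (forall y, simplex S y -> w y = y *m A + b) ->
  A + A^T = 0.
Proof.
move=> STh wA; apply: contrapT => AA.
have [nd _ _] := ThP.
have : (vol R d).-negligible (simplex S)°.
  have := ae_and (Xh_strain Omega_bounded ThP wXh) w_strain.
  apply: negligibleS => x /= Sx [h h0].
  have Ox := interior_simplex_sub ThP STh Sx.
  have := h Ox S STh (interior_subset Sx) A b wA.
  rewrite h0 // => /esym/eqP; rewrite scaler_eq0 invr_eq0 pnatr_eq0 /=.
  by move/eqP.
move/vol_negligible => S0.
have := vol_open_gt0 (@open_interior _ (simplex S)) (simplex_interior_nonempty (nd _ STh)).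
by rewrite /vol /= S0 ltxx.
Qed.

(** On each simplex the slope is skew-symmetric, so the component of w along a
    segment is constant on every piece of the segment. *)
Lemma Xh_orthogonal_increments x y :
  (forall t, 0 <= t <= 1 -> closure Omega (x + t *: (y - x))) ->
  mdot (w y - w x) (y - x) = 0.
Proof.
have [A [b wA]] := Xh_affine wXh.
move=> xyO; apply/eqP; rewrite -normr_le0.
have -> : mdot (w y - w x) (y - x) = mdot (w y) (y - x) - mdot (w x) (y - x).
  by rewrite mdotBl.
apply: (@segment_growth _ _ _ _ ThP (fun z => mdot (w z) (y - x))) => //.
move=> S p q c STh Sp Sq pq; rewrite mul0r (wA _ _ STh Sp) (wA _ _ STh Sq).
rewrite -mdotBl opprD addrACA subrr addr0 -mulmxBl pq -scalemxAl mdotZl mdot_skew ?mulr0 ?normr0 //.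
exact: (Xh_skew STh (wA _ ^~ STh)).
Qed.

Lemma Xh_locally_rigid x : Omega x ->
  exists M c, M + M^T = 0 /\ \forall y \near x, w y = y *m M + c.
Proof.
move=> Ox.
have /nbhs_ballP[r /= r0 rO] := open_nbhs_nbhs (conj (open_triangulated ThP) Ox).
have [|M [c [MM wM]]] := @orthogonal_increments_affine _ _ w x r r0.
  move=> y z yr zr; apply: Xh_orthogonal_increments => t /andP[t0 t1].
  apply: subset_closure; apply: rO; rewrite -ball_normE /=.
  have -> : x - (z + t *: (y - z)) = - ((1 - t) *: (z - x) + t *: (y - x)).
    apply/rowP => i; rewrite !mxE; ring.
  rewrite normrN (le_lt_trans (ler_normD _ _)) // !normrZ !ger0_norm ?subr_ge0 //.
  apply: (@le_lt_trans _ _ (Num.max `|y - x| `|z - x|)); last by rewrite gt_max yr.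
  have hy : `|y - x| <= Num.max `|y - x| `|z - x| by rewrite le_max lexx.
  have hz : `|z - x| <= Num.max `|y - x| `|z - x| by rewrite le_max lexx orbT.
  by nra.
exists M, c; split=> //; apply/nbhs_ballP; exists r => // y; rewrite -ball_normE /= => yr.
by apply: wM; rewrite distrC.
Qed.

(** The set where w coincides locally with a given rigid displacement is open
    and closed in Omega. *)
Lemma Xh_rigid : Omega !=set0 -> exists M c, M + M^T = 0 /\
  forall x, closure Omega x -> w x = x *m M + c.
Proof.
move=> [x0 Ox0]; have [M [c [MM wM]]] := Xh_locally_rigid Ox0.
exists M, c; split=> //.
pose E := [set x | Omega x /\ \forall y \near x, w y = y *m M + c].
pose F := [set x | Omega x /\ exists M' c', (M', c') <> (M, c) /\ \forall y \near x, w y = y *m M' + c'].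
have oP P : open [set x : 'rV[R]_d | Omega x /\ \forall y \near x, P y].
  apply: openI; first exact: open_triangulated ThP.
  exact: open_interior.
have EO : E = Omega.
  apply: Omega_connected.
  - by exists x0.
  - exists E; first exact: oP.
    by apply/seteqP; split=> x [] //; split=> //; case: b.
  - exists (~` F); last first.
      apply/seteqP; split=> x.
        move=> [Ox xE]; split=> // -[_ [M' [c' [ne xF]]]]; apply: ne.
        have [|-> -> //] := @affine_unique _ _ M' M c' c x.
        by apply: filterS2 xE xF => y -> ->.
      move=> [Ox nF]; split=> //; have [M' [c' [_ xM]]] := Xh_locally_rigid Ox.
      have [[<- <-] //|ne] := pselect ((M', c') = (M, c)).
      by exfalso; apply: nF; split=> //; exists M', c'.
    apply: open_closedC; rewrite (_ : F = \bigcup_(Mc in [set Mc | Mc <> (M, c)])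
        [set x | Omega x /\ \forall y \near x, w y = y *m Mc.1 + Mc.2]).
      by apply: bigcup_open => Mc _; exact: oP.
    apply/seteqP; split=> x.
      by move=> [Ox [M' [c' [ne xF]]]]; exists (M', c').
    by move=> [[M' c'] /= ne [Ox xF]]; split=> //; exists M', c'.
move=> x; rewrite (closure_triangulated ThP) => -[S /= STh Sx].
have [A [b wA]] := Xh_affine wXh.
have [nd _ _] := ThP.
have [z Sz] := simplex_interior_nonempty (nd _ STh).
have [_ zE] : E z by rewrite EO; exact: (interior_simplex_sub ThP STh Sz).
suff [AM bc] : A S = M /\ b S = c by rewrite (wA _ _ STh Sx) AM bc.
apply: (@affine_unique _ _ _ _ _ _ z).
by apply: filterS2 zE Sz => y <- Sy; rewrite (wA _ _ STh Sy).
Qed.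

(** The uniqueness statement behind Korn's inequality: the zeros of a nontrivial
    rigid displacement are too few to contain a set of positive surface
    measure. *)
Lemma Xh_rigid_eq0 Gamma0 : Gamma0 `<=` bdry Omega -> (0 < surf R d Gamma0)%E ->
  (\forall x \ae surf R d, Gamma0 x -> w x = 0) ->
  forall x, closure Omega x -> w x = 0.
Proof.
move=> GO G0 w0.
have On : Omega !=set0.
  apply: contrapT => /set0P/negP/negPn/eqP O0; move: G0.
  have -> : Gamma0 = set0.
    by apply/seteqP; split=> // x /GO [] +; rewrite O0 closure0.
  by rewrite measure0 ltxx.
have [M [c [MM wM]]] := Xh_rigid On.
have zero : hausdorff_outer d.-1 (Gamma0 `&` [set x : 'rV[R]_d | x *m M + c = 0]) <> 0%E.
  move=> Z0; move: G0; apply/negP; rewrite -leNgt.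
  have /surf_negligible N0 := w0.
  rewrite -[leRHS]adde0 -{1}N0 -Z0.
  apply: le_trans (outer_measureU2 (@hausdorff_outer R d d.-1) _ _).
  apply: (le_outer_measure (@hausdorff_outer R d d.-1)) => x Gx.
  have [h|h] := pselect (w x = 0); last by left => /(_ Gx).
  by right; split=> //; rewrite /mkset -wM //; case: (GO _ Gx).
have M0 : M = 0.
  apply: contrapT => /eqP M0; apply: zero.
  apply: rigid_zeros_surf_null => //.
  - by apply/eqP; rewrite -addr_eq0 addrC MM.
  - have [B [Br hB]] := bounded_closure_triangulated Omega_bounded.
    by exists B; split=> // k Bk x /GO[clx _]; exact: hB clx.
suff c0 : c = 0 by move=> x /wM ->; rewrite M0 c0 mulmx0 addr0.
apply: contrapT => c0; apply: zero.
rewrite (_ : _ `&` _ = set0) ?outer_measure0 //.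
by apply/seteqP; split=> // x [_ /=]; rewrite M0 mulmx0 add0r.
Qed.

End one_function.
End rigidity.

(** * Finite-dimensional variational problems *)

Section galerkin.
Variables (R : fieldType) (V : lmodType R) (W : V -> Prop).
Hypothesis W0 : W 0.
Hypothesis WL : forall a u v, W u -> W v -> W (a *: u + v).

Definition linear_on (l : V -> R) :=
  forall a u v, W u -> W v -> l (a *: u + v) = a * l u + l v.

Lemma linear_onD l l' : linear_on l -> linear_on l' -> linear_on (fun v => l v + l' v).
Proof.
by move=> ll ll' a u v Wu Wv; rewrite ll // ll' // mulrDr addrACA.
Qed.

Lemma linear_onB l l' : linear_on l -> linear_on l' -> linear_on (fun v => l v - l' v).
Proof.
by move=> ll ll' a u v Wu Wv; rewrite ll // ll' // mulrBr opprD addrACA.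
Qed.

Lemma linear_on_comb l r (w : 'I_r -> V) (c : 'I_r -> R) : linear_on l ->
  (forall i, W (w i)) ->
  W (\sum_i c i *: w i) /\ l (\sum_i c i *: w i) = \sum_i c i * l (w i).
Proof.
move=> ll Ww; have l0 : l 0 = 0.
  by have := ll (-1) 0 0 W0 W0; rewrite scaler0 addr0 mulN1r addNr.
elim: (index_enum _) => [|i s [Ws IH]]; first by rewrite !big_nil.
by rewrite !big_cons; split; [exact: WL|rewrite ll // IH].
Qed.

(** The functionals ev i play the role of the degrees of freedom. *)
Variables (I : finType) (ev : I -> V -> R).
Hypothesis ev_lin : forall i, linear_on (ev i).

Let E (w : V) : 'rV[R]_#|I| := \row_k ev (enum_val k) w.

Let E0 w : E w = 0 <-> forall i, ev i w = 0.
Proof.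
split=> [/rowP Ew i|h]; last by apply/rowP => k; rewrite !mxE.
by have := Ew (enum_rank i); rewrite !mxE enum_rankK.
Qed.

(** A family whose images have maximal rank spans W up to vectors that no
    functional sees. *)
Lemma finite_basis : exists r (w : 'I_r -> V), [/\ forall i, W (w i),
  row_free (\matrix_i E (w i)) &
  forall v, W v -> exists c : 'I_r -> R, forall i, ev i (v - \sum_j c j *: w j) = 0].
Proof.
pose P r := exists2 w : 'I_r -> V, forall i, W (w i) & row_free (\matrix_i E (w i)).
have exP : exists r, `[< P r >].
  exists 0%N; apply/asboolP; exists (fun=> 0) => //.
  by rewrite /row_free flatmx0 mxrank0.
have boundP r : `[< P r >] -> (r <= #|I|)%N.
  by move=> /asboolP[w _ /eqP <-]; exact: rank_leq_col.
have [r /asboolP[w Ww free] max] := ex_maxnP exP boundP.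
exists r, w; split=> // v Wv.
have [/submxP[c vE]|nv] := boolP (E v <= \matrix_i E (w i))%MS.
  have Wc := fun l ll => @linear_on_comb l r w (c 0) ll Ww.
  exists (c 0) => i; have [Ws es] := Wc _ (ev_lin i).
  rewrite -scaleN1r addrC ev_lin // es mulN1r.
  have /rowP/(_ (enum_rank i)) := vE; rewrite mxE enum_rankK => ->.
  rewrite mxE addrC; apply/eqP; rewrite subr_eq0; apply/eqP/eq_bigr => j _.
  by rewrite !mxE enum_rankK.
exfalso; have : (1 + r <= r)%N; last by rewrite ltnn.
apply: max; apply/asboolP.
exists (fun i : 'I_(1 + r) => if fintype.split i is inr j then w j else v).
  by move=> i; case: (fintype.split i).
have -> : \matrix_(i < 1 + r) E (if fintype.split i is inr j then w j else v) =
    col_mx (E v) (\matrix_i E (w i)).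
  apply/row_matrixP => i; rewrite rowK; case: (fintype.split_ordP i) => j ->.
    by rewrite rowKu row_id.
  by rewrite rowKd rowK.
rewrite -row_leq_rank -addsmxE.
have capE : (E v :&: \matrix_i E (w i) = 0)%MS.
  apply/eqP; rewrite -submx0; apply/rV_subP => z; rewrite sub_capmx => /andP[/sub_rVP[a ->]].
  have [->|a0] := eqVneq a 0; first by rewrite scale0r !sub0mx.
  by rewrite (eqmx_scale _ a0) (negPf nv).
rewrite mxrank_disjoint_sum // (eqP free) leq_add2r rank_rV.
by case: eqP => // Ev0; move: nv; rewrite Ev0 sub0mx.
Qed.

(** On the span of the basis the problem is a square linear system, which is
    injective by definiteness of B. *)
Lemma galerkin (B : V -> V -> R) (l : V -> R) :
  (forall v, W v -> linear_on (B ^~ v)) -> (forall u, W u -> linear_on (B u)) -> linear_on l ->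
  (forall w, W w -> B w w = 0 -> forall i, ev i w = 0) ->
  (forall z, W z -> (forall i, ev i z = 0) -> l z = 0 /\ forall u, W u -> B u z = 0) ->
  exists2 u, W u & forall v, W v -> B u v = l v.
Proof.
move=> Bl Br ll B0 z0; have [r [w [Ww free span]]] := finite_basis.
pose comb (c : 'rV[R]_r) := \sum_i c 0 i *: w i.
have Wc c : W (comb c) by case: (linear_on_comb (c 0) ll Ww).
pose G := \matrix_(i, j) B (w i) (w j).
have BG c j : B (comb c) (w j) = (c *m G) 0 j.
  have [_ ->] := linear_on_comb (c 0) (Bl (w j) (Ww j)) Ww.
  by rewrite mxE; apply: eq_bigr => i _; rewrite mxE.
have Bcomb u d : W u -> B u (comb d) = \sum_j d 0 j * B u (w j).
  by move=> Wu; have [_ ->] := linear_on_comb (d 0) (Br u Wu) Ww.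
have Gunit : G \in unitmx.
  rewrite -row_free_unit -kermx_eq0; apply/eqP/row_matrixP => i; rewrite row0.
  set c := row i _; have cG : c *m G = 0 by rewrite -row_mul mulmx_ker row0.
  have cw0 : B (comb c) (comb c) = 0.
    have Z j : (0 : 'rV[R]_r) 0 j = 0 by rewrite mxE.
    by rewrite Bcomb // big1 // => j _; rewrite BG cG Z mulr0.
  have /E0 := B0 _ (Wc c) cw0.
  suff -> : E (comb c) = c *m \matrix_i E (w i).
    by move/eqP; rewrite mulmx_free_eq0 // => /eqP.
  apply/rowP => k; rewrite mxE (linear_on_comb (c 0) (ev_lin _) Ww).2 mxE.
  by apply: eq_bigr => j _; rewrite !mxE.
pose c := (\row_j l (w j)) *m invmx G; exists (comb c) => // v Wv.
have [d dP] := span v Wv; pose u := \sum_j d j *: w j.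
have [Wu lu] := linear_on_comb d ll Ww.
have Wz : W (v - u) by rewrite -scaleN1r addrC; exact: WL.
have [lz Bz] := z0 _ Wz dP.
have vE : v = 1 *: (v - u) + u by rewrite scale1r subrK.
rewrite vE ll // lz (Br _ (Wc c)) // (Bz _ (Wc c)) mulr0 !add0r lu.
have [_ ->] := linear_on_comb d (Br _ (Wc c)) Ww.
by apply: eq_bigr => j _; rewrite BG /c mulmxKV // mxE.
Qed.

End galerkin.

(** * Positive tensors *)

Lemma mdot_tr (R : realType) m n (A B : 'M[R]_(m, n)) : mdot A^T B^T = mdot A B.
Proof.
rewrite /mdot exchange_big; apply: eq_bigr => i _; apply: eq_bigr => j _.
by rewrite !mxE.
Qed.

Definition positive_on_sym (R : realType) d (K : 'M[R]_d -> 'M[R]_d) : Prop :=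
  forall xi, xi^T = xi -> 0 <= mdot (K xi) xi /\ (mdot (K xi) xi = 0 -> xi = 0).

Section resolvent.
Variables (R : realType) (d : nat) (C : {linear 'M[R]_d -> 'M[R]_d}) (gamma : R).
Hypothesis gamma_gt0 : 0 < gamma.
Hypothesis C_sym : forall xi, (C xi)^T = C xi.
Hypothesis C_tr : forall xi, C xi^T = C xi.
Hypothesis C_pos : positive_on_sym C.

Let F : 'End('M[R]_d) := linfun (gamma \*: idfun \+ C).

Let FE xi : F xi = gamma *: xi + C xi. Proof. by rewrite lfunE. Qed.

(* C only sees the symmetric part, so it is nonnegative on all matrices. *)
Let C_ge0 xi : 0 <= mdot (C xi) xi.
Proof.
have [+ _] := C_pos (xi := 2^-1 *: (xi + xi^T)) (ltac:(by rewrite linearZ linearD /= trmxK addrC)).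
have T : mdot (C xi) xi^T = mdot (C xi) xi by rewrite -mdot_tr trmxK C_sym.
rewrite linearZ linearD /= C_tr mdotZl mdotDl (mdotC (C xi) (2^-1 *: _)) mdotZl mdotDl.
by rewrite !(mdotC _ (C xi)) T; lra.
Qed.

Let kerF : lker F == 0%VS.
Proof.
rewrite -subv0; apply/subvP => xi; rewrite memv_ker memv0 FE => /eqP Fxi.
apply/eqP/mdot_eq0.
have : mdot (gamma *: xi + C xi) xi = 0.
  by rewrite Fxi /mdot big1 // => i _; rewrite big1 // => j _; rewrite mxE mul0r.
rewrite mdotDl mdotZl => h; have := C_ge0 xi; have := mdot_ge0 xi => x0 c0.
have /eqP : gamma * mdot xi xi = 0.
  apply/eqP; rewrite eq_le mulr_ge0 ?(ltW gamma_gt0) // andbT; lra.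
by rewrite mulf_eq0 gt_eqF //= => /eqP.
Qed.

(** The inverse of gamma + C, which exists because C is nonnegative and the
    space of matrices has finite dimension. *)
Definition resolvent : {linear 'M[R]_d -> 'M[R]_d} := (F^-1)%VF.

Lemma resolventK xi : gamma *: resolvent xi + C (resolvent xi) = xi.
Proof. by rewrite -FE; exact: (lker0_lfunVK kerF). Qed.

Lemma resolvent_eq xi zeta : gamma *: xi + C xi = zeta -> xi = resolvent zeta.
Proof. by rewrite -FE => <-; exact/esym/(lker0_lfunK kerF). Qed.

Lemma resolvent_sym zeta : zeta^T = zeta -> (resolvent zeta)^T = resolvent zeta.
Proof.
move=> zs; apply: resolvent_eq.
by rewrite C_tr -[RHS]zs -[in RHS](resolventK zeta) linearD linearZ /= C_sym.
Qed.

(** For zeta = gamma xi + C xi the quadratic form takes the value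
    gamma (gamma (C xi : xi) + C xi : C xi). *)
Lemma resolvent_pos : positive_on_sym (fun xi => gamma *: C (resolvent xi)).
Proof.
move=> zeta zs; set xi := resolvent zeta.
have [xi0 xi00] := C_pos (resolvent_sym zs).
have E : mdot (gamma *: C xi) zeta = gamma * (gamma * mdot (C xi) xi + mdot (C xi) (C xi)).
  rewrite mdotZl; congr (_ * _).
  transitivity (mdot (C xi) (gamma *: xi + C xi)); first by rewrite resolventK.
  by rewrite mdotC mdotDl mdotZl [mdot xi _]mdotC.
have C2 := mdot_ge0 (C xi); rewrite -/xi in xi0 xi00.
split=> [|]; rewrite E.
  by rewrite !(mulr_ge0, addr_ge0) ?(ltW gamma_gt0).
move=> /eqP; rewrite mulf_eq0 gt_eqF //= => /eqP h.
have /eqP : gamma * mdot (C xi) xi = 0.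
  apply/eqP; rewrite eq_le mulr_ge0 ?(ltW gamma_gt0) // andbT; lra.
rewrite mulf_eq0 gt_eqF //= => /eqP CC0.
by rewrite -(resolventK zeta) -/xi (xi00 CC0) scaler0 linear0 addr0.
Qed.

End resolvent.

Section elasticity_tensor.
Variables (R : realType) (d : nat) (lam mu : R).

Lemma CappE (xi : 'M[R]_d) :
  Capp lam mu xi = (lam * \tr xi)%:M + mu *: (xi + xi^T).
Proof.
apply/matrixP => i j; rewrite !mxE.
have dk (k : 'I_d) (a : 'I_d -> R) : \sum_l (k == l)%:R * a l = a k.
  rewrite (bigD1 k) //= eqxx mul1r big1 ?addr0 // => l lk.
  by rewrite eq_sym (negPf lk) mul0r.
transitivity (\sum_k (lam * (i == j)%:R * xi k k +
    mu * ((i == k)%:R * xi k j + (j == k)%:R * xi k i))).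
  apply: eq_bigr => k _.
  rewrite (eq_bigr (fun l => lam * (i == j)%:R * ((k == l)%:R * xi k l) +
      mu * ((i == k)%:R * ((j == l)%:R * xi k l) + (j == k)%:R * ((i == l)%:R * xi k l)))).
    by rewrite big_split /= -!mulr_sumr big_split /= -!mulr_sumr !dk.
  by move=> l _; rewrite /ctensor; ring.
rewrite big_split /= -!mulr_sumr big_split /= !(dk _ (fun k => xi k _)) /mxtrace.
by rewrite mulrAC; case: (i == j); rewrite ?mulr1 ?mulr0 ?mulr1n ?mulr0n.
Qed.

Lemma Capp_is_linear : linear (@Capp R d lam mu).
Proof.
move=> a x y; rewrite !CappE mxtraceD mxtraceZ.
apply/matrixP => i j; rewrite !mxE; case: (i == j); rewrite ?mulr1n ?mulr0n; ring.
Qed.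

HB.instance Definition _ := GRing.isLinear.Build R 'M[R]_d 'M[R]_d *:%R (@Capp R d lam mu)
  Capp_is_linear.

Lemma Capp_sym (xi : 'M[R]_d) : (Capp lam mu xi)^T = Capp lam mu xi.
Proof. by rewrite !CappE linearD linearZ /= linearD /= trmxK tr_scalar_mx [xi^T + _]addrC. Qed.

Lemma Capp_tr (xi : 'M[R]_d) : Capp lam mu xi^T = Capp lam mu xi.
Proof. by rewrite !CappE mxtrace_tr trmxK [xi^T + _]addrC. Qed.

Lemma Capp_pos : ctensor_positive d lam mu -> positive_on_sym (@Capp R d lam mu).
Proof.
move=> [cstar c0 h] xi /h {}h.
have nE : \sum_i \sum_j xi i j ^+ 2 = mdot xi xi.
  by apply: eq_bigr => i _; apply: eq_bigr => j _; rewrite expr2.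
have E : \sum_i \sum_j \sum_k \sum_l ctensor lam mu i j k l * xi i j * xi k l =
    mdot (Capp lam mu xi) xi.
  apply: eq_bigr => i _; apply: eq_bigr => j _; rewrite mxE mulr_suml.
  apply: eq_bigr => k _; rewrite mulr_suml; apply: eq_bigr => l _; ring.
rewrite nE E in h; have n0 := mdot_ge0 xi.
split=> [|h0]; first by rewrite (le_trans _ h) // mulr_ge0 // ltW.
by apply: mdot_eq0; nra.
Qed.

End elasticity_tensor.

(** * The elliptic problem of one time step *)

Lemma L2_linear disp (T : measurableType disp) (R : realType)
    (mu : {measure set T -> \bar R}) (A : set T) d (K : {linear 'M[R]_d -> 'M[R]_d})
    (F : T -> 'M[R]_d) :
  measurable A -> L2 mu A F -> L2 mu A (fun x => K (F x)).
Proof.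
move=> mA /(L2P _ mA) sF; apply/(L2P _ mA) => i j.
under eq_fun => x.
  rewrite (matrix_sum_delta (F x)) linear_sum summxE.
  under eq_bigr => k _ do (rewrite linear_sum summxE;
    under eq_bigr do rewrite linearZ mxE mulrC).
  over.
by apply: (sqint_sum mA) => k; apply: (sqint_sum mA) => l; exact: (sqintZ mA).
Qed.

Section elliptic.
Variables (R : realType) (d : nat) (Omega Gamma0 : set 'rV[R]_d).
Variable Th : seq 'M[R]_(d.+1, d).
Hypothesis Omega_bounded : bounded_set Omega.
Hypothesis Omega_connected : connected Omega.
Hypothesis ThP : triangulation Omega Th.
Hypothesis Gamma0_bdry : Gamma0 `<=` bdry Omega.
Hypothesis Gamma0_pos : (0 < surf R d Gamma0)%E.
Local Notation mu := (vol R d).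
Local Notation T := (caratheodory_type (@lebesgue_outer R d)).
Local Notation H := (caratheodory_type (@hausdorff_outer R d d.-1)).
Local Notation Gamma1 := (neumann_part Omega Gamma0).
Local Notation fT := ('rV[R]_d -> 'rV[R]_d).
Implicit Types u v w : fT.

Let mO : measurable (Omega : set T). Proof. exact: Omega_measurable ThP. Qed.

Let lincombE a u v x : (a *: u + v) x = a *: u x + v x. Proof. by []. Qed.

Lemma Xh_lin a u v : Xh Omega Th u -> Xh Omega Th v -> Xh Omega Th (a *: u + v).
Proof.
move=> [cu uA] [cv vA]; split.
  apply/subspace_continuousP => x Ox.
  move/subspace_continuousP/(_ x Ox): cu => cu; move/subspace_continuousP/(_ x Ox): cv => cv.
  exact: (cvgD (cvgZl_tmp cu) cv).
move=> S STh; have [A [b uE]] := uA S STh; have [A' [b' vE]] := vA S STh.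
exists (a *: A + A'), (a *: b + b') => x Sx.
by rewrite lincombE uE // vE // mulmxDr -scalemxAr scalerDr addrACA.
Qed.

Lemma Xh0 : Xh Omega Th (0 : fT).
Proof.
split; first by apply: continuous_subspaceT => x; exact: cst_continuous.
by move=> S _; exists 0, 0 => x _; rewrite mulmx0 addr0.
Qed.

Lemma strain_lin a u v : Xh Omega Th u -> Xh Omega Th v ->
  \forall x \ae mu, Omega x ->
    strain Omega (a *: u + v) x = a *: strain Omega u x + strain Omega v x.
Proof.
move=> uX vX; have [A [b uA]] := Xh_affine uX; have [A' [b' vA]] := Xh_affine vX.
have su := Xh_strain Omega_bounded ThP uX; have sv := Xh_strain Omega_bounded ThP vX.
have suv := Xh_strain Omega_bounded ThP (Xh_lin a uX vX).
apply: ae_mono (ae_and (ae_and su sv) suv) => x [[sux svx] suvx] Ox.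
have := subset_closure Ox; rewrite (closure_triangulated ThP) => -[S /= STh Sx].
rewrite (sux Ox S STh Sx _ _ (uA S ^~ STh)) (svx Ox S STh Sx _ _ (vA S ^~ STh)).
rewrite (suvx Ox S STh Sx (a *: A S + A' S) (a *: b S + b' S)).
  by apply/matrixP => i j; rewrite !mxE; ring.
move=> y Sy; rewrite lincombE (uA _ _ STh Sy) (vA _ _ STh Sy).
by rewrite mulmxDr -scalemxAr scalerDr addrACA.
Qed.

Lemma strain_eq0 w : Xh Omega Th w -> (forall x, closure Omega x -> w x = 0) ->
  \forall x \ae mu, Omega x -> strain Omega w x = 0.
Proof.
move=> wX w0; apply: ae_mono (Xh_strain Omega_bounded ThP wX) => x sx Ox.
have := subset_closure Ox; rewrite (closure_triangulated ThP) => -[S /= STh Sx].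
rewrite (sx Ox S STh Sx 0 0); first by rewrite trmx0 addr0 scaler0.
by move=> y Sy; rewrite mulmx0 addr0 w0 //; exact: (sub_closure_triangulated ThP STh).
Qed.

Lemma Xh_trace w x : Xh Omega Th w -> closure Omega x -> trace Omega w x = w x.
Proof.
by move=> [cw _]; exact: trace_continuous (open_triangulated ThP) Omega_bounded cw.
Qed.

Lemma VhP g v : Xh Omega Th g -> Vh Omega Gamma0 Th g v <->
  Xh Omega Th v /\ \forall x \ae surf R d, Gamma0 x -> v x = g x.
Proof.
move=> gX; split=> [[vX [_ tv]]|[vX tv]].
  split=> //; apply: ae_mono tv => x tv Gx; have [cx _] := Gamma0_bdry Gx.
  by rewrite -(Xh_trace vX cx) -(Xh_trace gX cx) tv.
split; first exact: vX.
split; first exact: (Xh_H1 Omega_bounded ThP vX).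
apply: ae_mono tv => x tv Gx; have [cx _] := Gamma0_bdry Gx.
by rewrite (Xh_trace vX cx) (Xh_trace gX cx) tv.
Qed.

Lemma Vh0P v : Vh Omega Gamma0 Th (fun=> 0) v <->
  Xh Omega Th v /\ \forall x \ae surf R d, Gamma0 x -> v x = 0.
Proof. exact: (VhP v Xh0). Qed.

Local Notation V0 := (Vh Omega Gamma0 Th (fun=> 0)).

Lemma Vh_lin g a u v : Xh Omega Th g -> V0 u -> Vh Omega Gamma0 Th g v ->
  Vh Omega Gamma0 Th g (a *: u + v).
Proof.
move=> gX /Vh0P[uX tu] /(VhP _ gX)[vX tv]; apply/(VhP _ gX); split; first exact: Xh_lin.
apply: ae_mono (ae_and tu tv) => x [tu' tv'] Gx.
by rewrite lincombE tu' // tv' // scaler0 add0r.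
Qed.

(** On a simplex an affine map takes at a convex combination of the vertices the
    same convex combination of its values at the vertices. *)
Lemma Xh_eq0 w : Xh Omega Th w ->
  (forall S i, S \in Th -> w (row i S) = 0) -> forall x, closure Omega x -> w x = 0.
Proof.
move=> wX w0 x; rewrite (closure_triangulated ThP) => -[S /= STh Sx].
have [A [b wA]] := Xh_affine wX; have [c [c0 c1 _ xE]] := Sx.
have vS i : simplex S (row i S).
  exists (delta_mx 0 i); split=> [j||j|].
  - by rewrite mxE; case: (_ && _).
  - rewrite (bigD1 i) //= mxE !eqxx big1 ?addr0 // => j ji.
    by rewrite mxE (negPf ji) andbF.
  - by rewrite inE.
  - by rewrite rowE.
rewrite (wA _ _ STh Sx) xE.
have -> : c *m S *m A S + b S = \sum_i c 0 i *: w (row i S).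
  rewrite (eq_bigr (fun i => c 0 i *: (row i S *m A S) + c 0 i *: b S)); last first.
    by move=> i _; rewrite (wA _ _ STh (vS i)) scalerDr.
  rewrite big_split /= -scaler_suml c1 scale1r -mulmxA; congr (_ + _).
  by rewrite mulmx_sum_row; apply: eq_bigr => i _; rewrite row_mul.
by rewrite big1 // => i _; rewrite w0 // scaler0.
Qed.

Lemma neumann_measurable : measurable (Gamma1 : set H).
Proof.
apply: measurableD; last first.
  by rewrite -[closure _]setCK; apply/measurableC/open_surf_measurable/closed_openC/closed_closure.
rewrite /bdry; apply: measurableD; last exact/open_surf_measurable/open_interior.
by rewrite -[closure _]setCK; apply/measurableC/open_surf_measurable/closed_openC/closed_closure.
Qed.

Lemma Xh_L2_surf v : Xh Omega Th v -> L2 (surf R d) Gamma1 v.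
Proof.
move=> vX; have [M M0 vM] := Xh_bounded Omega_bounded vX.
have G1O : Gamma1 `<=` closure Omega by move=> x [[]].
apply: (L2_bounded (M := M) neumann_measurable).
- apply: le_lt_trans (surf_bdry_fin Omega_bounded ThP).
  by apply: (le_outer_measure (@hausdorff_outer R d d.-1)) => x [].
- move=> i j; rewrite (ord1 i).
  apply: (@continuous_caratheodory_measurable _ _ (@hausdorff_outer R d d.-1) Gamma1 (closure Omega)) => //.
  + exact: hausdorff_halfspace.
  + exact: Xh_within_continuous vX j.
  + exact: neumann_measurable.
- by move=> x i j /G1O; rewrite (ord1 i); exact: vM.
Qed.

Section load.
Variables f0 q0 : fT.
Hypothesis f0_L2 : L2 mu Omega f0.
Hypothesis q0_L2 : L2 (surf R d) Gamma1 q0.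

Definition load_functional v : R :=
  L2dot mu Omega f0 v + L2dot (surf R d) Gamma1 q0 (trace Omega v).

Lemma load_traceE v : Xh Omega Th v ->
  load_functional v = L2dot mu Omega f0 v + L2dot (surf R d) Gamma1 q0 v.
Proof.
move=> vX; congr (_ + _); apply: eq_Rintegral => x /set_mem[[cx _] _].
by rewrite (Xh_trace vX cx).
Qed.

Lemma load_lin : linear_on (Xh Omega Th) load_functional.
Proof.
move=> a u v uX vX; rewrite !load_traceE //; last exact: Xh_lin.
have LO w := @Xh_L2 _ _ _ _ Omega_bounded ThP w.
have LG := Xh_L2_surf; have mG := neumann_measurable.
rewrite ![L2dot mu Omega f0 _]L2dotC ![L2dot (surf R d) _ q0 _]L2dotC.
rewrite (L2dotDl mO (L2Z mO a (LO _ uX)) (LO _ vX) f0_L2) (L2dotZl mO a (LO _ uX) f0_L2).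
rewrite (L2dotDl mG (L2Z mG a (LG _ uX)) (LG _ vX) q0_L2) (L2dotZl mG a (LG _ uX) q0_L2).
ring.
Qed.

Lemma load_eq0 w : Xh Omega Th w -> (forall x, closure Omega x -> w x = 0) ->
  load_functional w = 0.
Proof.
move=> wX w0; rewrite load_traceE // /L2dot.
have m0 (a : 'rV[R]_d) : mdot a 0 = 0.
  by rewrite /mdot big1 // => i _; rewrite big1 // => j _; rewrite mxE mulr0.
rewrite (@eq_Rintegral _ _ _ mu Omega (cst 0)); last first.
  by move=> x /set_mem Ox; rewrite w0 ?m0 //; exact: subset_closure.
rewrite (@eq_Rintegral _ _ _ (surf R d) Gamma1 (cst 0)); last first.
  by move=> x /set_mem[[cx _] _]; rewrite w0 ?m0.
by rewrite !Rintegral_cst ?mul0r ?addr0 //; exact: neumann_measurable.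
Qed.

End load.

Section energy.
Variable K : {linear 'M[R]_d -> 'M[R]_d}.
Hypothesis K_pos : positive_on_sym K.

Definition energy w v : R := L2dot mu Omega (fun x => K (strain Omega w x)) (strain Omega v).

Let strL2 v : Xh Omega Th v -> L2 mu Omega (strain Omega v).
Proof. exact: (Xh_strain_L2 Omega_bounded ThP). Qed.

Let KstrL2 v : Xh Omega Th v -> L2 mu Omega (fun x => K (strain Omega v x)).
Proof. by move=> vX; exact: (L2_linear K mO (strL2 vX)). Qed.

Lemma energy_linl v : Xh Omega Th v -> linear_on (Xh Omega Th) (energy ^~ v).
Proof.
move=> vX a u u' uX uX'; rewrite /energy.
have h : \forall x \ae mu, Omega x -> K (strain Omega (a *: u + u') x) =
    a *: K (strain Omega u x) + K (strain Omega u' x).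
  by apply: ae_mono (strain_lin a uX uX') => x h Ox; rewrite h // linearD linearZ.
apply: (etrans (L2dot_ae mO (KstrL2 (Xh_lin a uX uX'))
  (L2D mO (L2Z mO a (KstrL2 uX)) (KstrL2 uX')) (strL2 vX) (strL2 vX) h (aeW _ (fun _ _ => erefl)))).
apply: (etrans (L2dotDl mO (L2Z mO a (KstrL2 uX)) (KstrL2 uX') (strL2 vX))).
by congr (_ + _); exact: (L2dotZl mO a (KstrL2 uX) (strL2 vX)).
Qed.

Lemma L2dot_strain_lin F : L2 mu Omega F ->
  linear_on (Xh Omega Th) (fun v => L2dot mu Omega F (strain Omega v)).
Proof.
move=> LF a u u' uX uX'.
apply: (etrans (L2dot_ae mO LF LF (strL2 (Xh_lin a uX uX'))
  (L2D mO (L2Z mO a (strL2 uX)) (strL2 uX')) (aeW _ (fun _ _ => erefl)) (strain_lin a uX uX'))).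
apply: (etrans (L2dotC _ _ _ _)).
apply: (etrans (L2dotDl mO (L2Z mO a (strL2 uX)) (strL2 uX') LF)).
congr (_ + _); last exact: L2dotC.
by apply: (etrans (L2dotZl mO a (strL2 uX) LF)); congr (_ * _); exact: L2dotC.
Qed.

Lemma energy_linr u : Xh Omega Th u -> linear_on (Xh Omega Th) (energy u).
Proof. by move=> uX; exact: (L2dot_strain_lin (KstrL2 uX)). Qed.

(** The energy is positive definite on V_h, by positivity of the tensor and
    rigidity. *)
Lemma energy_eq0 w : V0 w -> energy w w = 0 -> forall x, closure Omega x -> w x = 0.
Proof.
move=> /Vh0P[wX tw] E0.
have nn x : Omega x -> 0 <= mdot (K (strain Omega w x)) (strain Omega w x).
  by move=> _; case: (K_pos (strain_sym Omega w x)).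
have z := L2dot_eq0 mO (KstrL2 wX) (strL2 wX) nn E0.
apply: (Xh_rigid_eq0 Omega_bounded Omega_connected ThP wX _ Gamma0_bdry Gamma0_pos tw).
by apply: ae_mono z => x h Ox; have [_] := K_pos (strain_sym Omega w x); apply; exact: h.
Qed.

Lemma V0_Xh v : V0 v -> Xh Omega Th v.
Proof. by case/Vh0P. Qed.

Let linear_on_V0 l : linear_on (Xh Omega Th) l -> linear_on V0 l.
Proof. by move=> ll a u v /V0_Xh uX /V0_Xh vX; exact: ll. Qed.

Variables f0 q0 : fT.
Hypothesis f0_L2 : L2 mu Omega f0.
Hypothesis q0_L2 : L2 (surf R d) Gamma1 q0.

(** The boundary datum g is moved to the right-hand side, which leaves a
    variational problem on V_h. *)
Lemma elliptic_exists g psi : Xh Omega Th g -> L2 mu Omega psi ->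
  exists2 u, Vh Omega Gamma0 Th g u & forall v, V0 v ->
    L2dot mu Omega (fun x => K (strain Omega u x) - psi x) (strain Omega v) =
    load_functional f0 q0 v.
Proof.
move=> gX Lpsi.
pose l v := load_functional f0 q0 v + L2dot mu Omega psi (strain Omega v) - energy g v.
have ll : linear_on (Xh Omega Th) l.
  exact: (linear_onB (linear_onD (load_lin f0_L2 q0_L2) (L2dot_strain_lin Lpsi)) (energy_linr gX)).
pose ev (z : 'I_(size Th) * 'I_d.+1 * 'I_d) w := w (row z.1.2 (nth 0 Th z.1.1)) 0 z.2.
have ev_lin z : linear_on V0 (ev z) by move=> a u v _ _; rewrite /ev lincombE !mxE.
have ev0 w : V0 w -> (forall z, ev z w = 0) -> forall x, closure Omega x -> w x = 0.
  move=> /V0_Xh wX h; apply: Xh_eq0 => // S i STh; apply/rowP => k; rewrite mxE.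
  have iS : (index S Th < size Th)%N by rewrite index_mem.
  by have := h (Ordinal iS, i, k); rewrite /ev /= nth_index.
have V00 : V0 0 by apply/Vh0P; split; [exact: Xh0|exact: aeW].
have V0L a u v : V0 u -> V0 v -> V0 (a *: u + v) by exact: (Vh_lin a Xh0).
have [|||||w Vw wl] := @galerkin R _ V0 V00 V0L _ ev ev_lin energy l.
- by move=> v /V0_Xh vX; exact/linear_on_V0/energy_linl.
- by move=> u /V0_Xh uX; exact/linear_on_V0/energy_linr.
- exact: linear_on_V0.
- move=> w Vw E0 z; rewrite /ev (energy_eq0 Vw E0) ?mxE //.
  apply: (sub_closure_triangulated ThP (S := nth 0 Th z.1.1)); first by rewrite mem_nth.
  exists (delta_mx 0 z.1.2); split=> [j||j|].
  + by rewrite mxE; case: (_ && _).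
  + rewrite (bigD1 z.1.2) //= mxE !eqxx big1 ?addr0 // => j ji.
    by rewrite mxE (negPf ji) andbF.
  + by rewrite inE.
  + by rewrite rowE.
- move=> z Vz /(ev0 _ Vz) z0; have zX := V0_Xh Vz.
  have dot0 F : L2 mu Omega F -> L2dot mu Omega F (strain Omega z) = 0.
    move=> LF; rewrite /L2dot.
    have s0 := strain_eq0 zX z0.
    have L0 : L2 mu Omega (fun=> 0 : 'M[R]_d).
      apply/(L2P _ mO) => i j; under eq_fun do rewrite mxE; exact: sqint0.
    rewrite -[LHS]/(L2dot mu Omega F (strain Omega z)).
    rewrite (L2dot_ae mO LF LF (strL2 zX) L0) //; last by apply: aeW.
    rewrite /L2dot (@eq_Rintegral _ _ _ mu Omega (cst 0)) ?Rintegral_cst ?mul0r // => x _.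
    by rewrite /mdot big1 // => i _; rewrite big1 // => j _; rewrite mxE mulr0.
  split=> [|u /V0_Xh uX]; last exact/dot0/KstrL2.
  have ez : energy g z = 0 := dot0 _ (KstrL2 gX).
  by rewrite /l ez (dot0 _ Lpsi) load_eq0 // subr0 addr0.
exists (1 *: w + g).
  apply: Vh_lin => //; apply/(VhP _ gX); split=> //; exact: aeW.
move=> v Vv; have vX := V0_Xh Vv; have wX := V0_Xh Vw.
have uX : Xh Omega Th (1 *: w + g) by exact: Xh_lin.
have Npsi : L2 mu Omega (fun x => (-1) *: psi x) by exact: L2Z.
have su : L2dot mu Omega (fun x => K (strain Omega (1 *: w + g) x) - psi x) (strain Omega v) =
    energy (1 *: w + g) v - L2dot mu Omega psi (strain Omega v).
  rewrite -mulN1r -(L2dotZl mO (-1) Lpsi (strL2 vX)).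
  apply: (etrans _ (L2dotDl mO (KstrL2 uX) Npsi (strL2 vX))).
  by apply: eq_Rintegral => x _; rewrite scaleN1r.
have uE : energy (1 *: w + g) v = 1 * energy w v + energy g v := energy_linl vX 1 wX gX.
have lE : energy w v = load_functional f0 q0 v + L2dot mu Omega psi (strain Omega v) - energy g v.
  exact: wl.
by rewrite su uE lE mul1r subrK addrK.
Qed.

(** The difference of two solutions is an admissible test function and has zero
    energy. *)
Lemma elliptic_unique g u u' (s s' : 'rV[R]_d -> 'M[R]_d) (l : fT -> R) :
  Xh Omega Th g -> Vh Omega Gamma0 Th g u -> Vh Omega Gamma0 Th g u' ->
  L2 mu Omega s -> L2 mu Omega s' ->
  (\forall x \ae mu, Omega x -> s' x - s x = K (strain Omega u' x - strain Omega u x)) ->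
  (forall v, V0 v -> L2dot mu Omega s (strain Omega v) = l v) ->
  (forall v, V0 v -> L2dot mu Omega s' (strain Omega v) = l v) ->
  forall x, closure Omega x -> u' x = u x.
Proof.
move=> gX /(VhP _ gX)[uX tu] /(VhP _ gX)[uX' tu'] Ls Ls' ss su su'.
pose w := (-1) *: u + u'.
have Vw : V0 w.
  apply/Vh0P; split; first exact: Xh_lin.
  apply: ae_mono (ae_and tu tu') => x [ux ux'] Gx.
  by rewrite /w lincombE ux // ux' // scaleN1r addNr.
have wX := V0_Xh Vw.
suff E0 : energy w w = 0.
  move=> x Ox; have := energy_eq0 Vw E0 Ox; rewrite /w lincombE scaleN1r addrC => /eqP.
  by rewrite subr_eq0 => /eqP.
rewrite /energy.
have Ns : L2 mu Omega (fun x => (-1) *: s x) by exact: L2Z.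
have h : \forall x \ae mu, Omega x -> K (strain Omega w x) = s' x + (-1) *: s x.
  apply: ae_mono (ae_and ss (strain_lin (-1) uX uX')) => x [ssx sx] Ox.
  by rewrite sx // !scaleN1r ssx // [- _ + _]addrC.
apply: (etrans (L2dot_ae mO (KstrL2 wX) (L2D mO Ls' Ns) (strL2 wX) (strL2 wX) h
  (aeW _ (fun _ _ => erefl)))).
apply: (etrans (L2dotDl mO Ls' Ns (strL2 wX))).
rewrite (L2dotZl mO (-1) Ls (strL2 wX)).
by rewrite su // su' // mulN1r subrr.
Qed.

End energy.
End elliptic.

(** * Time stepping *)

Section time_step.
Variables (R : realType) (d : nat) (Omega Gamma0 : set 'rV[R]_d).
Variable Th : seq 'M[R]_(d.+1, d).
Hypothesis Omega_bounded : bounded_set Omega.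
Hypothesis Omega_connected : connected Omega.
Hypothesis ThP : triangulation Omega Th.
Hypothesis Gamma0_bdry : Gamma0 `<=` bdry Omega.
Hypothesis Gamma0_pos : (0 < surf R d Gamma0)%E.
Variables (lam mu eta alpha tau : R).
Hypothesis eta_gt0 : 0 < eta.
Hypothesis alpha_ge0 : 0 <= alpha.
Hypothesis tau_gt0 : 0 < tau.
Hypothesis C_pos : ctensor_positive d lam mu.
Local Notation T := (caratheodory_type (@lebesgue_outer R d)).
Local Notation Gamma1 := (neumann_part Omega Gamma0).
Local Notation V0 := (Vh Omega Gamma0 Th (fun=> 0)).
Local Notation L2O := (@L2 R _ T (vol R d) Omega d d).
Implicit Types (u v g : 'rV[R]_d -> 'rV[R]_d) (phi psi : 'rV[R]_d -> 'M[R]_d).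

Let C : {linear 'M[R]_d -> 'M[R]_d} := @Capp R d lam mu.
Let beta : R := eta / tau.
Let gamma : R := beta + alpha.
Let D : {linear 'M[R]_d -> 'M[R]_d} := resolvent C gamma.
Let K : {linear 'M[R]_d -> 'M[R]_d} := gamma \*: (C \o D).

Let beta_gt0 : 0 < beta. Proof. exact: divr_gt0. Qed.
Let gamma_gt0 : 0 < gamma. Proof. exact: ltr_pwDl. Qed.

Let Cp : positive_on_sym C. Proof. exact: Capp_pos. Qed.
Let Csym xi : (C xi)^T = C xi. Proof. exact: Capp_sym. Qed.
Let Ctr xi : C xi^T = C xi. Proof. exact: Capp_tr. Qed.
Let DK := resolventK gamma_gt0 Csym Ctr Cp.
Let D_eq := resolvent_eq gamma_gt0 Csym Ctr Cp.
Let Dsym := resolvent_sym gamma_gt0 Csym Ctr Cp.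
Let Kp : positive_on_sym K. Proof. exact: (resolvent_pos gamma_gt0 Csym Ctr Cp). Qed.
Let mO : measurable (Omega : set T). Proof. exact: Omega_measurable ThP. Qed.

Let CB xi zeta : Capp lam mu (xi - zeta) = C xi - C zeta. Proof. exact: (linearB C). Qed.
Let CBl xi zeta : C (xi - zeta) = C xi - C zeta. Proof. exact: (linearB C). Qed.
Let KB xi zeta : K (xi - zeta) = K xi - K zeta. Proof. exact: (linearB K). Qed.

(** The implicit Euler step for the internal variable with previous value p at a
    point where the new strain is e. *)
Definition euler_step (e p : 'M[R]_d) : 'M[R]_d := D (C e + beta *: p).

Lemma euler_stepP (e p xi : 'M[R]_d) :
  eta *: (tau^-1 *: (xi - p)) + alpha *: xi - Capp lam mu (e - xi) = 0 <->
  xi = euler_step e p.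
Proof.
have E : eta *: (tau^-1 *: (xi - p)) + alpha *: xi - Capp lam mu (e - xi) =
    (gamma *: xi + C xi) - (C e + beta *: p).
  rewrite CB scalerA -/beta.
  by move: (C e) (C xi) => a b; apply/matrixP => i j; rewrite !mxE /gamma; ring.
rewrite E; split=> [/eqP|->]; last by rewrite DK subrr.
by rewrite subr_eq0 => /eqP/D_eq.
Qed.

(** Eliminating the internal variable leaves a stress that depends on the new
    strain through a positive tensor. *)
Lemma stress_euler_step (e p : 'M[R]_d) :
  Capp lam mu (e - euler_step e p) = K e - beta *: C (D p).
Proof.
have DCe : D (C e) = e - gamma *: D e.
  by apply/eqP; rewrite eq_sym subr_eq -linearZ -linearD addrC; apply/eqP/D_eq.
have stepE : e - euler_step e p = gamma *: D e - beta *: D p.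
  have -> : euler_step e p = D (C e) + beta *: D p by rewrite /euler_step linearD linearZ.
  by rewrite DCe; move: (D e) (D p) => a b; apply/matrixP => i j; rewrite !mxE; ring.
by rewrite stepE -[LHS]/(C _) linearB !linearZ.
Qed.

Let L2B F G : L2O F -> L2O G -> L2O (fun x => F x - G x).
Proof.
move=> LF LG; rewrite (_ : (fun x => _) = (fun x => F x + (-1) *: G x)).
  have LN : L2O (fun x => (-1) *: G x) by exact: (L2Z mO).
  exact: (L2D mO LF LN).
by apply/funext => x; rewrite scaleN1r.
Qed.

Let strL2 v : Xh Omega Th v -> L2O (strain Omega v).
Proof. exact: (Xh_strain_L2 Omega_bounded ThP). Qed.

Lemma stress_L2 u phi : Xh Omega Th u -> L2O phi -> L2O (stress Omega lam mu u phi).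
Proof. by move=> uX Lp; exact: (L2_linear C mO (L2B (strL2 uX) Lp)). Qed.

Lemma Psih_L2 phi : Psih Omega Th phi -> L2O phi.
Proof. by case=> -[]. Qed.

Lemma Psih_euler_step u phi : Xh Omega Th u -> Psih Omega Th phi ->
  Psih Omega Th (fun x => euler_step (strain Omega u x) (phi x)).
Proof.
move=> uX [[Lp sp] cp]; split; first split.
- apply: (L2_linear D mO); apply: (L2D mO (L2_linear C mO (strL2 uX))).
  exact: L2Z.
- apply: ae_mono sp => x sp Ox; apply: Dsym.
  have -> : (C (strain Omega u x) + beta *: phi x)^T =
      (C (strain Omega u x))^T + beta *: (phi x)^T.
    by move: (C _) (phi x) => a b; rewrite linearD linearZ.
  by rewrite Csym (sp Ox).
- move=> S STh; have [M hM] := cp S STh; have [A [b uA]] := Xh_affine uX.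
  exists (euler_step (2^-1 *: (A S + (A S)^T)) M).
  apply: ae_mono (ae_and hM (Xh_strain Omega_bounded ThP uX)) => x [pM sx] [Ox Sx].
  by rewrite (sx Ox S STh Sx _ _ (uA S ^~ STh)) pM.
Qed.

Section one_step.
Variables f0 q0 g : 'rV[R]_d -> 'rV[R]_d.
Hypothesis f0_L2 : L2 (vol R d) Omega f0.
Hypothesis q0_L2 : L2 (surf R d) Gamma1 q0.
Hypothesis gX : Xh Omega Th g.

Definition equilibrium u phi := Vh Omega Gamma0 Th g u /\ forall v, V0 v ->
  L2dot (vol R d) Omega (stress Omega lam mu u phi) (strain Omega v) =
  load_functional Omega Gamma0 f0 q0 v.

Lemma equilibrium_exists phi : Psih Omega Th phi -> exists u, equilibrium u phi.
Proof.
move=> pP; have LCp := L2_linear C mO (Psih_L2 pP).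
have [u Vu uE] := elliptic_exists Omega_bounded Omega_connected ThP Gamma0_bdry Gamma0_pos
  Cp f0_L2 q0_L2 gX LCp.
exists u; split=> // v Vv; rewrite -uE //; apply: eq_Rintegral => x _.
by rewrite /stress CB.
Qed.

Lemma equilibrium_unique u u' phi phi' : Psih Omega Th phi -> Psih Omega Th phi' ->
  phi' = phi %[ae vol R d in Omega] -> equilibrium u phi -> equilibrium u' phi' ->
  forall x, closure Omega x -> u' x = u x.
Proof.
move=> pP pP' pp [Vu su] [Vu' su'].
have uX : Xh Omega Th u by case: Vu.
have uX' : Xh Omega Th u' by case: Vu'.
apply: (elliptic_unique Omega_bounded Omega_connected ThP Gamma0_bdry Gamma0_pos
  Cp gX Vu Vu' (stress_L2 uX (Psih_L2 pP)) (stress_L2 uX' (Psih_L2 pP')) _ su su').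
apply: ae_mono pp => x pp Ox; by rewrite /stress (pp Ox) (CB (strain Omega u x)) (CB (strain Omega u' x)) CBl opprB addrA subrK.
Qed.

Lemma step_exists phi : Psih Omega Th phi -> exists u,
  equilibrium u (fun x => euler_step (strain Omega u x) (phi x)).
Proof.
move=> pP; have LCp := L2Z mO beta (L2_linear C mO (L2_linear D mO (Psih_L2 pP))).
have [u Vu uE] := elliptic_exists Omega_bounded Omega_connected ThP Gamma0_bdry Gamma0_pos
  Kp f0_L2 q0_L2 gX LCp.
exists u; split=> // v Vv; rewrite -uE //; apply: eq_Rintegral => x _.
by rewrite /stress stress_euler_step.
Qed.

Lemma step_unique u u' phi phi' psi psi' : Psih Omega Th psi -> Psih Omega Th psi' ->
  phi' = phi %[ae vol R d in Omega] ->
  (\forall x \ae vol R d, Omega x -> psi x = euler_step (strain Omega u x) (phi x)) ->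
  (\forall x \ae vol R d, Omega x -> psi' x = euler_step (strain Omega u' x) (phi' x)) ->
  equilibrium u psi -> equilibrium u' psi' ->
  (forall x, closure Omega x -> u' x = u x) /\ psi' = psi %[ae vol R d in Omega].
Proof.
move=> pP pP' pp hp hp' [Vu su] [Vu' su'].
have uX : Xh Omega Th u by case: Vu.
have uX' : Xh Omega Th u' by case: Vu'.
have uu : forall x, closure Omega x -> u' x = u x.
  apply: (elliptic_unique Omega_bounded Omega_connected ThP Gamma0_bdry Gamma0_pos
    Kp gX Vu Vu' (stress_L2 uX (Psih_L2 pP)) (stress_L2 uX' (Psih_L2 pP')) _ su su').
  apply: ae_mono (ae_and pp (ae_and hp hp')) => x [{}pp [{}hp {}hp']] Ox.
  by rewrite /stress (hp Ox) (hp' Ox) !stress_euler_step (pp Ox) KB opprB addrA subrK.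
split=> //.
pose w := (-1) *: u + u'.
have w0 x : closure Omega x -> w x = 0.
  by move=> Ox; rewrite -[w x]/((-1) *: u x + u' x) uu // scaleN1r addNr.
have ws := strain_eq0 Omega_bounded ThP (Xh_lin (-1) uX uX') w0.
have wl := strain_lin Omega_bounded ThP (-1) uX uX'.
apply: ae_mono (ae_and (ae_and pp (ae_and hp hp')) (ae_and ws wl)).
move=> x [[{}pp [{}hp {}hp']] [{}ws {}wl]] Ox.
have E : strain Omega u' x = strain Omega u x.
  by apply/eqP; rewrite -subr_eq0 addrC -scaleN1r -(wl Ox) (ws Ox).
by rewrite (hp' Ox) (pp Ox) E (hp Ox).
Qed.

End one_step.
End time_step.

Theorem theorem5p4 (R : realType) (d : nat) (hd : d = 2%N \/ d = 3%N)
  (Omega Gamma0 : set 'rV[R]_d)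
  (hOmega : bounded_lipschitz_domain Omega)
  (hGamma0 : dirichlet_part Omega Gamma0)
  (eta alpha : R) (heta : 0 < eta) (halpha : 0 <= alpha)
  (lam mu : R) (hC : ctensor_positive d lam mu)
  (Tmax tau : R) (hT : 0 < Tmax) (htau : 0 < tau)
  (Th : seq 'M[R]_(d.+1, d)) (hTh : triangulation Omega Th)
  (f g q : R -> 'rV[R]_d -> 'rV[R]_d)
  (hf : continuous_in_L2 (vol R d) Omega Tmax f)
  (hg : continuous_in_H1 Omega Tmax g)
  (hq : continuous_in_L2 (surf R d) (neumann_part Omega Gamma0) Tmax q)
  (phi0 : 'rV[R]_d -> 'M[R]_d) (hphi0 : Psi Omega phi0)
  (gh : nat -> 'rV[R]_d -> 'rV[R]_d)
  (hgh : forall k, (k <= Num.truncn (Tmax / tau))%N -> Xh Omega Th (gh k))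
  (phi0h : 'rV[R]_d -> 'M[R]_d) (hphi0h : Psih Omega Th phi0h) :
  exists (u : nat -> 'rV[R]_d -> 'rV[R]_d) (phi : nat -> 'rV[R]_d -> 'M[R]_d),
    discrete_solution Omega Gamma0 Th lam mu eta alpha tau
      (Num.truncn (Tmax / tau)) f q gh phi0h u phi /\
    forall (u' : nat -> 'rV[R]_d -> 'rV[R]_d)
           (phi' : nat -> 'rV[R]_d -> 'M[R]_d),
      discrete_solution Omega Gamma0 Th lam mu eta alpha tau
        (Num.truncn (Tmax / tau)) f q gh phi0h u' phi' ->
      forall k, (k <= Num.truncn (Tmax / tau))%N ->
        (forall x, closure Omega x -> u' k x = u k x) /\
        phi' k = phi k %[ae vol R d in Omega].
Proof.
have [Oop Oconn Obd _] := hOmega; have [[U oU G0E] G0pos _] := hGamma0.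
have G0b : Gamma0 `<=` bdry Omega by rewrite G0E => x [].
set N := Num.truncn (Tmax / tau).
have tk k : (k <= N)%N -> k%:R * tau \in `[0, Tmax].
  move=> kN; rewrite in_itv /= mulr_ge0 ?ler0n ?(ltW htau) //= -ler_pdivlMr //.
  apply: (@le_trans _ _ N%:R); first by rewrite ler_nat.
  by have /andP[] := truncn_itv (divr_ge0 (ltW hT) (ltW htau)).
have fL k (kN : (k <= N)%N) := (hf _ (tk k kN)).1.
have qL k (kN : (k <= N)%N) := (hq _ (tk k kN)).1.
pose eq k u phi := equilibrium Omega Gamma0 Th lam mu (f (k%:R * tau)) (q (k%:R * tau)) (gh k) u phi.
pose step u phi x := euler_step lam mu eta alpha tau (strain Omega u x) (phi x).
have Pstep := Psih_euler_step Obd hTh heta halpha htau hC.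
have [u0 eq0] : exists u, eq 0%N u phi0h.
  exact: (equilibrium_exists Obd Oconn hTh G0b G0pos hC (fL 0%N _) (qL 0%N _) (hgh 0%N _)).
(* next picks a displacement at each time step from the previous internal
   variable; outside the admissible data its value is irrelevant *)
have /choice[next nextP] : forall kp : nat * ('rV[R]_d -> 'M[R]_d), exists u,
    (kp.1 <= N)%N -> Psih Omega Th kp.2 -> eq kp.1 u (step u kp.2).
  move=> [k p] /=; have [kN|] := boolP (k <= N)%N; last by exists (fun=> 0).
  have [pP|] := pselect (Psih Omega Th p); last by exists (fun=> 0).
  have [u uP] := step_exists Obd Oconn hTh G0b G0pos heta halpha htau hC (fL k kN) (qL k kN) (hgh k kN) pP.
  by exists u.
pose s := fix s k := if k is k'.+1 then
    let u := next (k, (s k').2) in (u, step u (s k').2) else (u0, phi0h).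
pose u k := (s k).1; pose phi k := (s k).2.
have main k : (k <= N)%N -> eq k (u k) (phi k) /\ Psih Omega Th (phi k).
  elim: k => [|k IH] kN; first by split.
  have [_ pP] := IH (ltnW kN); have uP := nextP (k.+1, phi k) kN pP.
  have uX : Xh Omega Th (next (k.+1, phi k)) by case: uP => -[].
  by split; [exact: uP|exact: (Pstep _ _ uX pP)].
have bdiffE (v : nat -> 'rV[R]_d -> 'rV[R]_d) (p : nat -> 'rV[R]_d -> 'M[R]_d) k x :
    eta *: bdiff tau p k x + alpha *: p k x - stress Omega lam mu (v k) (p k) x = 0 <->
    p k x = step (v k) (p k.-1) x.
  exact: (euler_stepP heta halpha htau hC).
exists u, phi; split.
  split.
  - by move=> k kN; have [[Vu _] pP] := main k kN.
  - exact: aeW.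
  - by move=> k kN v Vv; have [[_ uP] _] := main k kN; exact: uP.
  - by move=> [//|k] _; apply: aeW => x _; apply/(bdiffE u phi k.+1).
move=> u' phi' [VP' p0' eq' rel'].
elim=> [|k IH] kN.
  have pp : phi' 0%N = phi 0%N %[ae vol R d in Omega] by exact: p0'.
  split=> //; have [e0 P0] := main _ kN; have [V0' P0'] := VP' _ kN.
  apply: (equilibrium_unique Obd Oconn hTh G0b G0pos hC (hgh _ kN) P0 P0' pp e0).
  by split=> // v Vv; exact: eq'.
have [_ pp] := IH (ltnW kN); have [e0 P0] := main _ kN; have [V0' P0'] := VP' _ kN.
apply: (step_unique Obd Oconn hTh G0b G0pos heta halpha htau hC (hgh _ kN) P0 P0' pp _ _ e0).
- exact: aeW.
- by apply: ae_mono (rel' k.+1 kN) => x h Ox; apply/(bdiffE u' phi' k.+1); exact: h.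
- by split=> // v Vv; exact: eq'.
Qed.
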